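(* Let $\alpha>0$, let $\mu$ be a positive Borel measure on $(0,\infty)$ and let $0<p<2$. (i) If $\sum_{n=0}^\infty\mu^{\frac{2p}{2-p}}_n\sqrt{n+1} <\infty$, then $\mathcal{H}_\mu:F^2_\alpha\to F^p_\alpha$ is bounded. (ii) If $\mathcal{H}_\mu:F^2_\alpha\to F^p_\alpha$ is bounded, then $\sum_{n=0}^\infty\mu^{\frac{2p}{2-p}}_n <\infty$.
   Context: For $\alpha>0$ and $0<p<\infty$, $F^p_\alpha$ is the space of entire functions $f$ with $\|f\|_{p,\alpha}=\left(\frac{\alpha p}{2\pi}\int_{\mathbb C}|f(z)e^{-\frac{\alpha}{2}|z|^2}|^p\,dA(z)\right)^{1/p}<\infty$ ($dA$ is area measure). The Hausdorff operator is $\mathcal{H}_\mu(f)(z)=\int_0^\infty f\left(\frac{z}{t}\right)\frac{d\mu(t)}{t}$ for entire $f$, and $\mu_n=\int_0^\infty\frac{d\mu(t)}{t^{n+1}}$ for $n=0,1,2,\dots$. ''$\mathcal{H}_\mu:X\to Y$ is bounded'' means it is well defined on $X$ with values in $Y$ and there is $C>0$ with $\|\mathcal{H}_\mu f\|_Y\le C\|f\|_X$ for all $f\in X$. *)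

(* Defs.v *)
From HB Require Import structures.
From mathcomp Require Import all_boot all_order all_algebra.
From mathcomp Require Import all_classical all_reals all_analysis.
From mathcomp Require Import complex.

Set Implicit Arguments.
Unset Strict Implicit.
Unset Printing Implicit Defensive.

Import Order.TTheory GRing.Theory Num.Theory.
Import numFieldNormedType.Exports.

Local Open Scope classical_set_scope.
Local Open Scope ring_scope.
Local Open Scope complex_scope.
Local Open Scope ereal_scope.

(* Derivability is over the field R[i], hence in the complex sense. *)
Definition entire (R : realType) (f : R[i] -> R[i]) : Prop :=
  forall z : R[i], derivable (f : R[i]^o -> R[i]^o) z 1%R.

Definition cmod (R : realType) (z : R[i]) : R := complex.Re `|z|%R.

(* The integral over the plane is taken in the coordinates z = x + iy,
   with the product Lebesgue measure on R * R as area measure. *)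
Definition fock_norm (R : realType) (alpha p : R) (f : R[i] -> R[i]) : \bar R :=
  ((alpha * p / (2 * pi))%:E *
   \int[(@lebesgue_measure R \x @lebesgue_measure R)]_w
     ((cmod (f (w.1 +i* w.2)%C) *
       expR (- (alpha / 2) * cmod (w.1 +i* w.2)%C ^+ 2)) `^ p)%:E) `^ p^-1.

Definition fock (R : realType) (alpha p : R) (f : R[i] -> R[i]) : Prop :=
  entire f /\ fock_norm alpha p f < +oo.

Definition cintegrable (d : measure_display) (T : measurableType d)
    (R : realType) (mu : {measure set T -> \bar R}) (D : set T)
    (g : T -> R[i]) : Prop :=
  mu.-integrable D (fun t => (complex.Re (g t))%:E) /\
  mu.-integrable D (fun t => (complex.Im (g t))%:E).

Definition cintegral (d : measure_display) (T : measurableType d)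
    (R : realType) (mu : {measure set T -> \bar R}) (D : set T)
    (g : T -> R[i]) : R[i] :=
  (Rintegral mu D (fun t => complex.Re (g t)) +i*
   Rintegral mu D (fun t => complex.Im (g t)))%C.

(* A positive Borel measure on (0, +oo) is represented by a Borel measure on R
   that is only ever integrated against over `]0, +oo[; its values outside
   `]0, +oo[ play no role, and no finiteness is assumed. *)
Section Hausdorff.
Variables (R : realType) (mu : {measure set (measurableTypeR R) -> \bar R}).

Definition hausdorff_integrand (f : R[i] -> R[i]) (z : R[i]) (t : R) : R[i] :=
  (f (z / t%:C%C) / t%:C%C)%R.

Definition hausdorff (f : R[i] -> R[i]) (z : R[i]) : R[i] :=
  cintegral mu `]0%R, +oo[ (hausdorff_integrand f z).

Definition hausdorff_moment (n : nat) : \bar R :=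
  \int[mu]_(t in `]0%R, +oo[) ((t ^+ n.+1)^-1)%:E.

(* [hausdorff] is total (Rintegral has a junk value), so being well defined on
   the source space is the first conjunct. *)
Definition hausdorff_bounded (alpha p q : R) : Prop :=
  [/\ forall f, fock alpha p f -> forall z,
        cintegrable mu `]0%R, +oo[ (hausdorff_integrand f z),
      forall f, fock alpha p f -> fock alpha q (hausdorff f) &
      exists2 C : R, (0 < C)%R & forall f, fock alpha p f ->
        fock_norm alpha q (hausdorff f) <= C%:E * fock_norm alpha p f].

End Hausdorff.

(* Main.v *)
Require Import Defs.
From HB Require Import structures.
From mathcomp Require Import all_boot all_order all_algebra.
From mathcomp Require Import all_classical all_reals all_analysis.
From mathcomp Require Import complex measurable_realfun.
From mathcomp Require Import ring lra.

Set Implicit Arguments.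
Unset Strict Implicit.
Unset Printing Implicit Defensive.

Import Order.TTheory GRing.Theory Num.Theory.
Import numFieldNormedType.Exports.

Local Open Scope classical_set_scope.
Local Open Scope ring_scope.

(** Write [q = p / 2], [s = 2 p / (2 - p)], and for an entire [f] with Taylor
    coefficients [a n] put [B n = |a n|^2 n! / alpha^n]; up to constants
    [sum B n] is the squared norm of [f] in [F^2_alpha].  The Hausdorff operator
    multiplies [a n] by the moment [mu_n], hence [B n] by [mu_n^2].  In polar
    coordinates [alpha |z|^2] has a multiple of Lebesgue measure as its law, and
    [|z|^(2n) exp(- alpha |z|^2)] becomes a multiple of the Poisson weight
    [w_n(x) = x^n e^(-x) / n!].

    (i) Averaging over the rotations by roots of unity, concavity of [t^q] and
    Parseval bound [int |H f|^p exp(- p alpha |z|^2 / 2)] by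
    [int (sum B n mu_n^2 w_n)^q <= sum (B n)^q mu_n^p int w_n^q].  As [w_n] is
    concentrated on an interval of length of order [sqrt n] and has height of
    order [1 / sqrt n], [int w_n^q] is of order [sqrt(n + 1)^(1 - q)], and
    Hoelder's inequality with exponents [1 / q] and [1 / (1 - q)] brings out
    [sum mu_n^s sqrt(n + 1)].

    (ii) Test the operator on [f = sum_(n < N) +-c_n z^n] with [B n = mu_n^s].
    Averaging over the signs, Khintchine's inequality and concavity (the [w_n]
    have sum at most [1]) bound the mean of [int |H f|^p] from below by a multiple
    of [sum_(n < N) (B n mu_n^2)^q = S_N], where [S_N = sum_(n < N) mu_n^s], while
    boundedness gives the upper bound [C (sum B n)^q = C S_N^q].  As [q < 1],
    [S_N] stays bounded.

    Taylor expansion of entire functions is obtained from Goursat's theorem on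
    rectangles. *)

(** * Complex modulus, derivative and integral *)

(** The exponent [s] solves [s = q (s + 2)], equivalently [s (1 - q) = 2 q]. In (i) this turns
    [mu_n^p] into [(mu_n^s)^(1 - q)]; in (ii) it makes [(B n mu_n^2)^q] equal to [B n]. The factor
    [sqrt(n + 1)] that separates the two halves is the price of subadditivity in (i): splitting
    [(sum B n mu_n^2 w_n)^q] term by term ignores that about [sqrt n] neighbouring weights overlap,
    whereas Jensen's inequality in (ii) meets only [int w_n = 1].

    The operator acts on coefficients only once all moments are finite and sum and integral may be
    exchanged. In (i) finiteness follows from summability; in (ii) it comes from the operator being
    defined on monomials at [z = 1].

    Boundedness tolerates constants, so none is optimised: the area of a disc stays an unnamed
    positive number and Bessel's inequality loses a factor 2. Finite averages over roots of unity
    replace integration in the angle: rotation invariance of area and orthogonality of finitely many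
    powers suffice, and polar coordinates reduce to the law of the radius. *)

Section ComplexModulus.
Variable R : realType.
Local Notation C := R[i].
Implicit Types z w : C.

Lemma cmodC z : (cmod z)%:C%C = `|z|.
Proof. by []. Qed.

Lemma cmod_ge0 z : 0 <= cmod z.
Proof. by case: z => x y; exact: sqrtr_ge0. Qed.

Lemma cmodM z w : cmod (z * w) = cmod z * cmod w.
Proof. exact: Normc.normcM. Qed.

Lemma cmodD z w : cmod (z + w) <= cmod z + cmod w.
Proof. exact: le_normcD. Qed.

Lemma cmodN z : cmod (- z) = cmod z.
Proof. exact: normcN. Qed.

Lemma cmodB z w : cmod (z - w) <= cmod z + cmod w.
Proof. by rewrite -(cmodN w) cmodD. Qed.

Lemma cmodBC z w : cmod (z - w) = cmod (w - z).
Proof. by rewrite -cmodN opprB. Qed.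

Lemma cmod0 : cmod (0 : C) = 0.
Proof. exact: Normc.normc0. Qed.

Lemma cmod1 : cmod (1 : C) = 1.
Proof. exact: Normc.normc1. Qed.

Lemma cmodV z : cmod z^-1 = (cmod z)^-1.
Proof. exact: Normc.normcV. Qed.

Lemma cmodX z n : cmod (z ^+ n) = cmod z ^+ n.
Proof. by elim: n => [|n IH]; rewrite ?expr0 ?cmod1 // !exprS cmodM IH. Qed.

Lemma cmod_sqr z : cmod z ^+ 2 = complex.Re z ^+ 2 + complex.Im z ^+ 2.
Proof. by case: z => x y; rewrite sqr_sqrtr // addr_ge0 // sqr_ge0. Qed.

Lemma cmod_real (x : R) : cmod (x%:C%C) = `|x|.
Proof. by rewrite /cmod /= expr0n /= addr0 sqrtr_sqr. Qed.

Lemma cmodi : cmod ('i%C : C) = 1.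
Proof. by rewrite /cmod /= expr0n /= add0r expr1n sqrtr1. Qed.

Lemma cmod_eq0 z : (cmod z == 0) = (z == 0).
Proof.
apply/eqP/eqP => [|->]; last exact: cmod0.
exact: Normc.eq0_normc.
Qed.

Lemma cmod_gt0 z : (0 < cmod z) = (z != 0).
Proof. by rewrite lt_def cmod_ge0 andbT cmod_eq0. Qed.

Lemma Re_le_cmod z : `|complex.Re z| <= cmod z.
Proof.
rewrite -ler_sqr ?nnegrE ?cmod_ge0 // cmod_sqr real_normK ?num_real //.
by rewrite lerDl sqr_ge0.
Qed.

Lemma Im_le_cmod z : `|complex.Im z| <= cmod z.
Proof.
rewrite -ler_sqr ?nnegrE ?cmod_ge0 // cmod_sqr real_normK ?num_real //.
by rewrite lerDr sqr_ge0.
Qed.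

Lemma cmod_le_ReIm z : cmod z <= `|complex.Re z| + `|complex.Im z|.
Proof.
rewrite -ler_sqr ?nnegrE ?cmod_ge0 ?addr_ge0 // cmod_sqr sqrrD.
by rewrite !real_normK ?num_real // lerD2r lerDl mulrn_wge0 // mulr_ge0.
Qed.

Lemma cmod_sum (I : Type) (r : seq I) (P : pred I) (F : I -> C) :
  cmod (\sum_(i <- r | P i) F i) <= \sum_(i <- r | P i) cmod (F i).
Proof.
elim/big_ind2 : _ => [|x a y b xa yb|//]; first by rewrite cmod0.
by rewrite (le_trans (cmodD _ _))// lerD.
Qed.

Lemma ReD z w : complex.Re (z + w) = complex.Re z + complex.Re w.
Proof. by case: z w => [? ?] [? ?]. Qed.

Lemma ImD z w : complex.Im (z + w) = complex.Im z + complex.Im w.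
Proof. by case: z w => [? ?] [? ?]. Qed.

Lemma ReB z w : complex.Re (z - w) = complex.Re z - complex.Re w.
Proof. by case: z w => [? ?] [? ?]. Qed.

Lemma ImB z w : complex.Im (z - w) = complex.Im z - complex.Im w.
Proof. by case: z w => [? ?] [? ?]. Qed.

Lemma Re_mul z w : complex.Re (z * w) =
  complex.Re z * complex.Re w - complex.Im z * complex.Im w.
Proof. by case: z w => [? ?] [? ?]. Qed.

Lemma Im_mul z w : complex.Im (z * w) =
  complex.Re z * complex.Im w + complex.Im z * complex.Re w.
Proof. by case: z w => [? ?] [? ?]. Qed.

Lemma eq_ReIm z w : complex.Re z = complex.Re w -> complex.Im z = complex.Im w ->
  z = w.
Proof. by case: z w => [? ?] [? ?] /= -> ->. Qed.

End ComplexModulus.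

Section ComplexDerivative.
Variable R : realType.
Local Notation C := R[i].
Implicit Types (f g : C -> C) (z w D : C).

(** Differentiability with real [e] and [d] and without a quotient: no case [h = 0] to exclude, and
    no use of the partial order of [R[i]]. *)
Definition cder f z D := forall e : R, 0 < e -> exists2 d, 0 < d &
  forall h, cmod h < d -> cmod (f (z + h) - f z - D * h) <= e * cmod h.

Lemma derivable_cder f z : derivable (f : C^o -> C^o) z 1 ->
  exists D, cder f z D.
Proof.
move=> /cvg_ex[/= D HD]; exists D => e e0.
have e0' : (0 : C) < e%:C%C by rewrite ltcR.
move/cvgrPdist_le : HD => /(_ _ e0') /nbhs_ballP[/= d d0 dP].
exists (cmod d) => [|h hd]; first by rewrite cmod_gt0 gt_eqF.
have [->|h0] := eqVneq h 0; first by rewrite addr0 subrr mulr0 subr0 cmod0 mulr0.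
have dE : d = (cmod d)%:C%C by rewrite cmodC gtr0_norm.
have := dP h; rewrite /ball /= sub0r normrN => /(_ _ h0).
rewrite -cmodC dE ltcR => /(_ hd).
rewrite (_ : h%:A = h :> R[i]^o); last exact: mulr1.
rewrite -[h^-1 *: _]/(h^-1 * _) -cmodC lecR => H.
have -> : f (z + h) - f z - D * h = - (D - h^-1 * (f (h + z) - f z)) * h.
  by rewrite addrC [h + z]addrC; field.
by rewrite cmodM cmodN ler_wpM2r ?cmod_ge0.
Qed.

Lemma cder_derivable f z D : cder f z D -> derivable (f : C^o -> C^o) z 1.
Proof.
move=> HD; apply/cvg_ex; exists D => /=.
apply/cvgrPdist_le => e e0.
have eE : e = (cmod e)%:C%C by rewrite cmodC gtr0_norm.
have ce0 : 0 < cmod e by rewrite cmod_gt0 gt_eqF.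
have [d d0 dP] := HD _ ce0.
apply/nbhs_ballP; exists (d%:C%C) => /=; first by rewrite ltcR.
move=> h; rewrite /ball /= sub0r normrN => hd h0.
have hd' : cmod h < d by rewrite -ltcR.
have := dP _ hd'.
have -> : f (z + h) - f z - D * h = - (D - h^-1 * (f (h + z) - f z)) * h.
  by rewrite addrC [h + z]addrC; field.
rewrite cmodM cmodN ler_pM2r ?cmod_gt0 // => H.
rewrite (_ : h%:A = h :> R[i]^o); last exact: mulr1.
by rewrite eE -[h^-1 *: _]/(h^-1 * _) -cmodC lecR.
Qed.

Lemma cder_cont f z D : cder f z D ->
  forall e, 0 < e -> exists2 d, 0 < d &
    forall w, cmod (w - z) < d -> cmod (f w - f z) <= e.
Proof.
move=> fD e e0; have [d d0 dP] := fD _ ltr01.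
have D1 : 0 < 1 + cmod D by rewrite ltr_wpDr ?cmod_ge0.
exists (Num.min d (e / (1 + cmod D))); first by rewrite lt_min d0 divr_gt0.
move=> w; rewrite lt_min => /andP[/dP + he].
rewrite mul1r [z + _]addrC subrK => H.
have -> : f w - f z = (f w - f z - D * (w - z)) + D * (w - z) by ring.
rewrite (le_trans (cmodD _ _))// cmodM (le_trans (lerD H (lexx _)))//.
rewrite -{1}[cmod (w - z)]mul1r -mulrDl.
by rewrite ltW // mulrC -ltr_pdivlMr.
Qed.

End ComplexDerivative.

Section ComplexIntegral.
Context d (T : measurableType d) (R : realType).
Variables (mu : {measure set T -> \bar R}) (D : set T) (mD : measurable D).
Local Notation C := R[i].
Implicit Types (g h : T -> C) (G : T -> R).

Lemma eq_cintegral g h : (forall x, D x -> g x = h x) ->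
  cintegral mu D g = cintegral mu D h.
Proof.
move=> gh; rewrite /cintegral; congr (_ +i* _)%C;
  by apply: eq_Rintegral => x; rewrite inE => Dx; rewrite gh.
Qed.

Lemma eq_cintegrable g h : (forall x, D x -> g x = h x) ->
  cintegrable mu D g -> cintegrable mu D h.
Proof.
move=> gh [g1 g2]; split.
- by apply: eq_integrable g1 => // x; rewrite inE => Dx; rewrite gh.
- by apply: eq_integrable g2 => // x; rewrite inE => Dx; rewrite gh.
Qed.

Lemma cintegrableD g h : cintegrable mu D g -> cintegrable mu D h ->
  cintegrable mu D (fun x => g x + h x).
Proof.
move=> [g1 g2] [h1 h2]; split.
- apply: (eq_integrable mD (_ \+ _)%E _ _ (integrableD mD g1 h1)).
  by move=> x _ /=; rewrite ReD.
- apply: (eq_integrable mD (_ \+ _)%E _ _ (integrableD mD g2 h2)).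
  by move=> x _ /=; rewrite ImD.
Qed.

Lemma cintegralD g h : cintegrable mu D g -> cintegrable mu D h ->
  cintegral mu D (fun x => g x + h x) = cintegral mu D g + cintegral mu D h.
Proof.
move=> [g1 g2] [h1 h2]; apply: eq_ReIm; rewrite ?ReD ?ImD /cintegral /=.
- by rewrite -RintegralD //; apply: eq_Rintegral => x _; rewrite ReD.
- by rewrite -RintegralD //; apply: eq_Rintegral => x _; rewrite ImD.
Qed.

Let integrableZ (k : R) (f : T -> R) : mu.-integrable D (EFin \o f) ->
  mu.-integrable D (EFin \o (fun x => k * f x)).
Proof.
move=> fi; apply: (eq_integrable mD _ _ _ (integrableZl mD k fi)).
by move=> x _ /=.
Qed.

Lemma cintegrableZ (k : C) g : cintegrable mu D g ->
  cintegrable mu D (fun x => k * g x).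
Proof.
move=> [g1 g2]; split.
- apply: (eq_integrable mD (_ \- _)%E _ _ (integrableB mD
    (integrableZ (complex.Re k) g1) (integrableZ (complex.Im k) g2))).
  by move=> x _ /=; rewrite Re_mul.
- apply: (eq_integrable mD (_ \+ _)%E _ _ (integrableD mD
    (integrableZ (complex.Re k) g2) (integrableZ (complex.Im k) g1))).
  by move=> x _ /=; rewrite Im_mul.
Qed.

Lemma cintegralZ (k : C) g : cintegrable mu D g ->
  cintegral mu D (fun x => k * g x) = k * cintegral mu D g.
Proof.
move=> [g1 g2]; apply: eq_ReIm; rewrite ?Re_mul ?Im_mul /cintegral /=.
- rewrite -!RintegralZl // -RintegralB //; try exact: integrableZ.
  by apply: eq_Rintegral => x _; rewrite Re_mul.
- rewrite -!RintegralZl // -RintegralD //; try exact: integrableZ.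
  by apply: eq_Rintegral => x _; rewrite Im_mul.
Qed.

Lemma cintegralB g h : cintegrable mu D g -> cintegrable mu D h ->
  cintegral mu D (fun x => g x - h x) = cintegral mu D g - cintegral mu D h.
Proof.
move=> gi hi; rewrite -[X in _ + X]mulN1r -cintegralZ // -cintegralD //.
  by apply: eq_cintegral => x _; rewrite mulN1r.
exact: cintegrableZ.
Qed.

(* Real and imaginary parts are bounded separately, whence the factor 2. *)
Lemma cmod_cintegral_le g G : cintegrable mu D g ->
  mu.-integrable D (EFin \o G) -> (forall x, D x -> cmod (g x) <= G x) ->
  cmod (cintegral mu D g) <= 2 * Rintegral mu D G.
Proof.
move=> [g1 g2] Gi gG.
have H (k : T -> R) : mu.-integrable D (EFin \o k) ->
    (forall x, D x -> `|k x| <= G x) -> `|Rintegral mu D k| <= Rintegral mu D G.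
  move=> ki kG; rewrite (le_trans (le_normr_Rintegral _ _))//.
  apply: le_Rintegral => //.
  exact: (eq_integrable mD _ _ _ (integrable_norm ki)).
rewrite (le_trans (cmod_le_ReIm _))// mulr_natl mulr2n lerD // H //.
- by move=> x Dx; rewrite (le_trans (Re_le_cmod _))// gG.
- by move=> x Dx; rewrite (le_trans (Im_le_cmod _))// gG.
Qed.

End ComplexIntegral.

(** * Complex integrals along segments *)

Section SegmentIntegral.
Variable R : realType.
Local Notation C := R[i].
Local Notation leb := (@lebesgue_measure R).
Implicit Types (g h : R -> C) (a b : R).

Definition cint a b g : C := cintegral leb `[a, b] g.

(** [y] ranges over the whole line and not only over the segment: the integrands are traces of
    functions on the plane, differentiable at the points of the contour. *)
Definition ccont a b g := forall x, a <= x <= b ->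
  forall e : R, 0 < e -> exists2 d, 0 < d &
    forall y, `|y - x| < d -> cmod (g y - g x) <= e.

(** Serves for the real part, the imaginary part and the modulus of [g], all 1-Lipschitz in [g]. *)
Lemma ccontP a b g (k : R -> R) :
  (forall x y, `|k y - k x| <= cmod (g y - g x)) ->
  ccont a b g -> {within `[a, b], continuous k}.
Proof.
move=> kg gc; apply: continuous_in_subspaceT => x; rewrite inE /= in_itv /= => xab.
apply/cvgrPdist_le => e e0; have [d d0 dP] := gc _ xab _ e0.
apply/nbhs_ballP; exists d => // y; rewrite /ball /= => yd.
by rewrite distrC (le_trans (kg _ _))// dP // distrC.
Qed.

Lemma ccont_integrable a b g : ccont a b g -> cintegrable leb `[a, b] g.
Proof.
move=> gc; split; (apply: continuous_compact_integrable;
  first exact: segment_compact).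
- by apply: (@ccontP a b g) gc => x y; rewrite -ReB Re_le_cmod.
- by apply: (@ccontP a b g) gc => x y; rewrite -ImB Im_le_cmod.
Qed.

Lemma cint_split m a b g : a <= m <= b -> ccont a b g ->
  cint a b g = cint a m g + cint m b g.
Proof.
move=> /andP[am mb] gc.
have H k : leb.-integrable `[a, b] (EFin \o k) ->
    Rintegral leb `[a, b] k = Rintegral leb `[a, m] k + Rintegral leb `[m, b] k.
  move=> ki.
  have ki' : leb.-integrable `]m, b] (EFin \o k).
    by apply: integrableS ki => //; apply: subset_itvr; rewrite bnd_simp.
  rewrite -(@Rintegral_itv_obnd_cbnd _ m (BRight b)) //.
  rewrite -(@Rintegral_itvB _ k (BLeft a) (BRight b) m) ?bnd_simp //.
  by rewrite addrC subrK.
have [g1 g2] := ccont_integrable gc.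
by rewrite /cint /cintegral !H //; apply: eq_ReIm.
Qed.

Lemma fine_leb_itv a b : a <= b -> fine (leb `[a, b]) = b - a.
Proof.
move=> ab; rewrite lebesgue_measure_itv /= lte_fin; case: ltP => // ba.
by rewrite (@le_anti _ _ a b) ?ab // subrr.
Qed.

Lemma cint_cst a b (k : C) : a <= b -> cint a b (fun=> k) = (b - a)%:C%C * k.
Proof.
move=> ab; rewrite /cint /cintegral !Rintegral_cst //.
rewrite fine_leb_itv //.
by case: k => x y; apply: eq_ReIm => /=; rewrite ?Re_mul ?Im_mul /=; ring.
Qed.

Lemma cst_integrable a b (M : R) : leb.-integrable `[a, b] (EFin \o cst M).
Proof.
apply: continuous_compact_integrable; first exact: segment_compact.
by apply: continuous_in_subspaceT => x _; exact: cvg_cst.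
Qed.

Lemma cint_bound a b g M : a <= b -> ccont a b g ->
  (forall x, a <= x <= b -> cmod (g x) <= M) ->
  cmod (cint a b g) <= 2 * ((b - a) * M).
Proof.
move=> ab gc gM.
have := @cmod_cintegral_le _ _ _ leb `[a, b] _ g (cst M) (ccont_integrable gc)
  (cst_integrable a b M).
rewrite Rintegral_cst // fine_leb_itv //.
by rewrite [M * _]mulrC; apply=> // x; rewrite /= in_itv /=; exact: gM.
Qed.

Lemma ccontD a b g h : ccont a b g -> ccont a b h -> ccont a b (fun x => g x + h x).
Proof.
move=> gc hc x xab e e0.
have e2 : 0 < e / 2 by rewrite divr_gt0.
have [d d0 dP] := gc _ xab _ e2; have [d' d0' dP'] := hc _ xab _ e2.
exists (Num.min d d') => [|y]; rewrite lt_min ?d0 // => /andP[yd yd'].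
rewrite opprD addrACA (le_trans (cmodD _ _))// (splitr e).
by rewrite lerD ?dP ?dP'.
Qed.

Lemma ccontZ a b (k : C) g : ccont a b g -> ccont a b (fun x => k * g x).
Proof.
move=> gc x xab e e0.
have k0 : 0 < cmod k + 1 by rewrite ltr_wpDl ?cmod_ge0.
have [d d0 dP] := gc _ xab _ (divr_gt0 e0 k0).
exists d => // y /dP; rewrite -mulrBr cmodM ler_pdivlMr // => H.
by rewrite (le_trans _ H)// mulrC ler_wpM2l ?cmod_ge0 // lerDl.
Qed.

Lemma ccontB a b g h : ccont a b g -> ccont a b h -> ccont a b (fun x => g x - h x).
Proof.
move=> gc /(@ccontZ _ _ (-1)) hc x xab e e0.
have [d d0 dP] := ccontD gc hc xab e0; exists d => // y /dP.
by rewrite !mulN1r.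
Qed.

Lemma cintD a b g h : ccont a b g -> ccont a b h ->
  cint a b (fun x => g x + h x) = cint a b g + cint a b h.
Proof. by move=> /ccont_integrable ? /ccont_integrable ?; apply: cintegralD. Qed.

Lemma cintB a b g h : ccont a b g -> ccont a b h ->
  cint a b (fun x => g x - h x) = cint a b g - cint a b h.
Proof. by move=> /ccont_integrable ? /ccont_integrable ?; apply: cintegralB. Qed.

Lemma cintZ a b k g : ccont a b g ->
  cint a b (fun x => k * g x) = k * cint a b g.
Proof. by move=> /ccont_integrable ?; apply: cintegralZ. Qed.

Lemma eq_cint a b g h : (forall x, a <= x <= b -> g x = h x) ->
  cint a b g = cint a b h.
Proof. by move=> gh; apply: eq_cintegral => x /=; rewrite in_itv; exact: gh. Qed.

Lemma ccont_bounded a b g : ccont a b g ->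
  exists2 M, 0 <= M & forall x, a <= x <= b -> cmod (g x) <= M.
Proof.
move=> gc; have cc : {within `[a, b], continuous (fun x => cmod (g x))}.
  apply: (ccontP _ gc) => x y; rewrite ler_norml; apply/andP; split.
    rewrite lerBrDr addrC -lerBrDr opprK cmodBC.
    by rewrite -{1}(subrK (g y) (g x)) addrC cmodD.
  by rewrite lerBlDr (le_trans _ (cmodD _ _)) // subrK.
have [ab|ba] := leP a b; last first.
  exists 0 => // x /andP[ax xb]; have := lt_le_trans ba ax.
  by rewrite ltNge xb.
have [c _ cP] := @EVT_max R _ a b ab cc.
by exists (cmod (g c)) => [|x xab]; [exact: cmod_ge0|exact: cP].
Qed.

End SegmentIntegral.

(** * Translation invariance of Lebesgue measure *)

Section LebesgueInvariance.
Variable R : realType.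
Local Notation leb := (@lebesgue_measure R).

Lemma measurable_addr (s : R) : measurable_fun setT
  (fun x : measurableTypeR R => x + s : measurableTypeR R).
Proof. exact: measurable_funD. Qed.

(** A measure with the right values on the intervals []a, b]] is Lebesgue measure, and the image
    under a translation has them. *)
Lemma lebesgue_translate (s : R) (A : set (measurableTypeR R)) : measurable A ->
  pushforward leb (fun x : measurableTypeR R => x + s : measurableTypeR R) A = leb A.
Proof.
move=> mA; apply/esym/lebesgue_measure_unique => //=.
  exact: measurable_addr.
move=> mf _ [[a b]] _ <-; rewrite /pushforward.
have -> : (fun x => x + s) @^-1` `]a, b] = `]a - s, b - s]%classic.
  by apply/seteqP; split => x /=; rewrite !in_itv /= ltrBlDr lerBrDr.
rewrite !lebesgue_measure_itv /= !lte_fin ltrD2r; case: ifP => // _.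
by rewrite -!EFinB; congr _%:E; ring.
Qed.

Lemma ge0_integral_translate (s : R) (f : R -> \bar R) :
  measurable_fun setT f -> (forall x, 0 <= f x)%E ->
  (\int[leb]_x f (x + s)%R = \int[leb]_x f x)%E.
Proof.
move=> mf f0.
have := @ge0_integral_pushforward _ _ _ _ R _ (measurable_addr s) leb setT f
  measurableT mf (fun x _ => f0 x).
rewrite preimage_setT /comp => <-; apply: eq_measure_integral => [|? A mA _].
  exact: measurable_addr.
by rewrite /= lebesgue_translate.
Qed.

Lemma ge0_integral_translate_itv (s a b : R) (f : R -> \bar R) :
  measurable_fun `[a, b] f -> (forall x, 0 <= f x)%E ->
  (\int[leb]_(x in `[(a - s)%R, (b - s)%R]) f (x + s)%R =
   \int[leb]_(x in `[a, b]) f x)%E.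
Proof.
move=> mf f0.
have := @ge0_integral_pushforward _ _ _ _ R _ (measurable_addr s) leb `[a, b] f
  (measurable_itv _) mf (fun x _ => f0 x).
have -> : (fun x => x + s) @^-1` `[a, b] = `[a - s, b - s]%classic.
  by apply/seteqP; split => x /=; rewrite !in_itv /= lerBlDr lerBrDr.
rewrite /comp => <-; apply: eq_measure_integral => [|? A mA _].
  exact: measurable_addr.
by rewrite /= lebesgue_translate.
Qed.

Lemma Rintegral_translate_itv (s a b : R) (f : R -> R) :
  measurable_fun `[a, b] f ->
  Rintegral leb `[a - s, b - s] (fun x => f (x + s)) = Rintegral leb `[a, b] f.
Proof.
move=> mf; rewrite /Rintegral !(integralE _ _ (fun x => EFin _)) /=.
have /measurable_EFinP mE := mf.
congr fine; congr (_ - _)%E.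
- have H := @ge0_integral_translate_itv s a b _ (measurable_funepos mE)
    (funepos_ge0 _).
  by apply: etrans H; apply: eq_integral => x _; rewrite !funeposE.
- have H := @ge0_integral_translate_itv s a b _ (measurable_funeneg mE)
    (funeneg_ge0 _).
  by apply: etrans H; apply: eq_integral => x _; rewrite !funenegE.
Qed.

Lemma cint_translate (s a b : R) (g : R -> R[i]) : ccont a b g ->
  cint (a - s) (b - s) (fun x => g (x + s)) = cint a b g.
Proof.
move=> /ccont_integrable[/measurable_int /measurable_EFinP m1
  /measurable_int /measurable_EFinP m2].
apply: eq_ReIm => /=; [exact: (Rintegral_translate_itv s m1)|].
exact: (Rintegral_translate_itv s m2).
Qed.

End LebesgueInvariance.

(** * Goursat's theorem on rectangles *)

Section RectangleIntegral.
Variable R : realType.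
Local Notation C := R[i].
Implicit Types (g h : C -> C) (a b c d x y : R).

Definition pt x y : C := (x +i* y)%C.

Lemma cmod_pt x y : cmod (pt x y) <= `|x| + `|y|.
Proof. exact: cmod_le_ReIm. Qed.

Lemma ptB x y x' y' : pt x y - pt x' y' = pt (x - x') (y - y').
Proof. by []. Qed.

Definition hint g a b c := cint a b (fun x => g (pt x c)).
Definition vint g c d a := cint c d (fun y => g (pt a y)).

(* The contour integral over the boundary of `[a, b] + i `[c, d],
   counterclockwise. *)
Definition rint g a b c d : C :=
  hint g a b c + 'i%C * vint g c d b - hint g a b d - 'i%C * vint g c d a.

Lemma cder_hcont g a b c : (forall x, a <= x <= b -> exists D, cder g (pt x c) D) ->
  ccont a b (fun x => g (pt x c)).
Proof.
move=> gd x /gd[D gD] e e0; have [d d0 dP] := cder_cont gD e0.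
exists d => // y yd; apply: dP; rewrite ptB (le_lt_trans (cmod_pt _ _))//.
by rewrite subrr normr0 addr0.
Qed.

Lemma cder_vcont g c d a : (forall y, c <= y <= d -> exists D, cder g (pt a y) D) ->
  ccont c d (fun y => g (pt a y)).
Proof.
move=> gd x /gd[D gD] e e0; have [r r0 rP] := cder_cont gD e0.
exists r => // y yd; apply: rP; rewrite ptB (le_lt_trans (cmod_pt _ _))//.
by rewrite subrr normr0 add0r.
Qed.

(* Continuity along each of the four sides only: [g] may be singular inside. *)
Definition econt g a b c d := [/\ ccont a b (fun x => g (pt x c)),
  ccont a b (fun x => g (pt x d)), ccont c d (fun y => g (pt a y)) &
  ccont c d (fun y => g (pt b y))].

Lemma rintB g h a b c d : econt g a b c d -> econt h a b c d ->
  rint (fun w => g w - h w) a b c d = rint g a b c d - rint h a b c d.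
Proof.
by move=> [? ? ? ?] [? ? ? ?]; rewrite /rint /hint /vint !cintB //; ring.
Qed.

Lemma rintD g h a b c d : econt g a b c d -> econt h a b c d ->
  rint (fun w => g w + h w) a b c d = rint g a b c d + rint h a b c d.
Proof.
by move=> [? ? ? ?] [? ? ? ?]; rewrite /rint /hint /vint !cintD //; ring.
Qed.

Lemma rintZ k g a b c d : econt g a b c d ->
  rint (fun w => k * g w) a b c d = k * rint g a b c d.
Proof.
by move=> [? ? ? ?]; rewrite /rint /hint /vint !cintZ //; ring.
Qed.

Lemma eq_rint g h a b c d : (forall x y, a <= x <= b -> c <= y <= d ->
    [|| x == a, x == b, y == c | y == d] -> g (pt x y) = h (pt x y)) ->
  a <= b -> c <= d ->
  rint g a b c d = rint h a b c d.
Proof.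
move=> gh ab cd; rewrite /rint /hint /vint.
congr (_ + _ * _ - _ - _ * _); apply: eq_cint => t tab; apply: gh;
  by rewrite ?lexx ?ab ?cd ?eqxx ?orbT.
Qed.

(** The perimeter is [2 * ((b - a) + (d - c))]; the other factor 2 is the one lost in
    [cmod_cintegral_le]. *)
Lemma rint_bound g a b c d M : a <= b -> c <= d -> econt g a b c d ->
  (forall x y, a <= x <= b -> c <= y <= d ->
    [|| x == a, x == b, y == c | y == d] -> cmod (g (pt x y)) <= M) ->
  cmod (rint g a b c d) <= 4 * ((b - a) + (d - c)) * M.
Proof.
move=> ab cd [g1 g2 g3 g4] gM; rewrite /rint.
have H1 : cmod (hint g a b c) <= 2 * ((b - a) * M).
  apply: cint_bound => // x xab; apply: gM => //; rewrite ?lexx //.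
  by rewrite eqxx !orbT.
have H2 : cmod (hint g a b d) <= 2 * ((b - a) * M).
  apply: cint_bound => // x xab; apply: gM => //; rewrite ?lexx ?cd //.
  by rewrite eqxx !orbT.
have H3 : cmod ('i%C * vint g c d a) <= 2 * ((d - c) * M).
  rewrite cmodM cmodi mul1r; apply: cint_bound => // x xab.
  by apply: gM => //; rewrite ?lexx ?ab ?eqxx.
have H4 : cmod ('i%C * vint g c d b) <= 2 * ((d - c) * M).
  rewrite cmodM cmodi mul1r; apply: cint_bound => // x xab.
  by apply: gM => //; rewrite ?lexx ?ab ?eqxx ?orbT.
rewrite (le_trans (cmodB _ _))// (le_trans (lerD (cmodB _ _) (lexx _)))//.
rewrite (le_trans (lerD (lerD (cmodD _ _) (lexx _)) (lexx _)))//.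
by lra.
Qed.

Lemma rint_splitx m g a b c d : a <= m <= b ->
  ccont a b (fun x => g (pt x c)) -> ccont a b (fun x => g (pt x d)) ->
  rint g a b c d = rint g a m c d + rint g m b c d.
Proof.
by move=> mab gc gd; rewrite /rint /hint !(cint_split mab) //; ring.
Qed.

Lemma rint_splity n g a b c d : c <= n <= d ->
  ccont c d (fun y => g (pt a y)) -> ccont c d (fun y => g (pt b y)) ->
  rint g a b c d = rint g a b c n + rint g a b n d.
Proof.
by move=> ncd ga gb; rewrite /rint /vint !(cint_split ncd) //; ring.
Qed.

Lemma rint_cst k a b c d : rint (fun=> k) a b c d = 0.
Proof. by rewrite /rint /hint /vint; ring. Qed.

Lemma cder_id (z : C) : cder id z 1.
Proof.
move=> e e0; exists 1 => // h _.
by rewrite mul1r [z + h]addrC addrK subrr cmod0 mulr_ge0 ?cmod_ge0 // ltW.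
Qed.

Lemma econt_holo g a b c d : a <= b -> c <= d -> (forall x y, a <= x <= b -> c <= y <= d ->
    [|| x == a, x == b, y == c | y == d] -> exists D, cder g (pt x y) D) ->
  econt g a b c d.
Proof.
move=> ab cd gd; split.
- by apply: cder_hcont => x xab; apply: gd; rewrite ?lexx ?cd ?eqxx ?orbT.
- by apply: cder_hcont => x xab; apply: gd; rewrite ?lexx ?cd ?eqxx ?orbT.
- by apply: cder_vcont => x xab; apply: gd; rewrite ?lexx ?ab ?eqxx ?orbT.
- by apply: cder_vcont => x xab; apply: gd; rewrite ?lexx ?ab ?eqxx ?orbT.
Qed.

(** On opposite sides the integrands differ by a constant, so the horizontal pair gives
    [i (c - d) (b - a)] and the vertical pair its opposite. *)
Lemma rint_id a b c d : a <= b -> c <= d -> rint id a b c d = 0.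
Proof.
move=> ab cd; rewrite /rint.
have [h1 h2 h3 h4] : econt id a b c d.
  by apply: econt_holo => // x y _ _ _; exists 1; exact: cder_id.
have -> : hint id a b c + 'i%C * vint id c d b - hint id a b d - 'i%C * vint id c d a
  = (hint id a b c - hint id a b d) + 'i%C * (vint id c d b - vint id c d a).
  by ring.
rewrite /hint /vint -!cintB //.
rewrite (@eq_cint _ _ _ _ (fun=> pt 0 (c - d))); last first.
  by move=> x _; rewrite ptB subrr.
rewrite [X in _ * X](@eq_cint _ _ _ _ (fun=> pt (b - a) 0)); last first.
  by move=> x _; rewrite ptB subrr.
by rewrite !cint_cst //; apply: eq_ReIm; rewrite ?(ReD, ImD, Re_mul, Im_mul) /=; ring.
Qed.

Definition holor g a b c d := forall x y, a <= x <= b -> c <= y <= d ->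
  exists D, cder g (pt x y) D.

Lemma holor_econt g a b c d : a <= b -> c <= d -> holor g a b c d -> econt g a b c d.
Proof. by move=> ab cd gd; apply: econt_holo => // x y ? ? _; exact: gd. Qed.

Lemma holor_sub g a b c d a' b' c' d' : a <= a' -> b' <= b -> c <= c' -> d' <= d ->
  holor g a b c d -> holor g a' b' c' d'.
Proof.
move=> aa bb cc dd gd x y /andP[? ?] /andP[? ?]; apply: gd; apply/andP; split; lra.
Qed.

(** The affine approximation [A] of [g] at the point has integral zero, so only the error of
    differentiability remains. It is at most [e] times the sum of the sides, and the length of the
    contour contributes that sum a second time. *)
Lemma rint_local g a b c d x0 y0 (D : C) (e r : R) : a <= b -> c <= d ->
  a <= x0 <= b -> c <= y0 <= d -> econt g a b c d -> 0 < e ->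
  (forall h : C, cmod h < r -> cmod (g (pt x0 y0 + h) - g (pt x0 y0) - D * h) <= e * cmod h) ->
  (b - a) + (d - c) < r ->
  cmod (rint g a b c d) <= 4 * ((b - a) + (d - c)) ^+ 2 * e.
Proof.
move=> ab cd xab ycd ge e0 H rL.
pose A w := g (pt x0 y0) + D * (w - pt x0 y0).
have idc : econt id a b c d.
  by apply: econt_holo => // x y _ _ _; exists 1; exact: cder_id.
have cc k : econt (fun=> k) a b c d.
  by split=> ? _ e1 e10; exists 1 => // ? _; rewrite subrr cmod0 ltW.
have Ac : econt A a b c d.
  have [i1 i2 i3 i4] := idc; have [c1 c2 c3 c4] := cc (pt x0 y0).
  have [k1 k2 k3 k4] := cc (g (pt x0 y0)).
  by split; rewrite /A; apply: ccontD => //; apply: ccontZ; apply: ccontB.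
have A0 : rint A a b c d = 0.
  have Ai : econt (fun w => w - pt x0 y0) a b c d.
    by have [i1 i2 i3 i4] := idc; have [c1 c2 c3 c4] := cc (pt x0 y0);
    split; apply: ccontB.
  have AZ : econt (fun w => D * (w - pt x0 y0)) a b c d.
    by have [? ? ? ?] := Ai; split; apply: ccontZ.
  rewrite /A rintD // rint_cst rintZ // rintB // rint_cst rint_id //; ring.
have -> : rint g a b c d = rint (fun w => g w - A w) a b c d.
  by rewrite rintB // A0 subr0.
have -> : 4 * (b - a + (d - c)) ^+ 2 * e = 4 * (b - a + (d - c)) * ((b - a + (d - c)) * e).
  by ring.
apply: rint_bound => //.
  have [? ? ? ?] := ge; have [? ? ? ?] := Ac.
  by split; apply: ccontB.
move=> x y /andP[ax xb] /andP[cy yd] _.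
move: xab ycd => /andP[ax0 xb0] /andP[cy0 yd0].
have hL : cmod (pt x y - pt x0 y0) <= b - a + (d - c).
  rewrite ptB (le_trans (cmod_pt _ _))// lerD // ler_norml; apply/andP; split; lra.
have := H _ (le_lt_trans hL rL).
rewrite [_ + (_ - _)]addrC subrK /A opprD addrA => /le_trans; apply.
by rewrite mulrC ler_wpM2r // ltW.
Qed.

Lemma le_sum4 (K k1 k2 k3 k4 : R) : K <= k1 + k2 + (k3 + k4) ->
  4 * k1 < K -> 4 * k2 < K -> 4 * k3 < K -> K <= 4 * k4.
Proof. lra. Qed.

Lemma midpoint a b : a <= b -> let m := (a + b) / 2 in
  [/\ a <= m, m <= b, a <= m <= b, m - a = (b - a) / 2 & b - m = (b - a) / 2].
Proof. by move=> ab m; rewrite /m; split; lra. Qed.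

(** Bisecting both sides writes the integral as a sum of four, and one of them carries at least a
    quarter of the modulus. [q] packs the two intervals of that quarter. *)
Lemma goursat_step g a b c d : a <= b -> c <= d -> holor g a b c d ->
  exists q : (R * R) * (R * R),
  [/\ a <= q.1.1, q.1.2 <= b, c <= q.2.1 & q.2.2 <= d] /\
  [/\ q.1.2 - q.1.1 = (b - a) / 2, q.2.2 - q.2.1 = (d - c) / 2 &
   cmod (rint g a b c d) <= 4 * cmod (rint g q.1.1 q.1.2 q.2.1 q.2.2)].
Proof.
move=> ab cd gd; pose m := (a + b) / 2; pose n := (c + d) / 2.
have [am mb mab ma bm] := midpoint ab; have [cn nd ncd nc dn] := midpoint cd.
rewrite -/m -/n in am mb mab ma bm cn nd ncd nc dn.
have [g1 g2 g3 g4] := holor_econt ab cd gd.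
have [k1 k2 k3 k4] := holor_econt am cd (holor_sub (lexx _) mb (lexx _) (lexx _) gd).
have E := rint_splitx mab g1 g2.
rewrite (rint_splity ncd k3 k4) (rint_splity ncd k4 g4) in E.
have K : cmod (rint g a b c d) <= cmod (rint g a m c n) + cmod (rint g a m n d) +
   (cmod (rint g m b c n) + cmod (rint g m b n d)).
  by rewrite E (le_trans (cmodD _ _))// lerD // cmodD.
have [H1|H1] := leP (cmod (rint g a b c d)) (4 * cmod (rint g a m c n)).
  by exists ((a, m), (c, n)).
have [H2|H2] := leP (cmod (rint g a b c d)) (4 * cmod (rint g a m n d)).
  by exists ((a, m), (n, d)).
have [H3|H3] := leP (cmod (rint g a b c d)) (4 * cmod (rint g m b c n)).
  by exists ((m, b), (c, n)).
exists ((m, b), (n, d)); split; split=> //=.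
exact: le_sum4 K H1 H2 H3.
Qed.

Lemma nested_itv (a b : nat -> R) : (forall n, a n <= b n) ->
  (forall n, a n <= a n.+1) -> (forall n, b n.+1 <= b n) ->
  exists x, forall n, a n <= x <= b n.
Proof.
move=> ab aS bS.
have am n k : a n <= a (n + k)%N.
  by elim: k => [|k IH]; rewrite ?addn0 // addnS (le_trans IH).
have bm n k : b (n + k)%N <= b n.
  by elim: k => [|k IH]; rewrite ?addn0 // addnS (le_trans _ IH).
have anb n m : a n <= b m.
  by rewrite (le_trans (am n m))// (le_trans (ab _))// addnC.
exists (sup (range a)) => n; apply/andP; split.
  by apply: ub_le_sup; [exists (b 0%N) => _ [k _ <-]|exists n].
by apply: ge_sup; [exists (a 0%N); exists 0%N|move=> _ [k _ <-]].
Qed.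

Lemma goursat g a b c d : a <= b -> c <= d -> holor g a b c d ->
  rint g a b c d = 0.
Proof.
move=> ab cd gd.
pose good (q : (R * R) * (R * R)) := [/\ q.1.1 <= q.1.2, q.2.1 <= q.2.2 &
  holor g q.1.1 q.1.2 q.2.1 q.2.2].
pose I q := cmod (rint g q.1.1 q.1.2 q.2.1 q.2.2).
have /choice[F FP] : forall q : (R * R) * (R * R), exists q' : (R * R) * (R * R),
    good q -> [/\ good q',
    [/\ q.1.1 <= q'.1.1, q'.1.2 <= q.1.2, q.2.1 <= q'.2.1 & q'.2.2 <= q.2.2] &
    [/\ q'.1.2 - q'.1.1 = (q.1.2 - q.1.1) / 2, q'.2.2 - q'.2.1 = (q.2.2 - q.2.1) / 2 &
    I q <= 4 * I q']].
  move=> q; have [gq|] := pselect (good q); last by exists q.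
  have [h1 h2 h3] := gq.
  have [q' [[n1 n2 n3 n4] [e1 e2 e3]]] := goursat_step h1 h2 h3; exists q' => _.
  split; [split|by []|by []]; [lra|lra|].
  exact: holor_sub h3.
pose Q n := iter n F ((a, b), (c, d)).
have Qgood n : good (Q n) by elim: n => [//|n /FP[]].
pose L := (b - a) + (d - c).
have QL n : ((Q n).1.2 - (Q n).1.1) + ((Q n).2.2 - (Q n).2.1) = L / 2 ^+ n.
  elim: n => [|n IH]; first by rewrite expr0 divr1.
  have [_ _ [/= e1 e2 _]] := FP _ (Qgood n); rewrite /= e1 e2 exprS -mulrDl IH.
  by rewrite invfM; ring.
have QI n : I (Q 0%N) <= 4 ^+ n * I (Q n).
  elim: n => [|n IH]; first by rewrite expr0 mul1r.
  have [_ _ [_ _ /= e3]] := FP _ (Qgood n).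
  by rewrite (le_trans IH)// exprSr -mulrA ler_wpM2l // exprn_ge0.
have [x0 xP] : exists x, forall n, (Q n).1.1 <= x <= (Q n).1.2.
  apply: nested_itv => n; first by have [] := Qgood n.
    by have [_ []] := FP _ (Qgood n).
  by have [_ []] := FP _ (Qgood n).
have [y0 yP] : exists x, forall n, (Q n).2.1 <= x <= (Q n).2.2.
  apply: nested_itv => n; first by have [] := Qgood n.
    by have [_ []] := FP _ (Qgood n).
  by have [_ []] := FP _ (Qgood n).
have [D gD] := gd _ _ (xP 0%N) (yP 0%N).
have L0 : 0 <= L by rewrite /L; lra.
(* The integral has lost at most a factor [4 ^+ n] after [n] bisections, while [rint_local] bounds
   the last one by [4 * (L / 2 ^+ n) ^+ 2 * e]: the powers cancel. *)
have key e : 0 < e -> I (Q 0%N) <= 4 * L ^+ 2 * e.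
  move=> e0; have [r r0 rP] := gD _ e0.
  pose n := Num.bound (L / r).
  have Lr : L / 2 ^+ n < r.
    rewrite ltr_pdivrMr ?exprn_gt0 // mulrC -ltr_pdivrMr //.
    by apply: upper_nthrootP.
  have [h1 h2 h3] := Qgood n.
  have := rint_local h1 h2 (xP n) (yP n) (holor_econt h1 h2 h3) e0 rP.
  rewrite QL => /(_ Lr) H.
  rewrite (le_trans (QI n))// (le_trans (ler_wpM2l _ H)) ?exprn_ge0 //.
  rewrite expr_div_n -exprM mulnC exprM (_ : 2 ^+ 2 = 4 :> R); last by rewrite -natrX.
  rewrite le_eqVlt; apply/orP; left; apply/eqP; field.
  by rewrite expf_neq0.
apply/eqP; rewrite -cmod_eq0 eq_le cmod_ge0 andbT.
rewrite leNgt; apply/negP => K0.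
(* With [e] the modulus divided by [8 * L ^+ 2 + 8], [key] bounds the modulus by less than half of
   itself; the summand 8 covers [L = 0]. *)
have L8 : 0 < 8 * L ^+ 2 + 8 by have := sqr_ge0 L; lra.
have := key _ (divr_gt0 K0 L8); rewrite mulrA ler_pdivlMr // => H.
have : 0 < I (Q 0%N) * (4 * L ^+ 2 + 8) by rewrite mulr_gt0 //; have := sqr_ge0 L; lra.
move: H; rewrite /I /=; lra.
Qed.

(** The four strips between the rectangle and the small square avoid the singular point, so
    [goursat] removes them one by one. *)
Lemma rint_hole r g a b c d x0 y0 : 0 < r ->
  a <= x0 - r -> x0 + r <= b -> c <= y0 - r -> y0 + r <= d ->
  (forall z, z != pt x0 y0 -> exists D, cder g z D) ->
  rint g a b c d = rint g (x0 - r) (x0 + r) (y0 - r) (y0 + r).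
Proof.
move=> r0 ax xb cy yd gd.
have gx x y : x != x0 -> exists D, cder g (pt x y) D.
  by move=> xx; apply: gd; apply: contra xx => /eqP[-> _].
have gy x y : y != y0 -> exists D, cder g (pt x y) D.
  by move=> xx; apply: gd; apply: contra xx => /eqP[_ ->].
have hc a' b' y : y != y0 -> ccont a' b' (fun x => g (pt x y)).
  by move=> yy; apply: cder_hcont => x _; exact: gy.
have vc a' b' x : x != x0 -> ccont a' b' (fun y => g (pt x y)).
  by move=> yy; apply: cder_vcont => y _; exact: gx.
have c1 : c != y0 by lra.
have d1 : d != y0 by lra.
have x1 : x0 - r != x0 by lra.
have x2 : x0 + r != x0 by lra.
rewrite (@rint_splitx (x0 - r) g a b) //; [|lra|exact: hc|exact: hc].
rewrite goursat ?add0r //; [|lra|]; last first.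
  by move=> x y xx _; apply: gx; lra.
rewrite (@rint_splitx (x0 + r) g _ b) //; [|lra|exact: hc|exact: hc].
rewrite [X in _ + X]goursat ?addr0 //; [|lra|]; last first.
  by move=> x y xx _; apply: gx; lra.
rewrite (@rint_splity (y0 - r)) //; [|lra|exact: vc|exact: vc].
rewrite goursat ?add0r //; [|lra|]; last first.
  by move=> x y _ yy; apply: gy; lra.
rewrite (@rint_splity (y0 + r)) //; [|lra|exact: vc|exact: vc].
rewrite [X in _ + X]goursat ?addr0 //; [lra|].
by move=> x y _ yy; apply: gy; lra.
Qed.

End RectangleIntegral.

(** * Cauchy formula and Taylor expansion *)

Section CauchyFormula.
Variable R : realType.
Local Notation C := R[i].
Local Notation leb := (@lebesgue_measure R).
Implicit Types (f g h : C -> C) (z w : C) (x y s : R).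

Lemma cder_ext f g z : f =1 g -> (exists D, cder f z D) -> exists D, cder g z D.
Proof. by move=> /funext ->. Qed.

Lemma cder_invB z w : w != z -> exists D, cder (fun w => (w - z)^-1) w D.
Proof.
move=> wz; apply: derivable_cder.
apply: (@derivableV C C^o (fun w => w - z)); first by rewrite subr_eq0.
apply: (@derivableB C C^o C^o id (cst z)); first exact: derivable_id.
exact: derivable_cst.
Qed.

Lemma cder_mul f g z : (exists D, cder f z D) -> (exists D, cder g z D) ->
  exists D, cder (fun w => f w * g w) z D.
Proof.
move=> [D fD] [E gE]; apply: derivable_cder.
by apply: (@derivableM C C^o f g); [exact: cder_derivable fD|exact: cder_derivable gE].
Qed.

Lemma cder_cst k z : exists D, cder (fun=> k) z D.
Proof.
exists 0 => e e0; exists 1 => // h _.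
by rewrite subrr mul0r subrr cmod0 mulr_ge0 ?cmod_ge0 // ltW.
Qed.

Lemma cder_sub f g z : (exists D, cder f z D) -> (exists D, cder g z D) ->
  exists D, cder (fun w => f w - g w) z D.
Proof.
move=> [D fD] [E gE]; apply: derivable_cder.
by apply: (@derivableB C C^o C^o f g); [exact: cder_derivable fD|exact: cder_derivable gE].
Qed.

Lemma cder_divz f z w : (forall w, exists D, cder f w D) -> w != z ->
  exists D, cder (fun w => f w / (w - z)) w D.
Proof. by move=> fd wz; apply: cder_mul => //; exact: cder_invB. Qed.

Lemma econt_off g z s : (forall w, w != z -> exists D, cder g w D) ->
  `|complex.Re z| < s -> `|complex.Im z| < s -> econt g (- s) s (- s) s.
Proof.
move=> gd /ltr_normlP[z1 z2] /ltr_normlP[z3 z4].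
have ss : - s <= s by lra.
apply: econt_holo => // x y _ _ H; apply: gd; apply/eqP => zE; move: z1 z2 z3 z4 H.
by rewrite -zE /= => *; lra.
Qed.

(* Its value is [2 i pi]; only a lower bound on the modulus is needed. *)
Definition winding s : C := rint (fun w => w^-1) (- s) s (- s) s.

Lemma pt_neq x y z : (x != complex.Re z) || (y != complex.Im z) -> pt x y != z.
Proof. by move=> H; apply/eqP => E; move: H; rewrite -E /= !eqxx. Qed.

(** Opposite sides pair up into [k x = 2 s / (x^2 + s^2)], at least [1 / s] on [[- s, s]]. Each of
    the two pairs thus adds at least 2 to the imaginary part. *)
Lemma winding_ge s : 0 < s -> 4 <= cmod (winding s).
Proof.
move=> s0; have ss : - s <= s by lra.
have cd w : w != 0 -> exists D, cder (fun w : C => w^-1) w D.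
  move=> w0; have := cder_invB w0; apply: cder_ext => v /=.
  by rewrite subr0.
have hc y : y != 0 -> ccont (- s) s (fun x => (pt x y)^-1).
  move=> y0; apply: (@cder_hcont _ (fun w => w^-1)) => x _; apply: cd.
  by apply: pt_neq; rewrite y0 orbT.
have vc x : x != 0 -> ccont (- s) s (fun y => (pt x y)^-1).
  move=> x0; apply: (@cder_vcont _ (fun w => w^-1)) => y _; apply: cd.
  by apply: pt_neq; rewrite x0.
have s1 : s != 0 by lra.
have s2 : - s != 0 by lra.
pose k x := 2 * s / (x ^+ 2 + s ^+ 2).
have den x : x ^+ 2 + s ^+ 2 != 0.
  by rewrite gt_eqF // ltr_wpDl ?sqr_ge0 // exprn_gt0.
have cH : ccont (- s) s (fun x => pt 0 (k x)).
  have -> : (fun x => pt 0 (k x)) = (fun x => (pt x (- s))^-1 - (pt x s)^-1).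
    apply/funext => x; apply: eq_ReIm; rewrite ?(ReB, ImB) /= ?sqrrN ?subrr //.
    by rewrite /k opprK; field.
  by apply: ccontB; exact: hc.
have cV : ccont (- s) s (fun y => pt (k y) 0).
  have -> : (fun y => pt (k y) 0) = (fun y => (pt s y)^-1 - (pt (- s) y)^-1).
    apply/funext => x; apply: eq_ReIm; rewrite ?(ReB, ImB) /= ?sqrrN ?subrr //.
    by rewrite /k [s ^+ 2 + _]addrC mulNr opprK; field.
  by apply: ccontB; exact: vc.
have E : winding s = 'i%C * (cint (- s) s (fun y => pt (k y) 0)) +
     cint (- s) s (fun x => pt 0 (k x)).
  have -> : cint (- s) s (fun x => pt 0 (k x)) =
      cint (- s) s (fun x => (pt x (- s))^-1 - (pt x s)^-1).
    apply: eq_cint => x _; apply: eq_ReIm; rewrite ?(ReB, ImB) /= ?sqrrN ?subrr //.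
    by rewrite /k opprK; field.
  have -> : cint (- s) s (fun y => pt (k y) 0) =
      cint (- s) s (fun y => (pt s y)^-1 - (pt (- s) y)^-1).
    apply: eq_cint => x _; apply: eq_ReIm; rewrite ?(ReB, ImB) /= ?sqrrN ?subrr //.
    by rewrite /k [s ^+ 2 + _]addrC mulNr opprK; field.
  rewrite (cintB (vc _ s1) (vc _ s2)) (cintB (hc _ s2) (hc _ s1)).
  by rewrite /winding /rint /hint /vint; ring.
have [_ ki] := ccont_integrable cH; rewrite /= in ki.
have k2 : 2 <= Rintegral leb `[- s, s] k.
  have -> : 2 = Rintegral leb `[- s, s] (cst s^-1).
    rewrite Rintegral_cst // (fine_leb_itv ss); by field.
  apply: le_Rintegral => //; first exact: cst_integrable.
  move=> x /=; rewrite in_itv /= => /andP[x1 x2].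
  rewrite /k ler_pdivlMr ?lt_def ?den ?addr_ge0 ?sqr_ge0 //.
  rewrite mulrC ler_pdivrMr // -mulrA -expr2 mulr_natl mulr2n lerD2r -[s ^+ 2]real_normK ?num_real // -[x ^+ 2]real_normK ?num_real //.
  by rewrite ler_sqr ?nnegrE // (ger0_norm (ltW s0)) ler_norml x1 x2.
apply: le_trans (Im_le_cmod _); rewrite E.
rewrite ImD Im_mul /= mul0r add0r mul1r (_ : 4 = 2 + 2); last by rewrite -natrD.
by rewrite (le_trans _ (ler_norm _))// lerD.
Qed.

Lemma rint_translate g x0 y0 r : 0 < r ->
  (forall w, w != 0 -> exists D, cder g w D) ->
  rint (fun w => g (w - pt x0 y0)) (x0 - r) (x0 + r) (y0 - r) (y0 + r) =
  rint g (- r) r (- r) r.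
Proof.
move=> r0 gd.
have hc y : y != 0 -> ccont (- r) r (fun x => g (pt x y)).
  by move=> yy; apply: cder_hcont => x _; apply: gd; apply: pt_neq; rewrite yy orbT.
have vc x : x != 0 -> ccont (- r) r (fun y => g (pt x y)).
  by move=> yy; apply: cder_vcont => y _; apply: gd; apply: pt_neq; rewrite yy.
have H y : y != 0 -> hint (fun w => g (w - pt x0 y0)) (x0 - r) (x0 + r) (y0 + y) =
    hint g (- r) r y.
  move=> yy; rewrite /hint -(@cint_translate _ (- x0) (- r) r _ (hc _ yy)).
  rewrite opprK [x0 - r]addrC [x0 + r]addrC.
  by apply: eq_cint => x _; rewrite ptB [y0 + y]addrC addrK.
have V x : x != 0 -> vint (fun w => g (w - pt x0 y0)) (y0 - r) (y0 + r) (x0 + x) =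
    vint g (- r) r x.
  move=> yy; rewrite /vint -(@cint_translate _ (- y0) (- r) r _ (vc _ yy)).
  rewrite opprK [y0 - r]addrC [y0 + r]addrC.
  by apply: eq_cint => y _; rewrite ptB [x0 + x]addrC addrK.
rewrite /rint; rewrite !H ?V //; lra.
Qed.

(** Subtracting [f z / (w - z)] leaves the difference quotient [h]. It is bounded near [z], so its
    integral vanishes when the contour shrinks to [z]. *)
Lemma cauchy_square f s z : (forall w, exists D, cder f w D) ->
  `|complex.Re z| < s -> `|complex.Im z| < s ->
  rint (fun w => f w / (w - z)) (- s) s (- s) s = winding s * f z.
Proof.
move=> fd zs1 zs2; case: z zs1 zs2 => x0 y0 /= zs1 zs2; rewrite -/(pt x0 y0).
set z := pt x0 y0; have s0 : 0 < s by rewrite (le_lt_trans _ zs1).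
have ss : - s <= s by lra.
have invd w : w != z -> exists D, cder (fun w => (w - z)^-1) w D.
  exact: cder_invB.
have inv0 w : w != 0 -> exists D, cder (fun w : C => w^-1) w D.
  by move=> w0; have := cder_invB w0; apply: cder_ext => v /=; rewrite subr0.
pose h w := (f w - f z) / (w - z).
have hd w : w != z -> exists D, cder h w D.
  move=> wz; apply: cder_mul; last exact: invd.
  by apply: cder_sub => //; exact: cder_cst.
(* Half the distance from [z] to the boundary: squares about [z] of half-side at most [s1] stay
   inside. *)
pose s1 := (s - Num.max `|x0| `|y0|) / 2.
have ms : Num.max `|x0| `|y0| < s by rewrite gt_max zs1 zs2.
have s10 : 0 < s1 by rewrite /s1; lra.
have xs : `|x0| <= s - 2 * s1.
  by rewrite /s1 mulrC divfK // opprB addrC subrK le_max lexx.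
have ys : `|y0| <= s - 2 * s1.
  by rewrite /s1 mulrC divfK // opprB addrC subrK le_max lexx orbT.
move/ler_normlP : xs => [xs1 xs2]; move/ler_normlP : ys => [ys1 ys2].
have hole g r : 0 < r -> r <= s1 -> (forall w, w != z -> exists D, cder g w D) ->
    rint g (- s) s (- s) s = rint g (x0 - r) (x0 + r) (y0 - r) (y0 + r).
  by move=> r0 rs gd; apply: (rint_hole r0 _ _ _ _ gd); lra.
(* Both integrals move to squares of half-side [s1], about [z] and about 0, which differ by a
   translation. *)
have W : rint (fun w => (w - z)^-1) (- s) s (- s) s = winding s.
  rewrite (hole _ s1 s10 (lexx _) invd).
  rewrite (@rint_translate (fun w => w^-1)) //.
  have s1s : s1 <= s by clear -xs1 xs2 s10; lra.
  by rewrite /winding (@rint_hole _ s1 (fun w => w^-1) (- s) s (- s) s 0 0)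
    ?sub0r ?add0r ?lerN2.
have h0 : rint h (- s) s (- s) s = 0.
  have [D fD] := fd z; have [d d0 dP] := fD _ ltr01.
  have hM w : w != z -> cmod (w - z) < d -> cmod (h w) <= 1 + cmod D.
    move=> wz wd; have := dP _ wd; rewrite [z + _]addrC subrK mul1r => H.
    rewrite /h cmodM cmodV ler_pdivrMr ?cmod_gt0 ?subr_eq0 // mulrDl mul1r.
    rewrite -cmodM.
    have -> : f w - f z = (f w - f z - D * (w - z)) + D * (w - z) by ring.
    by rewrite (le_trans (cmodD _ _))// lerD2r.
  have D1 : 0 < 1 + cmod D by rewrite ltr_wpDr ?cmod_ge0.
  have small r : 0 < r -> r <= s1 -> 2 * r < d ->
      cmod (rint h (- s) s (- s) s) <= 16 * r * (1 + cmod D).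
    move=> r0 rs rd; rewrite (hole _ r r0 rs hd).
    have -> : 16 * r = 4 * ((x0 + r) - (x0 - r) + ((y0 + r) - (y0 - r))) by ring.
    have nz x y : [|| x == x0 - r, x == x0 + r, y == y0 - r | y == y0 + r] ->
        pt x y != z.
      move=> H; apply: pt_neq => /=; rewrite -negb_and; apply/negP => /andP[/eqP X /eqP Y].
      by move: H; rewrite X Y => H; lra.
    apply: rint_bound; [lra|lra| |].
      by apply: econt_holo; [lra|lra|] => x y _ _ /nz; exact: hd.
    move=> x y /andP[ax bx] /andP[ay by_] /nz H; apply: hM => //.
    rewrite (le_lt_trans _ rd)// ptB (le_trans (cmod_pt _ _))// mulr_natl mulr2n.
    by apply: lerD; rewrite ler_norml; apply/andP; split; lra.
  apply/eqP; rewrite -cmod_eq0 eq_le cmod_ge0 andbT leNgt; apply/negP => K0.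
  set K := cmod _ in K0 small.
  (* The bounds keep the square inside, keep its points within [d] of [z], and make the right-hand
     side of [small] at most [K / 2]. *)
  pose r := Num.min s1 (Num.min (d / 4) (K / (32 * (1 + cmod D)))).
  have r0 : 0 < r by rewrite !lt_min s10 !divr_gt0 // mulr_gt0.
  have rs : r <= s1 by rewrite ge_min lexx.
  have rd : r <= d / 4 by rewrite !ge_min lexx orbT.
  have rK : r <= K / (32 * (1 + cmod D)) by rewrite !ge_min lexx !orbT.
  have := small _ r0 rs; rewrite ler_pdivlMr ?mulr_gt0 // in rK => H.
  have : K <= 16 * r * (1 + cmod D) by apply: H; lra.
  lra.
have e1 : econt (fun w => f w / (w - z)) (- s) s (- s) s.
  by apply: (@econt_off _ z) => // w wz; exact: cder_divz.
have e2 : econt (fun w => (w - z)^-1) (- s) s (- s) s.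
  by apply: (@econt_off _ z).
have e3 : econt (fun w => f z * (w - z)^-1) (- s) s (- s) s.
  by have [? ? ? ?] := e2; split; apply: ccontZ.
have : rint h (- s) s (- s) s =
    rint (fun w => f w / (w - z)) (- s) s (- s) s - f z * winding s.
  by rewrite -W -rintZ // -rintB //; apply: eq_rint => // x y _ _ _; rewrite /h mulrBl.
by rewrite h0 mulrC => /esym/eqP; rewrite subr_eq0 => /eqP.
Qed.

Definition coefsum (a : nat -> C) (n : nat) z : C := \sum_(k < n) a k * z ^+ k.

Lemma coefsumS a n z : coefsum a n.+1 z = coefsum a n z + a n * z ^+ n.
Proof. by rewrite /coefsum big_ord_recr. Qed.

(* On the disc of radius [r] the remainders decay geometrically, with ratio at
   most 1/2.  This determines [a] and makes the convergence locally uniform. *)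
Definition fseries f (a : nat -> C) := forall r : R, 0 < r -> exists2 M, 0 <= M &
  forall n z, cmod z <= r -> cmod (f z - coefsum a n z) <= M * (cmod z / (2 * r)) ^+ n.

Lemma econt_bounded g a b c d : a <= b -> c <= d -> econt g a b c d ->
  exists2 M, 0 <= M & forall x y, a <= x <= b -> c <= y <= d ->
    [|| x == a, x == b, y == c | y == d] -> cmod (g (pt x y)) <= M.
Proof.
move=> ab cd [/ccont_bounded[M1 M10 H1] /ccont_bounded[M2 M20 H2]
  /ccont_bounded[M3 M30 H3] /ccont_bounded[M4 M40 H4]].
exists (M1 + M2 + M3 + M4); first by rewrite !addr_ge0.
move=> x y xab ycd /or4P[] /eqP E; rewrite E in xab ycd *.
- by rewrite (le_trans (H3 _ ycd))//; lra.
- by rewrite (le_trans (H4 _ ycd))//; lra.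
- by rewrite (le_trans (H1 _ xab))//; lra.
- by rewrite (le_trans (H2 _ xab))//; lra.
Qed.

Lemma cauchy_coef f s : (forall w, exists D, cder f w D) -> 0 < s ->
  let a n := rint (fun w => f w * w^-1 ^+ n.+1) (- s) s (- s) s / winding s in
  exists2 M, 0 <= M & forall n z, cmod z <= s / 2 ->
    cmod (f z - coefsum a n z) <= M * (cmod z / s) ^+ n.
Proof.
move=> fd s0 a.
have ss : - s <= s by lra.
have inv0 w : w != 0 -> exists D, cder (fun w : C => w^-1) w D.
  by move=> w0; have := cder_invB w0; apply: cder_ext => v /=; rewrite subr0.
have invX n w : w != 0 -> exists D, cder (fun w : C => w^-1 ^+ n) w D.
  move=> w0; elim: n => [|n IH]; first exact: cder_cst.
  by have := cder_mul (inv0 _ w0) IH; apply: cder_ext => v; rewrite exprS.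
have efX n : econt (fun w => f w * w^-1 ^+ n) (- s) s (- s) s.
  apply: (@econt_off _ 0); rewrite ?normr0 // => w w0.
  by apply: cder_mul => //; exact: invX.
have Wge := winding_ge s0.
have W0 : winding s != 0 by rewrite -cmod_gt0 (lt_le_trans _ Wge).
have edge x y : - s <= x <= s -> - s <= y <= s ->
    [|| x == - s, x == s, y == - s | y == s] -> s <= cmod (pt x y).
  move=> xs ys H; have : `|x| = s \/ `|y| = s.
    by case/or4P : H => /eqP ->; rewrite ?normrN (gtr0_norm s0); tauto.
  by case=> <-; [exact: (Re_le_cmod (pt x y))|exact: (Im_le_cmod (pt x y))].
have ef : econt f (- s) s (- s) s.
  by have := efX 0%N; (rewrite (_ : (fun w => f w * w^-1 ^+ 0) = f) //; apply/funext => w; rewrite expr0 mulr1).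
have [M M0 fM] := econt_bounded ss ss ef.
pose g n z w := f w * (z / w) ^+ n / (w - z).
have nz z w : cmod z <= s / 2 -> s <= cmod w -> s / 2 <= cmod (w - z).
  move=> zs ws; have := cmodD (w - z) z; rewrite subrK; lra.
have ineq z : cmod z <= s / 2 -> `|complex.Re z| < s /\ `|complex.Im z| < s.
  move=> zs; have s2 : s / 2 < s by lra.
  by split; rewrite (le_lt_trans _ s2)// (le_trans _ zs)// ?Re_le_cmod ?Im_le_cmod.
have einv z : cmod z <= s / 2 -> econt (fun w => (w - z)^-1) (- s) s (- s) s.
  by move=> /ineq[? ?]; apply: (@econt_off _ z) => // w; exact: cder_invB.
have holoM G H' z : cmod z <= s / 2 -> (forall w, w != 0 -> exists D, cder G w D) ->
    (forall w, w != z -> exists D, cder H' w D) ->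
    econt (fun w => G w * H' w) (- s) s (- s) s.
  move=> zs Gd Hd; have s20 : 0 < s / 2 by lra.
  apply: econt_holo => // x y xs ys E; have ps := edge _ _ xs ys E.
  apply: cder_mul; [apply: Gd|apply: Hd]; rewrite -?cmod_gt0 ?(lt_le_trans s0) //.
  by rewrite -subr_eq0 -cmod_gt0 (lt_le_trans s20)// nz.
have eg n z : cmod z <= s / 2 -> econt (g n z) (- s) s (- s) s.
  move=> zs; apply: (holoM _ _ z) => // [w w0|w]; last exact: cder_invB.
  apply: cder_mul => //; have := cder_mul (cder_cst (z ^+ n) w) (invX n _ w0).
  by apply: cder_ext => v; rewrite exprMn.
(* The remainder is the Cauchy integral of [f w * (z / w)^n / (w - z)]; the induction step is
   [1 / (w - z) - 1 / w = (z / w) / (w - z)]. *)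
have rem n z : cmod z <= s / 2 ->
    f z - coefsum a n z = rint (g n z) (- s) s (- s) s / winding s.
  move=> zs; have [z1 z2] := ineq _ zs.
  elim: n => [|n IH].
    rewrite /coefsum big_ord0 subr0; apply: (mulfI W0); rewrite -cauchy_square //.
    rewrite mulrC divfK //; apply: eq_rint => // x y _ _ _.
    by rewrite /g expr0 mulr1.
  rewrite coefsumS opprD addrA IH /a mulrAC -mulrBl; congr (_ / _).
  rewrite mulrC -rintZ ; last exact: efX.
  have ek : econt (fun w => z ^+ n * (f w * w^-1 ^+ n.+1)) (- s) s (- s) s.
    by have [? ? ? ?] := efX n.+1; split; apply: ccontZ.
  rewrite -rintB //; last exact: eg.
  apply: eq_rint => // x y xs ys E; have ps := edge _ _ xs ys E.
  have w0 : pt x y != 0 by rewrite -cmod_gt0 (lt_le_trans s0).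
  have wz : pt x y - z != 0.
    by rewrite -cmod_gt0 (lt_le_trans _ (nz _ _ zs ps))//; lra.
  rewrite /g !exprMn !exprS; move: (pt x y) w0 wz => w w0 wz.
  by rewrite !exprVn; field; rewrite w0 wz expf_neq0.
(* The contour integral is at most [32 * M] times the power, and [winding s] has modulus at least
   2. *)
exists (4 * M * 4) => [|n z zs]; first by rewrite !mulr_ge0.
rewrite rem // cmodM cmodV.
have H : cmod (rint (g n z) (- s) s (- s) s) <=
    4 * (s - - s + (s - - s)) * (M * (cmod z / s) ^+ n * (2 / s)).
  apply: rint_bound => //; first exact: eg.
  move=> x y xs ys E; have ps := edge _ _ xs ys E.
  rewrite /g !cmodM cmodX cmodM !cmodV.
  apply: ler_pM; rewrite ?mulr_ge0 ?exprn_ge0 ?invr_ge0 ?divr_ge0 ?cmod_ge0 //.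
    apply: ler_pM; rewrite ?exprn_ge0 ?divr_ge0 ?cmod_ge0 ?fM //.
    apply: lerXn2r; rewrite ?nnegrE ?divr_ge0 ?cmod_ge0 ?(ltW s0) //.
    by rewrite ler_wpM2l ?cmod_ge0 // lef_pV2 ?posrE // (lt_le_trans s0).
  have s20 : 0 < s / 2 by lra.
  rewrite -[2 / s]invf_div lef_pV2 ?posrE ?nz //.
  by rewrite (lt_le_trans s20) ?nz.
rewrite ler_pdivrMr ?(lt_le_trans _ Wge) // (le_trans H)//.
have -> : 4 * (s - - s + (s - - s)) * (M * (cmod z / s) ^+ n * (2 / s)) =
  (4 * M * 4 * (cmod z / s) ^+ n) * 2.
  by field; rewrite gt_eqF.
rewrite ler_wpM2l ?mulr_ge0 ?exprn_ge0 ?divr_ge0 ?cmod_ge0 ?(ltW s0) //.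
by rewrite (le_trans _ Wge)// ler_nat.
Qed.

(** If the coefficients below [n] agree, comparing the two expansions of order [n.+1] at a small
    real [t] gives [cmod (a n - b n) <= K * t], and [t] is arbitrarily small. *)
Lemma coef_unique f a b r s Ma Mb : 0 < r -> 0 < s ->
  (forall n z, cmod z <= r -> cmod (f z - coefsum a n z) <= Ma * (cmod z / s) ^+ n) ->
  (forall n z, cmod z <= r -> cmod (f z - coefsum b n z) <= Mb * (cmod z / s) ^+ n) ->
  a = b.
Proof.
move=> r0 s0 Ha Hb; apply/funext => n.
elim/ltn_ind : n => n IH.
have E z : coefsum a n z = coefsum b n z.
  by apply: eq_bigr => k _; rewrite IH.
pose K := (Ma + Mb) / s ^+ n.+1.
have key t : 0 < t -> t <= r -> cmod (a n - b n) <= K * t.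
  move=> t0 tr; have ct : cmod (t%:C%C) = t by rewrite cmod_real gtr0_norm.
  have := Ha n.+1 (t%:C%C); have := Hb n.+1 (t%:C%C).
  rewrite !coefsumS E !ct => /(_ tr) hb /(_ tr) ha.
  have : cmod ((a n - b n) * t%:C%C ^+ n) <= (Ma + Mb) * (t / s) ^+ n.+1.
    have -> : (a n - b n) * t%:C%C ^+ n =
      (f t%:C%C - (coefsum b n t%:C%C + b n * t%:C%C ^+ n)) -
      (f t%:C%C - (coefsum b n t%:C%C + a n * t%:C%C ^+ n)) by ring.
    by rewrite (le_trans (cmodB _ _))// addrC mulrDl lerD.
  rewrite cmodM cmodX ct expr_div_n exprSr.
  have -> : (Ma + Mb) * (t ^+ n * t / s ^+ n.+1) = K * t * t ^+ n.
    by rewrite /K; field; rewrite expf_neq0 ?gt_eqF.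
  by rewrite ler_pM2r ?exprn_gt0.
apply/eqP; rewrite -subr_eq0 -cmod_eq0 eq_le cmod_ge0 andbT leNgt; apply/negP => c0.
set c := cmod _ in c0 key.
have K1 : 0 < `|K| + 1 by rewrite ltr_wpDl.
pose t := Num.min r (c / (2 * (`|K| + 1))).
have t0 : 0 < t by rewrite lt_min r0 divr_gt0 // mulr_gt0.
have := key t t0; rewrite ge_min lexx => /(_ isT) H.
have t2 : t <= c / (2 * (`|K| + 1)) by rewrite ge_min lexx orbT.
rewrite ler_pdivlMr ?mulr_gt0 // in t2.
have : K * t <= (`|K| + 1) * t.
  by rewrite ler_wpM2r ?(ltW t0) // (le_trans (ler_norm _))// lerDl.
lra.
Qed.

(** The Cauchy coefficients over squares of different sizes agree by [coef_unique], so those of the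
    square with [s = 1] serve for every radius; the estimate at radius [r] is read off the square
    with [s = 2 * r]. *)
Lemma entire_fseries f : entire f -> exists a, fseries f a.
Proof.
move=> ef; have fd w : exists D, cder f w D by apply: derivable_cder; exact: ef.
pose a s n := rint (fun w => f w * w^-1 ^+ n.+1) (- s) s (- s) s / winding s.
have H s : 0 < s -> exists2 M, 0 <= M & forall n z, cmod z <= s / 2 ->
    cmod (f z - coefsum (a s) n z) <= M * (cmod z / s) ^+ n.
  by move=> s0; have := cauchy_coef fd s0.
have aE s : 0 < s -> a s = a 1.
  move=> s0; have [M M0 HM] := H _ s0; have [N N0 HN] := H _ ltr01.
  pose t := Num.min s 1.
  have t0 : 0 < t by rewrite lt_min s0 ltr01.
  have t20 : 0 < t / 2 by lra.
  have ts : t <= s by rewrite ge_min lexx.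
  have t1 : t <= 1 by rewrite ge_min lexx orbT.
  apply: (@coef_unique f _ _ (t / 2) t M N) => // n z zt.
    rewrite (le_trans (HM _ _ _)) ?(le_trans zt) ?ler_pM2r //.
    rewrite ler_wpM2l // lerXn2r ?nnegrE ?divr_ge0 ?cmod_ge0 ?(ltW s0) ?(ltW t0) ?ler01 //.
    by rewrite ler_wpM2l ?cmod_ge0 // lef_pV2 ?posrE.
  rewrite (le_trans (HN _ _ _)) ?(le_trans zt) ?ler_pM2r //.
  rewrite ler_wpM2l // lerXn2r ?nnegrE ?divr_ge0 ?cmod_ge0 ?(ltW s0) ?(ltW t0) ?ler01 //.
  by rewrite ler_wpM2l ?cmod_ge0 // lef_pV2 ?posrE.
exists (a 1) => r r0; have r2 : 0 < 2 * r by rewrite mulr_gt0.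
have [M M0 HM] := H _ r2; exists M => // n z zr; rewrite -(aE _ r2); apply: HM.
by rewrite mulrC mulKf.
Qed.

End CauchyFormula.

(** * Entire functions as power series *)

Section EntireSeries.
Variable R : realType.
Local Notation C := R[i].
Implicit Types (f g h : C -> C) (a c : nat -> C) (z w : C) (x y s : R).

(** Characterises the Taylor coefficients of entire functions, by [fseries_ecoef], [ecoef_fseries]
    and [fseries_entire]. Multiplying coefficients by a bounded sequence clearly preserves it. *)
Definition ecoef c := forall r : R, 0 < r -> exists M, forall n, cmod (c n) * r ^+ n <= M.

(** The partial sums plus or minus the geometric tail are the ends of nested intervals, whose common
    point is the sum. *)
Lemma real_geometric_cvg (u : nat -> R) M : 0 <= M ->
  (forall n, `|u n| <= M / 2 ^+ n) ->
  exists s, forall n, `|s - \sum_(k < n) u k| <= 2 * M / 2 ^+ n.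
Proof.
move=> M0 uM; pose S n := \sum_(k < n) u k.
pose A n := S n - 2 * M / 2 ^+ n; pose B n := S n + 2 * M / 2 ^+ n.
have p2 n : 0 < 2 ^+ n :> R by rewrite exprn_gt0.
have step n : 2 * M / 2 ^+ n = 2 * (M / 2 ^+ n) /\ 2 * M / 2 ^+ n.+1 = M / 2 ^+ n.
  by split; rewrite ?exprS; field; rewrite expf_neq0.
have uu n : - (M / 2 ^+ n) <= u n /\ u n <= M / 2 ^+ n.
  by have := uM n; rewrite ler_norml => /andP[].
have [s sP] : exists s, forall n, A n <= s <= B n.
  apply: nested_itv => n; rewrite /A /B /S ?big_ord_recr /=.
  - by have := divr_ge0 M0 (ltW (p2 n)); have [-> _] := step n; lra.
  - by have [-> ->] := step n; have [? ?] := uu n; lra.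
  - by have [-> ->] := step n; have [? ?] := uu n; lra.
exists s => n; have := sP n; rewrite /A /B /S => /andP[h1 h2].
by rewrite ler_norml; apply/andP; split; lra.
Qed.

Lemma Re_sum (I : Type) (r : seq I) (P : pred I) (F : I -> C) :
  complex.Re (\sum_(i <- r | P i) F i) = \sum_(i <- r | P i) complex.Re (F i).
Proof. by elim/big_ind2 : _ => // x y x' y' <- <-; rewrite ReD. Qed.

Lemma Im_sum (I : Type) (r : seq I) (P : pred I) (F : I -> C) :
  complex.Im (\sum_(i <- r | P i) F i) = \sum_(i <- r | P i) complex.Im (F i).
Proof. by elim/big_ind2 : _ => // x y x' y' <- <-; rewrite ImD. Qed.

Lemma geometric_cvg (u : nat -> C) M : 0 <= M ->
  (forall n, cmod (u n) <= M / 2 ^+ n) ->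
  exists s : C, forall n, cmod (s - \sum_(k < n) u k) <= 4 * M / 2 ^+ n.
Proof.
move=> M0 uM.
have [x xP] := real_geometric_cvg M0 (fun n => le_trans (Re_le_cmod (u n)) (uM n)).
have [y yP] := real_geometric_cvg M0 (fun n => le_trans (Im_le_cmod (u n)) (uM n)).
exists (pt x y) => n; rewrite (le_trans (cmod_le_ReIm _))//.
rewrite ReB ImB Re_sum Im_sum /= (le_trans (lerD (xP n) (yP n)))//.
by rewrite -mulrDl -mulrDl -natrD.
Qed.

Lemma eps_pow2 (M e : R) : 0 < e -> exists n, M / 2 ^+ n <= e.
Proof.
move=> e0; exists (Num.bound (M / e)); apply: ltW.
rewrite ltr_pdivrMr ?exprn_gt0 // mulrC -ltr_pdivrMr //.
exact: upper_nthrootP.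
Qed.

Lemma fseries_cvg f a z : fseries f a -> exists2 M, 0 <= M &
  forall n, cmod (f z - coefsum a n z) <= M / 2 ^+ n.
Proof.
move=> fa; pose r := cmod z + 1.
have r0 : 0 < r by rewrite ltr_wpDl ?cmod_ge0.
have [M M0 MP] := fa _ r0; exists M => // n.
have zr : cmod z <= r by rewrite lerDl.
rewrite (le_trans (MP n z zr))// ler_wpM2l // -exprVn.
rewrite lerXn2r ?nnegrE ?divr_ge0 ?cmod_ge0 ?invr_ge0 // ?mulr_ge0 ?(ltW r0) //.
by rewrite ler_pdivrMr ?mulr_gt0 // mulrA mulVf ?pnatr_eq0 // mul1r.
Qed.

Lemma fseries_ecoef f a : fseries f a -> ecoef a.
Proof.
move=> fa r r0; have [M M0 MP] := fa _ r0; exists (2 * M) => n.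
have cr : cmod (r%:C%C) = r by rewrite cmod_real gtr0_norm.
have -> : cmod (a n) * r ^+ n = cmod (a n * r%:C%C ^+ n) by rewrite cmodM cmodX cr.
have -> : a n * r%:C%C ^+ n = (f r%:C%C - coefsum a n r%:C%C) -
  (f r%:C%C - coefsum a n.+1 r%:C%C) by rewrite coefsumS; ring.
rewrite (le_trans (cmodB _ _))// mulr_natl mulr2n.
have H m : cmod (f r%:C%C - coefsum a m r%:C%C) <= M.
  rewrite (le_trans (MP m _ _)) ?cr // ler_piMr // exprn_ile1 ?divr_ge0 ?(ltW r0) //.
    by rewrite mulr_ge0 ?(ltW r0).
  by rewrite ler_pdivrMr ?mulr_gt0 // mul1r ler_pMl // ler1n.
by rewrite lerD.
Qed.

Lemma ecoef_fseries c : ecoef c -> exists g, fseries g c.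
Proof.
move=> cc.
have S z : exists s : C, exists2 M, 0 <= M & forall n, cmod (s - coefsum c n z) <= M / 2 ^+ n.
  have r0 : 0 < 2 * (cmod z + 1) by rewrite mulr_gt0 // ltr_wpDl ?cmod_ge0.
  have [M MP] := cc _ r0.
  have M0 : 0 <= M.
    by rewrite (le_trans _ (MP 0%N))// mulr_ge0 ?cmod_ge0 ?exprn_ge0 ?(ltW r0).
  have H n : cmod (c n * z ^+ n) <= M / 2 ^+ n.
    rewrite cmodM cmodX ler_pdivlMr ?exprn_gt0 // (le_trans _ (MP n))//.
    rewrite -mulrA -exprMn ler_wpM2l ?cmod_ge0 // lerXn2r ?nnegrE ?(ltW r0) //.
      by rewrite mulr_ge0 ?cmod_ge0.
    by rewrite mulrC ler_wpM2l // lerDl.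
  have [s sP] := geometric_cvg M0 H.
  by exists s, (4 * M) => //; rewrite mulr_ge0.
have [g gP] := choice S; exists g => r r0.
(* Of the factor 4, one half goes into the ratio [q = cmod z / (2 * r)] of [fseries], the other into
   a factor [2 ^- k] that sums the tail. *)
have r4 : 0 < 4 * r by rewrite mulr_gt0.
have [M MP] := cc _ r4.
have M0 : 0 <= M.
  by rewrite (le_trans _ (MP 0%N))// mulr_ge0 ?cmod_ge0 ?exprn_ge0 ?(ltW r4).
exists (2 * M) => [|n z zr]; first by rewrite mulr_ge0.
pose q := cmod z / (2 * r).
have q0 : 0 <= q by rewrite divr_ge0 ?cmod_ge0 ?mulr_ge0 ?(ltW r0).
have q1 : q <= 1 / 2.
  by rewrite ler_pdivrMr ?mulr_gt0 // mulrA mul1r mulVf ?pnatr_eq0 // mul1r.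
have term k : cmod (c k * z ^+ k) <= M * q ^+ k / 2 ^+ k.
  have -> : M * q ^+ k / 2 ^+ k = M * (cmod z / (4 * r)) ^+ k.
    rewrite -mulrA -expr_div_n; congr (_ * _ ^+ _).
    by rewrite /q; field; rewrite gt_eqF.
  rewrite cmodM cmodX expr_div_n mulrA ler_pdivlMr ?exprn_gt0 //.
  rewrite mulrAC ler_wpM2r ?exprn_ge0 ?cmod_ge0 //.
have tail m : cmod (coefsum c (n + m) z - coefsum c n z) <=
    2 * (M * q ^+ n) - 2 * (M * q ^+ n) / 2 ^+ m.
  elim: m => [|m IH]; first by rewrite addn0 expr0 divr1 !subrr cmod0.
  rewrite addnS coefsumS addrAC (le_trans (cmodD _ _))//.
  rewrite (le_trans (lerD IH (term _)))//.
  have -> : 2 * (M * q ^+ n) - 2 * (M * q ^+ n) / 2 ^+ m.+1 =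
    2 * (M * q ^+ n) - 2 * (M * q ^+ n) / 2 ^+ m + M * q ^+ n / 2 ^+ m.
    by rewrite exprS; field; rewrite expf_neq0.
  have qn0 : 0 <= M * q ^+ n by rewrite mulr_ge0 ?exprn_ge0.
  rewrite lerD2l !exprD mulrA invfM ler_pM ?divr_ge0 ?mulr_ge0 ?invr_ge0 ?exprn_ge0 //.
    by rewrite ler_piMr // exprn_ile1 // (le_trans q1)//; lra.
  by rewrite ler_piMl ?invr_ge0 ?exprn_ge0 // invf_le1 ?exprn_gt0 // exprn_ege1 // ler1n.
apply/ler_addgt0Pr => e e0; have [N NP] := gP z.
move=> NM; have [m mP] := eps_pow2 N e0.
rewrite -mulrA.
have -> : g z - coefsum c n z = (g z - coefsum c (n + m) z) +
  (coefsum c (n + m) z - coefsum c n z) by ring.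
rewrite (le_trans (cmodD _ _))// addrC lerD //.
  by rewrite (le_trans (tail m))// gerBl !mulr_ge0 ?invr_ge0 ?exprn_ge0.
rewrite (le_trans (NM _))// (le_trans _ mP)// ler_wpM2l //.
rewrite lef_pV2 ?posrE ?exprn_gt0 // ler_weXn2l ?ler1n // leq_addl //.
Qed.

(** The error of order [n.+1] is [z + h] times the error of order [n], plus [n z^(n-1) h^2];
    [1 <= r] supplies the missing powers of [r]. *)
Lemma exprD_linear_bound (z h : C) r n : 1 <= r -> cmod z + cmod h <= r ->
  cmod ((z + h) ^+ n - z ^+ n - n%:R * z ^+ n.-1 * h) <= n%:R ^+ 2 * r ^+ n * cmod h ^+ 2.
Proof.
move=> r1 zr; have r0 : 0 <= r by rewrite (le_trans ler01).
elim: n => [|n IH]; first by rewrite !expr0 subrr !mul0r subrr cmod0 expr0n !mul0r.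
have -> : (z + h) ^+ n.+1 - z ^+ n.+1 - n.+1%:R * z ^+ n.+1.-1 * h =
    (z + h) * ((z + h) ^+ n - z ^+ n - n%:R * z ^+ n.-1 * h) + n%:R * z ^+ n.-1 * h ^+ 2.
  by case: n {IH} => [|n]; rewrite ?exprS ?expr0 /= -?natr1; ring.
rewrite (le_trans (cmodD _ _))// 2!cmodM.
have H1 : cmod (z + h) * cmod ((z + h) ^+ n - z ^+ n - n%:R * z ^+ n.-1 * h) <=
    r * (n%:R ^+ 2 * r ^+ n * cmod h ^+ 2).
  by rewrite ler_pM ?cmod_ge0 // (le_trans (cmodD _ _)).
have cn : cmod (n%:R : C) = n%:R.
  by rewrite (_ : n%:R = n%:R%:C%C :> C) ?cmod_real ?normr_nat // rmorph_nat.
have H2 : cmod (n%:R * z ^+ n.-1) * cmod (h ^+ 2) <= n%:R * r ^+ n.+1 * cmod h ^+ 2.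
  rewrite cmodX ler_wpM2r ?exprn_ge0 ?cmod_ge0 // cmodM cn ler_wpM2l //.
  rewrite cmodX (@le_trans _ _ (r ^+ n.-1)) //.
    rewrite lerXn2r ?nnegrE ?cmod_ge0 // (le_trans _ zr)// lerDl cmod_ge0 //.
  by rewrite ler_weXn2l // (leq_trans (leq_pred _)).
rewrite (le_trans (lerD H1 H2))//.
have -> : r * (n%:R ^+ 2 * r ^+ n * cmod h ^+ 2) + n%:R * r ^+ n.+1 * cmod h ^+ 2 =
  (n%:R ^+ 2 + n%:R) * (r ^+ n.+1 * cmod h ^+ 2) by rewrite (exprS r n); ring.
rewrite -mulrA ler_wpM2r ?mulr_ge0 ?exprn_ge0 ?cmod_ge0 //.
by rewrite -natr1 sqrrD1; have : 0 <= n%:R :> R by []; lra.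
Qed.

Lemma geometric_sum_le (A : R) n : 0 <= A -> \sum_(k < n) A / 2 ^+ k <= 2 * A.
Proof.
move=> A0; have -> : \sum_(k < n) A / 2 ^+ k = 2 * A - 2 * A / 2 ^+ n.
  elim: n => [|n IH]; first by rewrite big_ord0 expr0 divr1 subrr.
  by rewrite big_ord_recr /= IH exprS; field; rewrite expf_neq0.
by rewrite gerBl divr_ge0 ?mulr_ge0 ?exprn_ge0.
Qed.

Lemma nat_sqr_le4 n : n%:R ^+ 2 <= 4 ^+ n :> R.
Proof.
rewrite (_ : 4 = 2 ^+ 2 :> R); last by rewrite -natrX.
rewrite -exprM mulnC exprM lerXn2r ?nnegrE //.
by rewrite -natrX ler_nat ltnW // ltn_expl.
Qed.

Lemma fseries_entire g c : fseries g c -> entire g.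
Proof.
move=> gc z; have cc := fseries_ecoef gc.
pose r := cmod z + 1.
have r1 : 1 <= r by rewrite lerDr cmod_ge0.
have r0 : 0 < r by rewrite (lt_le_trans ltr01).
(* [8 = 4 * 2]: [4 ^+ n] dominates the polynomial factors [n] and [n^2] of the differentiated series
   and of its error, and [2 ^+ n] makes the series geometric. *)
have r8 : 0 < 8 * r by rewrite mulr_gt0.
have [M MP] := cc _ r8.
have M0 : 0 <= M.
  by rewrite (le_trans _ (MP 0%N))// mulr_ge0 ?cmod_ge0 ?exprn_ge0 ?(ltW r8).
have cn n : cmod (n%:R : C) = n%:R.
  by rewrite (_ : n%:R = n%:R%:C%C :> C) ?cmod_real ?normr_nat // rmorph_nat.
have [D DP] : exists D : C, forall n, cmod (D - \sum_(k < n) c k * (k%:R * z ^+ k.-1)) <=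
    4 * M / 2 ^+ n.
  apply: (@geometric_cvg (fun k => c k * (k%:R * z ^+ k.-1)) M M0) => n.
  rewrite !cmodM cn cmodX ler_pdivlMr ?exprn_gt0 // (le_trans _ (MP n))//.
  rewrite -mulrA ler_wpM2l ?cmod_ge0 // (_ : 8 = 4 * 2); last by rewrite -natrM.
  rewrite !exprMn [_ * 2 ^+ n * r ^+ n]mulrAC ler_wpM2r ?exprn_ge0 //.
  rewrite ler_pM ?exprn_ge0 ?cmod_ge0 //.
    rewrite (le_trans _ (nat_sqr_le4 n))// expr2 -natrM ler_nat.
    by case: (n) => // m; rewrite leq_pmulr.
  rewrite (@le_trans _ _ (r ^+ n.-1)) //.
    by rewrite lerXn2r ?nnegrE ?cmod_ge0 ?(ltW r0) // lerDl.
  by rewrite ler_weXn2l // leq_pred.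
apply: (@cder_derivable _ _ _ D) => e e0.
have M2 : 0 < 2 * M + 1 by rewrite ltr_wpDl ?mulr_ge0.
exists (Num.min 1 (e / (2 * M + 1))); first by rewrite lt_min ltr01 divr_gt0.
move=> h; rewrite lt_min => /andP[h1 h2].
have zh : cmod z + cmod h <= r by rewrite lerD2l ltW.
suff key : cmod (g (z + h) - g z - D * h) <= 2 * M * cmod h ^+ 2.
  rewrite (le_trans key)// expr2 mulrA ler_wpM2r ?cmod_ge0 //.
  rewrite ltr_pdivlMr // in h2; rewrite (le_trans _ (ltW h2))// mulrC ler_wpM2l ?cmod_ge0 //.
  by rewrite lerDl.
apply/ler_addgt0Pr => d d0.
have [M1 M10 MP1] := fseries_cvg (z + h) gc; have [M3 M30 MP3] := fseries_cvg z gc.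
have [n nP] := eps_pow2 (M1 + M3 + 4 * M) d0.
have -> : g (z + h) - g z - D * h =
  \sum_(k < n) c k * ((z + h) ^+ k - z ^+ k - k%:R * z ^+ k.-1 * h) +
  ((g (z + h) - coefsum c n (z + h)) - (g z - coefsum c n z) -
   (D - \sum_(k < n) c k * (k%:R * z ^+ k.-1)) * h).
  have -> : \sum_(k < n) c k * ((z + h) ^+ k - z ^+ k - k%:R * z ^+ k.-1 * h) =
      coefsum c n (z + h) - coefsum c n z - (\sum_(k < n) c k * (k%:R * z ^+ k.-1)) * h.
    rewrite /coefsum mulr_suml -!sumrB; apply: eq_bigr => k _; ring.
  ring.
rewrite (le_trans (cmodD _ _))// lerD //.
  rewrite (le_trans (cmod_sum _ _ _))//.
  have : \sum_(k < n) cmod (c k * ((z + h) ^+ k - z ^+ k - k%:R * z ^+ k.-1 * h)) <=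
      \sum_(k < n) M * cmod h ^+ 2 / 2 ^+ k.
    apply: ler_sum => k _; rewrite cmodM.
    rewrite (le_trans (ler_wpM2l (cmod_ge0 _) (exprD_linear_bound _ r1 zh)))//.
    rewrite ler_pdivlMr ?exprn_gt0 //.
    have -> : cmod (c k) * (k%:R ^+ 2 * r ^+ k * cmod h ^+ 2) * 2 ^+ k =
      (cmod (c k) * (k%:R ^+ 2 * r ^+ k * 2 ^+ k)) * cmod h ^+ 2 by ring.
    rewrite ler_wpM2r ?exprn_ge0 ?cmod_ge0 // (le_trans _ (MP k))//.
    rewrite ler_wpM2l ?cmod_ge0 // (_ : 8 = 4 * 2); last by rewrite -natrM.
    rewrite !exprMn mulrAC !ler_wpM2r ?exprn_ge0 ?(ltW r0) //.
    exact: nat_sqr_le4.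
  move=> /le_trans; apply; rewrite -mulrA.
  by apply: geometric_sum_le; rewrite mulr_ge0 ?exprn_ge0 ?cmod_ge0.
rewrite (le_trans (cmodB _ _))// (le_trans _ nP)//.
rewrite (_ : _ / 2 ^+ n = (M1 / 2 ^+ n + M3 / 2 ^+ n) + 4 * M / 2 ^+ n); last first.
  by rewrite -!mulrDl.
rewrite lerD //; first by rewrite (le_trans (cmodB _ _))// lerD.
rewrite cmodM (le_trans _ (DP n))// ler_piMr ?cmod_ge0 //.
exact: ltW.
Qed.

Lemma fseries_ext f g a : fseries f a -> fseries g a -> f =1 g.
Proof.
move=> fa ga z; have [M M0 MP] := fseries_cvg z fa; have [N N0 NP] := fseries_cvg z ga.
apply/eqP; rewrite -subr_eq0 -cmod_eq0 eq_le cmod_ge0 andbT.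
apply/ler_addgt0Pr => e e0; rewrite add0r; have [n nP] := eps_pow2 (M + N) e0.
have -> : f z - g z = (f z - coefsum a n z) - (g z - coefsum a n z) by ring.
by rewrite (le_trans (cmodB _ _))// (le_trans _ nP)// mulrDl lerD.
Qed.

End EntireSeries.

(** * Rotations and polar coordinates in the plane *)

Section PlaneMeasure.
Variable R : realType.
Local Notation leb := (@lebesgue_measure R).
Local Notation area := (leb \x leb)%E.
Local Notation RR := (measurableTypeR R * measurableTypeR R)%type.
Implicit Types (F : RR -> \bar R).

Lemma measurable_linear (a b : R) :
  measurable_fun setT (fun w : RR => a * w.1 + b * w.2 : measurableTypeR R).
Proof.
by apply: measurable_funD; apply: measurable_funM.
Qed.

Lemma measurable_linear2 (a b c d : R) : measurable_fun setT
  (fun w : RR => (a * w.1 + b * w.2, c * w.1 + d * w.2) : RR).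
Proof.
by apply: measurable_fun_pair; exact: measurable_linear.
Qed.

(** By Tonelli's theorem a shear is a translation on each line. *)
Lemma area_shearx F c : measurable_fun setT F -> (forall w, 0 <= F w)%E ->
  (\int[area]_w F (w.1 + c * w.2, w.2)%R = \int[area]_w F w)%E.
Proof.
move=> mF F0.
have mG : measurable_fun setT (fun w : RR => F (w.1 + c * w.2, w.2)%R).
  apply: (measurableT_comp mF); have := measurable_linear2 1 c 0 1.
  by apply: eq_measurable_fun => w _; rewrite !mul1r mul0r add0r.
have E1 := fubini_tonelli2 F mF F0; have E2 := fubini_tonelli2 _ mG (fun w => F0 _).
apply: (etrans (E2 _ _)); apply: (etrans _ (esym (E1 _ _))).
apply: eq_integral => y _; rewrite /fubini_G /=.
apply: (@ge0_integral_translate _ (c * y) (fun x => F (x, y))) => //.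
exact: measurableT_comp.
Qed.

Lemma area_sheary F c : measurable_fun setT F -> (forall w, 0 <= F w)%E ->
  (\int[area]_w F (w.1, w.2 + c * w.1)%R = \int[area]_w F w)%E.
Proof.
move=> mF F0.
have mG : measurable_fun setT (fun w : RR => F (w.1, w.2 + c * w.1)%R).
  apply: (measurableT_comp mF); have := measurable_linear2 1 0 c 1.
  by apply: eq_measurable_fun => w _; rewrite !mul1r mul0r addr0 [c * _ + _]addrC.
have E1 := fubini_tonelli1 F mF F0; have E2 := fubini_tonelli1 _ mG (fun w => F0 _).
apply: (etrans (E2 _ _)); apply: (etrans _ (esym (E1 _ _))).
apply: eq_integral => x _; rewrite /fubini_F /=.
apply: (@ge0_integral_translate _ (c * x) (fun y => F (x, y))) => //.
exact: measurableT_comp.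
Qed.

(* A rotation is a product of three shears, except for the half turn, which is
   the square of a quarter turn. *)
Lemma area_rotation F a b : measurable_fun setT F -> (forall w, 0 <= F w)%E ->
  a ^+ 2 + b ^+ 2 = 1 ->
  (\int[area]_w F (a * w.1 - b * w.2, b * w.1 + a * w.2)%R = \int[area]_w F w)%E.
Proof.
wlog aN1 : F a b / a != -1.
  move=> H mF F0 ab.
  have [aE|] := eqVneq a (-1); last by move=> aN; exact: H.
  have b0 : b = 0.
    by apply/eqP; move/eqP: ab; rewrite aE sqrrN expr1n -subr_eq0 addrAC subrr add0r sqrf_eq0.
  pose G w := F (- w.2, w.1)%R.
  have mG : measurable_fun setT G.
    apply: (measurableT_comp mF); have := measurable_linear2 0 (-1) 1 0.
    by apply: eq_measurable_fun => w _; rewrite mul0r add0r mulN1r mul1r mul0r addr0.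
  have N0 : (0 : R) != -1 by rewrite eq_sym oppr_eq0 oner_eq0.
  have E0 : (0 : R) ^+ 2 + 1 ^+ 2 = 1 by rewrite expr0n expr1n add0r.
  have mG2 := measurableT_comp mF (measurable_linear2 0 (-1) 1 0).
  have mG3 : measurable_fun setT (fun w : RR => F (0 * w.1 - 1 * w.2, 1 * w.1 + 0 * w.2)).
    by apply: eq_measurable_fun mG2 => w _ /=; congr F; congr pair; ring.
  rewrite -(H F 0 1 N0 mF F0 E0) -(H _ 0 1 N0 mG3 (fun w => F0 _) E0).
  apply: eq_integral => w _; congr F; rewrite aE b0 /=.
  by congr pair; ring.
move=> mF F0 ab.
have a1 : 1 + a != 0 by rewrite addrC -[1]opprK subr_eq0.
pose t := - (b / (1 + a)).
pose F1 w := F (w.1 + t * w.2, w.2)%R.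
have mF1 : measurable_fun setT F1.
  apply: (measurableT_comp mF); have := measurable_linear2 1 t 0 1.
  by apply: eq_measurable_fun => w _; rewrite !mul1r mul0r add0r.
pose F2 w := F1 (w.1, w.2 + b * w.1)%R.
have mF2 : measurable_fun setT F2.
  apply: (measurableT_comp mF1); have := measurable_linear2 1 0 b 1.
  by apply: eq_measurable_fun => w _; rewrite !mul1r mul0r addr0 [b * _ + _]addrC.
rewrite -(@area_shearx F t) // -/F1 -(@area_sheary F1 b) //; last by move=> w; exact: F0.
rewrite -/F2 -(@area_shearx F2 t) //; last by move=> w; exact: F0.
apply: eq_integral => w _; rewrite /F2 /F1 /=; congr F.
have bE : b ^+ 2 = 1 - a ^+ 2 by rewrite -ab; ring.
have tb : 1 + t * b = a.
  rewrite /t; apply: (mulfI a1).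
  have -> : (1 + a) * (1 + - (b / (1 + a)) * b) = (1 + a) - b ^+ 2 by field.
  by rewrite bE; ring.
have t2 : t + t * a = - b by rewrite -{1}[t]mulr1 -mulrDr /t mulNr divfK.
have -> : w.2 + b * (w.1 + t * w.2) = b * w.1 + a * w.2 by rewrite -tb; ring.
have -> : w.1 + t * w.2 + t * (b * w.1 + a * w.2) = a * w.1 - b * w.2.
  have -> : w.1 + t * w.2 + t * (b * w.1 + a * w.2) = (1 + t * b) * w.1 + (t + t * a) * w.2 by ring.
  by rewrite tb t2; ring.
by [].
Qed.

Definition sqnorm (al : R) (w : RR) : measurableTypeR R := al * (w.1 ^+ 2 + w.2 ^+ 2).

Lemma measurable_sqnorm al : measurable_fun setT (sqnorm al).
Proof.
apply: measurable_funM => //; apply: measurable_funD.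
  by apply: measurable_funX; exact: measurable_fst.
by apply: measurable_funX; exact: measurable_snd.
Qed.

Lemma lebesgue_scale (k : R) (A : set (measurableTypeR R)) : 0 < k -> measurable A ->
  (leb ((fun x : R => k * x)%R @^-1` A) = (k^-1)%:E * leb A)%E.
Proof.
move=> k0 mA.
have mk : measurable_fun setT (fun x : measurableTypeR R => k * x : measurableTypeR R).
  by apply: measurable_funM => //.
have kn : 0 <= k by exact: ltW.
pose m := mscale (NngNum kn) (pushforward leb (fun x : measurableTypeR R => k * x : measurableTypeR R)).
have E : leb A = m mk A.
  apply: lebesgue_measure_unique => // _ [[a b]] _ <-.
  rewrite /= /m /mscale /= /pushforward.
  have -> : (fun x => k * x) @^-1` `]a, b] = `]a / k, b / k]%classic.
    by apply/seteqP; split => x /=; rewrite !in_itv /= ltr_pdivrMr // ler_pdivlMr // mulrC.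
  rewrite !lebesgue_measure_itv /= !lte_fin ltr_pM2r ?invr_gt0 //.
  case: ifP => _; last by rewrite mule0.
  by rewrite -!EFinB -EFinM; congr _%:E; field; rewrite gt_eqF.
by rewrite E /m /mscale /= muleA -EFinM mulVf ?gt_eqF // mul1e.
Qed.

Lemma area_rect (A B : set (measurableTypeR R)) : measurable A -> measurable B ->
  (area (A `*` B) = leb A * leb B)%E.
Proof. by move=> mA mB; rewrite product_measure1E. Qed.

Lemma measurable_disc al s : measurable (sqnorm al @^-1` `]-oo, s]).
Proof. by rewrite -[X in measurable X]setTI; apply: measurable_sqnorm. Qed.

Lemma mule_scale2 (a b : R) (x y : \bar R) :
  (a%:E * (b%:E * x * (b%:E * y)) = (a * (b * b))%:E * (x * y))%E.
Proof. by rewrite !EFinM -!muleA (muleCA x). Qed.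

Lemma area_scale (k : R) (X : set RR) : 0 < k -> measurable X ->
  (area ((fun w : RR => (k * w.1, k * w.2)%R) @^-1` X) = (k ^- 2)%:E * area X)%E.
Proof.
move=> k0 mX.
have mk : measurable_fun setT (fun w : RR => (k * w.1, k * w.2) : RR).
  have := measurable_linear2 k 0 0 k; apply: eq_measurable_fun => w _.
  by rewrite !mul0r addr0 add0r.
have kn : 0 <= k ^+ 2 by rewrite sqr_ge0.
pose m := mscale (NngNum kn) (pushforward area (fun w : RR => (k * w.1, k * w.2) : RR)).
have E : area X = m mk X.
  apply: product_measure_unique => // A B mA mB.
  rewrite /= /m /mscale /= /pushforward.
  have -> : (fun w : RR => (k * w.1, k * w.2)) @^-1` (A `*` B) =
    ((fun x : R => k * x) @^-1` A) `*` ((fun x : R => k * x) @^-1` B) by [].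
  have mkx : measurable_fun setT (fun x : measurableTypeR R => k * x : measurableTypeR R).
    exact: measurable_funM.
  have mpre D : measurable D -> measurable ((fun x : measurableTypeR R => k * x : measurableTypeR R) @^-1` D).
    by move=> mD; rewrite -[X in measurable X]setTI; exact: mkx.
  rewrite product_measure1E; [|exact: mpre|exact: mpre].
  rewrite [X in (_ * (X * _))%E](lebesgue_scale k0 mA).
  rewrite [X in (_ * (_ * X))%E](lebesgue_scale k0 mB).
  transitivity ((k ^+ 2 * (k^-1 * k^-1))%:E * (leb A * leb B))%E.
    exact: mule_scale2.
  rewrite (_ : k ^+ 2 * (k^-1 * k^-1) = 1) ?mul1e //.
  by field; rewrite gt_eqF.
rewrite E /m /mscale /= muleA -EFinM mulVf ?mul1e //.
by rewrite expf_neq0 // gt_eqF.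
Qed.

(** The dilation by [1 / sqrt s] maps the disc to the unit one and divides areas by [s]. This
    linearity in [s] is what gives [sqnorm al] a multiple of Lebesgue measure as its law. *)
Lemma area_disc_scale al s : 0 < al -> 0 < s ->
  (area (sqnorm al @^-1` `]-oo, s]) = s%:E * area (sqnorm al @^-1` `]-oo, 1%R]))%E.
Proof.
move=> al0 s0; pose k := Num.sqrt s^-1.
have k0 : 0 < k by rewrite sqrtr_gt0 invr_gt0.
have k2 : k ^+ 2 = s^-1 by rewrite sqr_sqrtr // invr_ge0 ltW.
have -> : sqnorm al @^-1` `]-oo, s] =
    (fun w : RR => (k * w.1, k * w.2)%R) @^-1` (sqnorm al @^-1` `]-oo, 1]).
  apply/seteqP; split => w; rewrite /sqnorm /= !in_itv /= !exprMn -mulrDr;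
    by rewrite mulrCA k2 [s^-1 * _]mulrC ler_pdivrMr // mul1r.
by rewrite area_scale // ?k2 ?invrK //; exact: measurable_disc.
Qed.

Lemma area_disc_fin al : 0 < al -> (area (sqnorm al @^-1` `]-oo, 1%R]) < +oo)%E.
Proof.
move=> al0; pose r := al^-1 + 1.
have r1 : 0 < al^-1 by rewrite invr_gt0.
have r0 : 0 <= r by rewrite /r; lra.
apply: (@le_lt_trans _ _ (area (`[- r, r]%classic `*` `[- r, r]%classic))).
  apply: le_measure; rewrite ?inE; [exact: measurable_disc|exact: measurableX|].
  have H x t : 0 <= t -> al * (x ^+ 2 + t) <= 1 -> `|x| <= r.
    move=> t0 xt; have x2 : x ^+ 2 <= al^-1.
      by rewrite -[al^-1]mul1r ler_pdivlMr // mulrC (le_trans _ xt)// ler_pM2l // lerDl.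
    rewrite -ler_sqr ?nnegrE // real_normK ?num_real // (le_trans x2)//.
    by rewrite /r sqrrD expr1n mulr1; have := sqr_ge0 al^-1; lra.
  move=> [x y]; rewrite /sqnorm /= !in_itv /= => xy.
  by rewrite -!ler_norml; split; [apply: H xy|rewrite addrC in xy; apply: H xy]; rewrite sqr_ge0.
have rr : - r < r by rewrite /r; lra.
by rewrite area_rect // lebesgue_measure_itv /= lte_fin rr -EFinB -EFinM ltry.
Qed.

Lemma area_disc_gt0 al : 0 < al -> (0 < area (sqnorm al @^-1` `]-oo, 1%R]))%E.
Proof.
move=> al0; pose r := Num.min 1 (al^-1 / 2).
have r0 : 0 < r by rewrite lt_min ltr01 divr_gt0 // invr_gt0.
have r1 : r <= 1 by rewrite ge_min lexx.
have r2 : r <= al^-1 / 2 by rewrite ge_min lexx orbT.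
apply: (@lt_le_trans _ _ (area (`[0, r]%classic `*` `[0, r]%classic))).
  by rewrite area_rect // lebesgue_measure_itv /= lte_fin r0 -EFinB -EFinM lte_fin subr0 mulr_gt0.
apply: le_measure; rewrite ?inE; [exact: measurableX|exact: measurable_disc|].
move=> [x y]; rewrite /sqnorm /= !in_itv /= => -[/andP[x0 xr] /andP[y0 yr]].
have H t : 0 <= t -> t <= r -> t ^+ 2 <= al^-1 / 2.
  move=> t0 tr; rewrite (le_trans _ r2)// (le_trans _ tr)// expr2 ler_piMr //.
  exact: le_trans tr r1.
rewrite -ler_pdivlMl // mulr1.
by rewrite (le_trans (lerD (H _ x0 xr) (H _ y0 yr)))// -splitr.
Qed.

(* The value is [pi / al], but only positivity and finiteness matter. *)
Definition discarea al : R := fine (area (sqnorm al @^-1` `]-oo, 1%R])).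

Lemma discareaE al : 0 < al -> ((discarea al)%:E = area (sqnorm al @^-1` `]-oo, 1%R]))%E.
Proof.
move=> al0; rewrite /discarea fineK // ge0_fin_numE; first exact: area_disc_fin.
exact: measure_ge0.
Qed.

Lemma discarea_gt0 al : 0 < al -> 0 < discarea al.
Proof. by move=> al0; rewrite -lte_fin discareaE // area_disc_gt0. Qed.

Local Notation nu al := (pushforward area (sqnorm al)).

Lemma nu_le al s : 0 < al -> (nu al `]-oo, s] = (Num.max s 0 * discarea al)%:E)%E.
Proof.
move=> al0; have [s0|s0] := ltP 0 s.
  by rewrite /pushforward area_disc_scale // -discareaE // -EFinM.
rewrite mul0r; apply/eqP; rewrite eq_le; apply/andP; split; last first.
  by rewrite /pushforward.
apply/lee_addgt0Pr => e e0; rewrite add0e.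
have t0 : 0 < e / discarea al by rewrite divr_gt0 // discarea_gt0.
rewrite /pushforward.
apply: (@le_trans _ _ (area (sqnorm al @^-1` `]-oo, e / discarea al]))).
  apply: le_measure; rewrite ?inE; [exact: measurable_disc|exact: measurable_disc|].
  by move=> w /=; rewrite !in_itv /= => /le_trans; apply; rewrite (le_trans s0)// ltW.
rewrite area_disc_scale // -discareaE // -EFinM lee_fin divfK //.
by rewrite gt_eqF // discarea_gt0.
Qed.

Lemma nu_itv al a b : 0 < al -> a < b ->
  (nu al `]a, b] = ((Num.max b 0 - Num.max a 0) * discarea al)%:E)%E.
Proof.
move=> al0 ab.
have -> : (nu al `]a, b] = nu al `]-oo, b] - nu al `]-oo, a])%E.
  rewrite /pushforward.
  have -> : sqnorm al @^-1` `]a, b] = (sqnorm al @^-1` `]-oo, b]) `\` (sqnorm al @^-1` `]-oo, a]).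
    apply/seteqP; split => w /=; rewrite !in_itv /=.
      by move=> /andP[h1 h2]; split => //; apply/negP; rewrite -ltNge.
    by move=> [h1 /negP]; rewrite -ltNge => ->.
  rewrite measureD; [|exact: measurable_disc|exact: measurable_disc|]; last first.
    by have := ltry (Num.max b 0 * discarea al); rewrite -(nu_le b al0).
  congr (_ - area _)%E; apply/seteqP; split => w /=; rewrite !in_itv /=; first by case.
  by move=> h; split=> //; rewrite (le_trans h)// ltW.
by rewrite !nu_le // -EFinB mulrBl.
Qed.

(** Uniqueness of Lebesgue measure concerns the whole line, but the law of [sqnorm al] lives on the
    positive half. Adding Lebesgue measure on []-oo, 0]] to the normalised law gives a measure [m]
    with the value [b - a] on every []a, b]]. *)
Lemma radial_measure al (A : set (measurableTypeR R)) : 0 < al -> measurable A ->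
  A `<=` `]0, +oo[ -> (nu al A = (discarea al)%:E * leb A)%E.
Proof.
move=> al0 mA A0.
have c0 := discarea_gt0 al0.
have ci : 0 <= (discarea al)^-1 by rewrite invr_ge0 ltW.
have mN : measurable (`]-oo, 0] : set (measurableTypeR R)) by [].
pose m := measure_add (mscale (NngNum ci) (nu al)) (mrestr leb mN).
have mE X : m (@measurable_sqnorm al) X =
    ((discarea al)^-1%:E * nu al X + leb (X `&` `]-oo, 0%R]))%E.
  exact: measure_addE.
have E : leb A = m (@measurable_sqnorm al) A.
  apply: lebesgue_measure_unique => // _ [[a b]] _ <-.
  etransitivity; last exact/esym/mE.
  rewrite /=.
  have [ab|ba] := ltP a b; last first.
    by rewrite set_itv_ge ?bnd_simp -?leNgt // /pushforward preimage_set0 set0I !measure0 mule0 adde0.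
  rewrite nu_itv // -EFinM [_ * discarea al]mulrC mulKf ?gt_eqF //.
  have -> : `]a, b] `&` `]-oo, 0] = `]a, Num.min b 0]%classic.
    by apply/seteqP; split => x /=; rewrite !in_itv /= le_min;
      [move=> [/andP[-> ->] ->]|move=> /and3P[-> -> ->]].
  rewrite !lebesgue_measure_itv /= !lte_fin ab.
  have [b0|b0] := leP b 0.
    by rewrite ab (max_idPr (ltW (lt_le_trans ab b0))) subrr add0e.
  have [a0|a0] := ltP a 0; last by rewrite adde0 EFinB.
  by rewrite subr0 -!EFinB -EFinD; congr _%:E; ring.
rewrite E mE.
have -> : A `&` `]-oo, 0] = set0.
  apply/seteqP; split => x //= [/A0 /=]; rewrite !in_itv /= andbT => h1 h2.
  by have := lt_le_trans h1 h2; rewrite ltxx.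
by rewrite measure0 adde0 muleA -EFinM mulfV ?mul1e // gt_eqF.
Qed.

Lemma radial_integral al (Phi : R -> \bar R) : 0 < al ->
  measurable_fun setT Phi -> (forall x, 0 <= Phi x)%E ->
  (\int[area]_w Phi (sqnorm al w) =
   (discarea al)%:E * \int[leb]_(x in `]0%R, +oo[) Phi x)%E.
Proof.
move=> al0 mPhi Phi0.
have c0 := discarea_gt0 al0.
have cn : 0 <= discarea al by exact: ltW.
have := @ge0_integral_pushforward _ _ _ _ R _ (@measurable_sqnorm al) area setT Phi
  measurableT mPhi (fun x _ => Phi0 x).
rewrite preimage_setT /comp => <-.
have -> : [set: measurableTypeR R] = `]-oo, 0] `|` `]0, +oo[.
  apply/seteqP; split => x //= _; rewrite !in_itv /= andbT.
  by have [h|h] := leP x 0; [left|right].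
rewrite ge0_integral_setU //=; last 2 first.
  exact: measurable_funTS.
  apply/disj_setPS => x /= [] ; rewrite !in_itv /= andbT => h1 h2.
  by have := lt_le_trans h2 h1; rewrite ltxx.
  exact: measurable_sqnorm.
move=> mS; rewrite (@null_set_integral _ _ _ (nu al)) //; last 2 first.
  exact: measurable_funTS.
  by etransitivity; [exact: nu_le|rewrite maxxx mul0r].
rewrite add0e.
transitivity (\int[mscale (NngNum cn) leb]_(x in `]0%R, +oo[) Phi x)%E.
  by apply: eq_measure_integral => A mA A0; exact: radial_measure.
rewrite ge0_integral_mscale //.
exact: measurable_funTS.
Qed.

End PlaneMeasure.

(** * Poisson weights *)

Section PoissonWeights.
Variable R : realType.
Local Notation leb := (@lebesgue_measure R).
Implicit Types (x q : R) (n k : nat).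

Definition pw n x : R := x ^+ n / n`!%:R * expR (- x).

Lemma fact_gt0R n : 0 < n`!%:R :> R.
Proof. by rewrite ltr0n fact_gt0. Qed.

Lemma pw_ge0 n x : 0 <= x -> 0 <= pw n x.
Proof.
by move=> x0; rewrite /pw !mulr_ge0 ?expR_ge0 ?exprn_ge0 ?invr_ge0 ?(ltW (fact_gt0R _)).
Qed.

Lemma pwS n x : pw n.+1 x = x / n.+1%:R * pw n x.
Proof.
rewrite /pw exprS factS natrM; field.
by rewrite gt_eqF ?fact_gt0R //= -[1]/(1%:R) -natrD pnatr_eq0.
Qed.

Lemma continuous_pw n : continuous (pw n).
Proof.
move=> x; apply: cvgM; first apply: cvgMl.
  exact: exprn_continuous.
apply: continuous_comp; first exact: opp_continuous.
exact: continuous_expR.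
Qed.

Lemma measurable_pw n : measurable_fun setT (pw n).
Proof. exact: continuous_measurable_fun (@continuous_pw n). Qed.

Lemma sum_pw_le1 n x : 0 <= x -> \sum_(k < n) pw k x <= 1.
Proof.
move=> x0; rewrite /pw -mulr_suml expRN ler_pdivrMr ?expR_gt0 // mul1r.
have := @nondecreasing_cvgn_le R (series (exp_coeff x)) _ (is_cvg_series_exp_coeff x) n.
rewrite /series /= big_mkord; apply.
apply/nondecreasing_seqP => k; rewrite /series /= big_nat_recr //= lerDl.
by rewrite /exp_coeff /= mulr_ge0 ?exprn_ge0 ?invr_ge0.
Qed.

Lemma pw_le1 n x : 0 <= x -> pw n x <= 1.
Proof.
move=> x0; rewrite (le_trans _ (sum_pw_le1 n.+1 x0))// big_ord_recr /= lerDr.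
by apply: sumr_ge0 => k _; exact: pw_ge0.
Qed.

(** [pw n.+1 x = x / n.+1 * pw n x] is at most 1, hence [pw n x <= n.+1 / x]. *)
Lemma cvg_pw n : pw n x @[x --> +oo] --> 0.
Proof.
apply/cvgrPdist_le => e e0; near=> x.
have x0 : 0 < x by near: x; exact: nbhs_pinfty_gt.
have xn : n.+1%:R / e <= x by near: x; apply: nbhs_pinfty_ge; exact: num_real.
rewrite sub0r normrN ger0_norm ?pw_ge0 ?(ltW x0) //.
have := pw_le1 n.+1 (ltW x0); rewrite pwS mulrAC ler_pdivrMr ?ltr0n // mul1r => H.
rewrite -(ler_pM2l x0) (le_trans H)// -ler_pdivrMr //.
Unshelve. all: by end_near. Qed.

Lemma is_derive_expRN x : is_derive x 1 (fun y : R => expR (- y)) (- expR (- x)).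
Proof.
have := is_derive1_comp (is_derive_expR (- x)) (is_deriveNid x 1).
by rewrite mulrN1.
Qed.

Lemma is_derive_pw0 x : is_derive x 1 (pw 0) (- pw 0 x).
Proof.
have -> : pw 0 = (fun y => expR (- y)) by apply/funext => y; rewrite /pw expr0 fact0 divr1 mul1r.
exact: is_derive_expRN.
Qed.

Lemma is_derive_pw n x : is_derive x 1 (pw n.+1) (pw n x - pw n.+1 x).
Proof.
have dX : is_derive x 1 (fun y : R => y ^+ n.+1) (n.+1%:R * x ^+ n).
  have := @is_deriveX R R id n.+1 x 1 1 (is_derive_id _ _).
  rewrite (_ : id ^+ n.+1 = (fun y : R => y ^+ n.+1)); last first.
    by apply/funext => y; rewrite exprfctE.
  by rewrite /GRing.scale /= mulr1.
have := is_deriveZ (n.+1`!%:R^-1) (is_deriveM dX (is_derive_expRN x)).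
rewrite /GRing.scale /= => H.
have E : n.+1`!%:R^-1 \*: ((fun y : R => y ^+ n.+1) * (fun y : R => expR (- y))) = pw n.+1.
  apply/funext => y; rewrite /pw -[LHS]/(n.+1`!%:R^-1 * (y ^+ n.+1 * expR (- y))).
  by rewrite mulrA [_^-1 * _]mulrC.
rewrite E in H; apply: is_derive_eq H _; rewrite /pw factS natrM exprS; field.
by rewrite gt_eqF ?fact_gt0R //= -[1]/(1%:R) -natrD pnatr_eq0.
Qed.

(* If [m] is the integer part of the square root of [n], each of [w_n(n)], ..., [w_(n+m)(n)]
   is at least [w_n(n) / e], and they add up to at most 1. *)
Lemma pw_peak n : pw n n%:R <= expR 1 / Num.sqrt n.+1%:R.
Proof.
have [m /andP[m1 m2]] : exists m, (m ^ 2 <= n < m.+1 ^ 2)%N.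
  elim: n => [|n [m /andP[m1 m2]]]; first by exists 0%N.
  have [h|h] := ltnP n.+1 (m.+1 ^ 2); first by exists m; rewrite h (leq_trans m1).
  exists m.+1; rewrite h (leq_ltn_trans m2) // ltn_exp2r //.
have ratio j : (j <= m)%N -> expR (-1) * pw n n%:R <= pw (n + j)%N n%:R.
  move=> jm; case: n m1 m2 => [|n] m1 m2.
    have j0 : j = 0%N.
      by move: m1 jm; rewrite leqn0 expn_eq0 /= andbT => /eqP ->; rewrite leqn0 => /eqP.
    by rewrite j0 addn0 ler_piMl ?pw_ge0 // expR_le1 lerN10.
  have nR : 0 < n.+1%:R :> R by rewrite ltr0n.
  (* Raising the index once multiplies by [n.+1 / (n.+1 + i.+1)], at least [exp (- j / n.+1)]. After
     [j] steps the loss is [exp (- j^2 / n.+1)], and [j^2 <= m^2 <= n.+1]. *)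
  have H i : (i <= j)%N -> pw n.+1 n.+1%:R * expR (- (j%:R / n.+1%:R) * i%:R) <= pw (n.+1 + i)%N n.+1%:R.
    elim: i => [_|i IH ij]; first by rewrite mulr0 expR0 mulr1 addn0.
    have -> : expR (- (j%:R / n.+1%:R) * i.+1%:R) =
        expR (- (j%:R / n.+1%:R) * i%:R) * expR (- (j%:R / n.+1%:R)) :> R.
      by rewrite -expRD -[i.+1%:R]natr1 mulrDr mulr1.
    rewrite addnS (pwS (n.+1 + i)) mulrA [leLHS]mulrC.
    have i0 := IH (ltnW ij).
    rewrite ler_pM ?expR_ge0 ?mulr_ge0 ?pw_ge0 ?expR_ge0 ?ler0n //.
    rewrite expRN -[leRHS]invf_div lef_pV2 ?posrE ?expR_gt0 ?divr_gt0 ?ltr0n //.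
    rewrite (le_trans _ (expR_ge1Dx _))// -addnS natrD mulrDl divff ?gt_eqF // lerD2l.
    by rewrite ler_pM2r ?invr_gt0 // ler_nat.
  rewrite (le_trans _ (H j (leqnn j)))// mulrC ler_wpM2l ?pw_ge0 // ler_expR.
  rewrite mulNr lerN2 mulrAC ler_pdivrMr // mul1r -natrM ler_nat.
  by rewrite (leq_trans _ m1)// -mulnn leq_mul.
have := sum_pw_le1 (n + m.+1) (ler0n R n); rewrite big_split_ord /= => S1.
have S2 : \sum_(i < m.+1) expR (-1) * pw n n%:R <= 1.
  rewrite (le_trans _ S1)// (le_trans (_ : _ <= \sum_(i < m.+1) pw (n + i) n%:R)) //.
    by apply: ler_sum => i _; apply: ratio; rewrite -ltnS.
  by rewrite lerDr; apply: sumr_ge0 => k _; exact: pw_ge0.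
rewrite sumr_const card_ord in S2.
have s0 : 0 < Num.sqrt n.+1%:R :> R by rewrite sqrtr_gt0 ltr0n.
have sm : Num.sqrt n.+1%:R <= m.+1%:R :> R.
  by rewrite -[leRHS]ger0_norm // -sqrtr_sqr ler_wsqrtr // -natrX ler_nat.
rewrite ler_pdivlMr // (@le_trans _ _ (pw n n%:R * m.+1%:R)) //.
  by rewrite ler_wpM2l ?pw_ge0.
by rewrite -(ler_pM2l (expR_gt0 (-1))) mulrA mulr_natr -expRD addNr expR0.
Qed.

(* [ln y <= y - 1] at [y = sqrt (x / n)]. *)
Lemma pw_gauss n x : 0 <= x ->
  pw n x <= pw n n%:R * expR (- (Num.sqrt x - Num.sqrt n%:R) ^+ 2).
Proof.
move=> x0; pose a := Num.sqrt x; pose b : R := Num.sqrt n%:R.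
have xa : x = a ^+ 2 by rewrite sqr_sqrtr.
have nb : n%:R = b ^+ 2 by rewrite sqr_sqrtr.
have a0 : 0 <= a by exact: sqrtr_ge0.
have b0 : 0 <= b by exact: sqrtr_ge0.
rewrite /pw -/a -/b [x ^+ n / _]mulrC [n%:R ^+ n / _]mulrC -!mulrA.
rewrite ler_pM2l ?invr_gt0 ?fact_gt0R // -expRD.
have -> : - n%:R + - (a - b) ^+ 2 = - x + (2 * a * b - 2 * n%:R).
  by rewrite xa nb; ring.
rewrite expRD [expR (- x) * _]mulrC mulrA ler_pM2r ?expR_gt0 //.
case: (posnP n) => [n0|n0].
  move: nb; rewrite n0 => /esym/eqP; rewrite sqrf_eq0 => /eqP ->.
  by rewrite !expr0 mulr0 mulr0 subrr expR0 mulr1.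
have b1 : 0 < b by rewrite sqrtr_gt0 ltr0n.
have E : a / b <= expR (a / b - 1).
  by rewrite (le_trans _ (expR_ge1Dx _))// addrC subrK.
(* As [n = b^2], the left side is [x^n / n^n] and the right side [exp (2 a b - 2 n)]. *)
have : (a / b) ^+ (2 * n) <= expR (a / b - 1) ^+ (2 * n).
  by rewrite lerXn2r ?nnegrE ?divr_ge0 ?expR_ge0.
rewrite -expRM_natl expr_div_n !exprM -xa -nb ler_pdivrMr ?exprn_gt0 ?ltr0n //.
rewrite mulrC; congr (_ <= _ * expR _).
rewrite natrM nb; field; exact: lt0r_neq0.
Qed.

(** A Gaussian regime up to [3 n] and an exponential tail beyond. For [x <= 3 n] one has
    [(x - n)^2 = (a - b)^2 (a + b)^2] with [(a + b)^2 <= 2 (x + n) <= 8 n]. *)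
Lemma pw_split n x : 0 <= x ->
  (x - n%:R) ^+ 2 / (8 * n.+1%:R) <= (Num.sqrt x - Num.sqrt n%:R) ^+ 2 \/
  x / 8 <= (Num.sqrt x - Num.sqrt n%:R) ^+ 2.
Proof.
move=> x0; pose a := Num.sqrt x; pose b : R := Num.sqrt n%:R.
have xa : x = a ^+ 2 by rewrite sqr_sqrtr.
have nb : n%:R = b ^+ 2 by rewrite sqr_sqrtr.
have a0 : 0 <= a by exact: sqrtr_ge0.
have b0 : 0 <= b by exact: sqrtr_ge0.
rewrite -/a -/b; have [h|h] := leP x (3 * n%:R).
  left; rewrite ler_pdivrMr ?mulr_gt0 ?ltr0n //.
  have -> : (x - n%:R) ^+ 2 = (a - b) ^+ 2 * (a + b) ^+ 2 by rewrite xa nb; ring.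
  rewrite ler_wpM2l ?sqr_ge0 // -[n.+1%:R]natr1 nb; rewrite xa nb in h.
  have := sqr_ge0 (a - b); rewrite sqrrB sqrrD; lra.
right; rewrite xa nb in h *.
(* This square bounds [2 a b] by [3/4 a^2 + 4/3 b^2]; since [3 b^2 < a^2], at least [5/36 a^2] of
   [(a - b)^2] is left, more than [a^2 / 8]. *)
have := sqr_ge0 (3 * a - 4 * b); rewrite !sqrrB !exprMn; nra.
Qed.

(** The derivatives [pw k - pw k.+1] telescope, so [F] is a primitive of [pw n], going from [-1] at
    0 to 0 at infinity. *)
Lemma integral_pw n : (\int[leb]_(x in `]0%R, +oo[) (pw n x)%:E = 1)%E.
Proof.
pose F x := - \sum_(k < n.+1) pw k x.
have dF x : is_derive x 1 F (pw n x).
  rewrite /F; elim: (n) => [|m IH].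
    have := is_deriveN (is_derive_pw0 x); rewrite opprK.
    by congr is_derive; apply/funext => y; rewrite big_ord1.
  have := is_deriveB IH (is_derive_pw m x).
  rewrite subKr.
  by congr is_derive; apply/funext => y; rewrite [in RHS]big_ord_recr opprD.
rewrite integral_itv_obnd_cbnd; last first.
  by apply/measurable_EFinP; apply: measurable_funTS; exact: measurable_pw.
rewrite (@ge0_continuous_FTC2y _ (pw n) F 0 0).
- rewrite /F big_ord_recl big1 ?addr0 => [|k _]; last first.
    by rewrite /pw /= expr0n mul0r mul0r.
  by rewrite -EFinB sub0r opprK /pw expr0 fact0 divr1 mul1r oppr0 expR0.
- by move=> x; exact: pw_ge0.
- by apply: continuous_subspaceT; exact: continuous_pw.
- have H : forall m, \sum_(k < m) pw k x @[x --> +oo] --> 0.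
    elim=> [|m IH]; first by under eq_fun do rewrite big_ord0; exact: cvg_cst.
    rewrite (_ : (fun x => \sum_(k < m.+1) pw k x) =
      (fun x => \sum_(k < m) pw k x) + pw m); last first.
      by apply/funext => x; rewrite big_ord_recr.
    by have := cvgD IH (cvg_pw m); rewrite addr0; apply.
  by have := cvgN (H n.+1); rewrite oppr0; apply.
- by move=> x _; have [] := dF x.
- apply: cvg_at_right_filter; apply: differentiable_continuous.
  by apply/derivable1_diffP; have [] := dF 0.
- by move=> x _; rewrite derive1E; have [] := dF x.
Qed.

Lemma integral_gauss_le q n : 0 < q ->
  (\int[leb]_x (expR (- (q * ((x - n%:R) ^+ 2 / (8 * n.+1%:R)))))%:E =
   (Num.sqrt (8 * pi / q) * Num.sqrt n.+1%:R)%:E)%E.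
Proof.
(* The standard deviation with [2 s^2 = 8 (n + 1) / q], which makes the integrand a multiple of a
   normal density. *)
move=> q0; pose s : R := Num.sqrt (4 * n.+1%:R / q).
have n0 : 0 < n.+1%:R :> R by rewrite ltr0n.
have s0 : 0 < s by rewrite sqrtr_gt0 divr_gt0 ?mulr_gt0.
have s2 : s ^+ 2 = 4 * n.+1%:R / q by rewrite sqr_sqrtr // divr_ge0 ?mulr_ge0 ?ltW.
have := @integral_normal_pdf R n%:R s.
under eq_integral do rewrite normal_pdfE ?gt_eqF //.
have p0 : 0 < normal_peak s by rewrite normal_peak_gt0 // gt_eqF.
have pE : (normal_peak s)^-1 = Num.sqrt (8 * pi / q) * Num.sqrt n.+1%:R.
  rewrite /normal_peak invrK s2 -sqrtrM; last by rewrite divr_ge0 ?mulr_ge0 ?pi_ge0 ?ltW.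
  by congr Num.sqrt; rewrite -mulr_natr; field; rewrite gt_eqF.
rewrite -pE => H.
have -> : (normal_peak s)^-1%:E = ((normal_peak s)^-1%:E * 1)%E by rewrite mule1.
rewrite -H -ge0_integralZl //; first last.
- by rewrite lee_fin invr_ge0 ltW.
- by move=> x _; rewrite lee_fin mulr_ge0 ?normal_peak_ge0 ?normal_fun_ge0.
- apply/measurable_EFinP; apply: measurable_funM => //; exact: measurable_normal_fun.
apply: eq_integral => x _; rewrite -EFinM mulKf ?gt_eqF // /normal_fun s2.
congr (expR _)%:E; rewrite -mulr_natr; field.
by rewrite !gt_eqF // -[1]/(1%:R) -?natrD ?ltr0n.
Qed.

Lemma integral_expo q : 0 < q ->
  (\int[leb]_(x in `]0%R, +oo[) (expR (- (q * (x / 8))))%:E = (8 / q)%:E)%E.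
Proof.
move=> q0; have q8 : 0 < q / 8 by rewrite divr_gt0.
rewrite integral_itv_obnd_cbnd; last first.
  apply/measurable_EFinP; apply: measurable_funTS; apply: measurableT_comp => //.
  by apply: measurableT_comp => //; apply: measurable_funM => //; exact: measurable_funM.
have H : (\int[leb]_(x in `[0%R, +oo[) (q / 8 * expR (- (q / 8) * x))%:E = 1)%E.
  rewrite integral_mkcond -[RHS](integral_exponential_pdf q8).
  apply: eq_integral => x _; rewrite /exponential_pdf !patchE.
  by case: ifP.
have -> : (8 / q)%:E = ((8 / q)%:E * 1)%E by rewrite mule1.
rewrite -H -ge0_integralZl //; first last.
- by rewrite lee_fin divr_ge0 ?ltW.
- by move=> x _; rewrite lee_fin mulr_ge0 ?expR_ge0 ?(ltW q8).
- apply/measurable_EFinP; apply: measurable_funM => //; apply: measurable_funTS.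
  by apply: measurableT_comp => //; exact: measurable_funM.
apply: eq_integral => x _; rewrite -EFinM; congr _%:E.
rewrite [RHS]mulrA (_ : 8 / q * (q / 8) = 1).
  by rewrite mul1r; congr expR; field.
by field; rewrite gt_eqF.
Qed.

(** With [r = sqrt (n + 1)], [pw_peak] gives the height [(e / r)^q], and [pw_split] bounds the
    Gaussian factor of [pw_gauss] by the sum of its two regimes. These have integrals of order [r]
    and 1, and [1 <= r] absorbs the second. *)
Lemma integral_pw_powR q : 0 < q -> q < 1 -> exists2 K, 0 < K & forall n,
  (\int[leb]_(x in `]0%R, +oo[) ((pw n x) `^ q)%:E <=
   (K * (Num.sqrt n.+1%:R) `^ (1 - q))%:E)%E.
Proof.
move=> q0 q1; pose K := expR 1 `^ q * (Num.sqrt (8 * pi / q) + 8 / q).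
exists K => [|n].
  by rewrite mulr_gt0 ?powR_gt0 ?expR_gt0 // ltr_wpDl ?sqrtr_ge0 ?divr_gt0.
set r : R := Num.sqrt n.+1%:R.
have r1 : 1 <= r by rewrite -[1]sqrtr1 ler_wsqrtr // ler1n.
have r0 : 0 < r by rewrite (lt_le_trans ltr01).
pose A : R := (expR 1 / r) `^ q.
have A0 : 0 <= A by exact: powR_ge0.
pose g1 x := expR (- (q * ((x - n%:R) ^+ 2 / (8 * n.+1%:R)))).
pose g2 x := expR (- (q * (x / 8))).
have mg1 : measurable_fun setT g1.
  apply: measurableT_comp => //; apply: measurableT_comp => //.
  by apply: measurable_funM => //; apply: measurable_funM => //; apply: measurable_funX; exact: measurable_funB.
have mg2 : measurable_fun setT g2.
  apply: measurableT_comp => //; apply: measurableT_comp => //.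
  by apply: measurable_funM => //; exact: measurable_funM.
apply: (@le_trans _ _ (\int[leb]_(x in `]0%R, +oo[) (A%:E * ((g1 x)%:E + (g2 x)%:E)))%E).
  apply: ge0_le_integral => //.
  - by move=> x _; rewrite lee_fin powR_ge0.
  - apply/measurable_EFinP; apply: measurable_funTS.
    by apply: (measurableT_comp (measurable_powR q)); exact: measurable_pw.
  - apply: measurable_funeM; apply: emeasurable_funD; apply/measurable_EFinP; exact: measurable_funTS.
  move=> x; rewrite /= in_itv /= andbT => x0.
  rewrite -EFinD -EFinM lee_fin.
  have H : pw n x <= expR 1 / r * expR (- (Num.sqrt x - Num.sqrt n%:R) ^+ 2).
    rewrite (le_trans (pw_gauss n (ltW x0)))// ler_wpM2r ?expR_ge0 //; exact: pw_peak.
  have er0 : 0 <= expR 1 / r by rewrite divr_ge0 ?expR_ge0 ?ltW.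
  apply: (@le_trans _ _ ((expR 1 / r * expR (- (Num.sqrt x - Num.sqrt n%:R) ^+ 2)) `^ q)).
    have t0 := mulr_ge0 er0 (expR_ge0 (- (Num.sqrt x - Num.sqrt n%:R) ^+ 2)).
    apply: (ge0_ler_powR (ltW q0)) H; rewrite nnegrE //; exact: pw_ge0 (ltW x0).
  rewrite powRM ?expR_ge0 // ler_wpM2l // -expRM.
  rewrite /g1 /g2; have [h|h] := pw_split n (ltW x0).
    rewrite ler_wpDr ?expR_ge0 // ler_expR mulNr lerN2 [leRHS]mulrC ler_pM2l //.
  rewrite ler_wpDl ?expR_ge0 // ler_expR mulNr lerN2 [leRHS]mulrC ler_pM2l //.
rewrite ge0_integralZl //; first last.
- by move=> x _; rewrite adde_ge0 ?lee_fin ?expR_ge0.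
- by apply: emeasurable_funD; apply/measurable_EFinP; exact: measurable_funTS.
rewrite ge0_integralD //; first last.
- by apply/measurable_EFinP; exact: measurable_funTS.
- by move=> x _; rewrite lee_fin expR_ge0.
- by apply/measurable_EFinP; exact: measurable_funTS.
- by move=> x _; rewrite lee_fin expR_ge0.
have H2 : (\int[leb]_(x in `]0%R, +oo[) (g2 x)%:E <= (8 / q)%:E)%E.
  by rewrite integral_expo.
have H1 : (\int[leb]_(x in `]0%R, +oo[) (g1 x)%:E <= (Num.sqrt (8 * pi / q) * r)%:E)%E.
  rewrite -integral_gauss_le //; apply: ge0_subset_integral => //.
  - exact/measurable_EFinP.
  - by move=> x _; rewrite lee_fin expR_ge0.
apply: (@le_trans _ _ (A%:E * ((Num.sqrt (8 * pi / q) * r)%:E + (8 / q)%:E))%E).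
  by apply: lee_wpmul2l; [rewrite lee_fin|exact: leeD H1 H2].
rewrite -EFinD -EFinM lee_fin /A powRM ?expR_ge0 ?invr_ge0 ?(ltW r0) //.
rewrite /K -!mulrA ler_wpM2l ?powR_ge0 //.
have -> : r^-1 `^ q = r `^ (- q) by rewrite -powR_inv1 ?ltW // -powRrM mulN1r.
have -> : r `^ (1 - q) = r `^ (- q) * r.
  have E : r `^ (- q + 1) = r `^ (- q) * r `^ 1 by apply: powRD; apply/implyP => _; rewrite gt_eqF.
  by rewrite [1 - q]addrC E powRr1 ?(ltW r0).
rewrite [leRHS]mulrCA ler_wpM2l ?powR_ge0 // [leRHS]mulrDl lerD ?ler_peMr ?divr_ge0 ?(ltW q0) //.
Qed.

End PoissonWeights.

(** * Parseval by roots of unity *)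

Section RootsOfUnity.
Variable R : realType.
Local Notation C := R[i].
Implicit Types (z w : C) (n m M : nat).

Definition cis (t : R) : C := pt (cos t) (sin t).

Lemma cisD s t : cis (s + t) = cis s * cis t.
Proof. by rewrite /cis; apply: eq_ReIm; rewrite ?Re_mul ?Im_mul /= ?cosD ?sinD //; ring. Qed.

Lemma cis_natM n t : cis (n%:R * t) = cis t ^+ n.
Proof.
elim: n => [|n IH]; first by rewrite mul0r expr0 /cis cos0 sin0.
by rewrite -natr1 mulrDl mul1r cisD IH exprSr.
Qed.

Lemma cmod_cis t : cmod (cis t) = 1.
Proof.
apply/eqP; rewrite -(@eqrXn2 _ 2) ?cmod_ge0 // expr1n cmod_sqr /=.
by rewrite cos2Dsin2.
Qed.

Lemma cis_neq1 t : 0 < t -> t < pi *+ 2 -> cis t != 1.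
Proof.
move=> t0 t2; apply/eqP => /(congr1 (@complex.Re R)) /= c1.
have s0 : 0 < sin (t / 2).
  apply: sin_gt0_pi; apply/andP; split; first by rewrite divr_gt0.
  by rewrite ltr_pdivrMr // mulr_natr.
have := cos2Dsin2 (t / 2); have := cosD (t / 2) (t / 2).
rewrite -splitr c1 -!expr2; have : 0 < sin (t / 2) ^+ 2 by rewrite exprn_gt0.
lra.
Qed.

Definition omega M : C := cis (pi *+ 2 / M%:R).

Lemma omega_exp M : (0 < M)%N -> omega M ^+ M = 1.
Proof.
move=> M0; rewrite -cis_natM mulrC divfK ?pnatr_eq0 -?lt0n //.
by rewrite /cis cos2pi sin2pi.
Qed.

Lemma cmod_omega M : cmod (omega M) = 1.
Proof. exact: cmod_cis. Qed.

Lemma omega_exp_neq1 M k : (0 < k < M)%N -> omega M ^+ k != 1.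
Proof.
move=> /andP[k0 kM]; have M0 : 0 < M%:R :> R by rewrite ltr0n (leq_trans _ kM).
rewrite -cis_natM cis_neq1 //.
  by rewrite mulr_gt0 ?ltr0n // divr_gt0 // mulrn_wgt0 // pi_gt0.
rewrite mulrA ltr_pdivrMr // mulrC ltr_pM2l ?ltr_nat //.
by rewrite mulrn_wgt0 // pi_gt0.
Qed.

Lemma conjc_unit (u : C) : cmod u = 1 -> conjc u = u^-1.
Proof. by move=> u1; rewrite invc_norm -cmodC u1 expr1n invr1 mul1r. Qed.

Lemma cmod_sqrC z : (cmod z ^+ 2)%:C%C = z * conjc z.
Proof. by rewrite rmorphXn /= cmodC sqr_normc. Qed.

Lemma sum_omega M n m : (n < M)%N -> (m < M)%N ->
  \sum_(j < M) (omega M ^+ n * (conjc (omega M)) ^+ m) ^+ j = if n == m then M%:R else 0.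
Proof.
move=> nM mM; have M0 : (0 < M)%N by apply: leq_ltn_trans nM.
have o0 : omega M != 0 by rewrite -cmod_gt0 cmod_omega.
rewrite conjc_unit ?cmod_omega //; set x := _ * _.
have xM : x ^+ M = 1.
  by rewrite exprMn -!exprM ![(_ * M)%N]mulnC !exprM exprVn omega_exp // invr1 !expr1n mulr1.
case: eqVneq => [nm|nm].
  have -> : x = 1 by rewrite /x nm exprVn mulfV // expf_neq0.
  by under eq_bigr do rewrite expr1n; rewrite sumr_const card_ord.
have x1 : x != 1.
  apply: contra nm => /eqP xE.
  have {xE} E : omega M ^+ n = omega M ^+ m.
    by apply: (mulIf (_ : (omega M)^-1 ^+ m != 0)); rewrite ?exprVn ?invr_eq0 ?expf_neq0 //
      mulfV ?expf_neq0 // -exprVn.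
  have W a b : (b < M)%N -> (a < b)%N -> omega M ^+ a = omega M ^+ b -> False.
    move=> bM ab H; have := @omega_exp_neq1 M (b - a); rewrite subn_gt0 ab.
    rewrite (leq_ltn_trans (leq_subr _ _) bM) => /(_ isT) /eqP; apply.
    apply: (mulfI (_ : omega M ^+ a != 0)); first by rewrite expf_neq0.
    by rewrite -exprD subnKC ?(ltnW ab) // mulr1.
  by case: (ltngtP n m) => // h; [have := W _ _ mM h E|have := W _ _ nM h (esym E)].
have : (x - 1) * \sum_(j < M) x ^+ j = 0 by rewrite -subrX1 xM subrr.
by move/eqP; rewrite mulf_eq0 subr_eq0 (negbTE x1) => /eqP.
Qed.

(** For exponents below [M] the powers of a primitive root are exactly orthogonal, so a finite mean
    does the work of the integral over the circle. *)
Lemma parseval (c : nat -> C) N M z : (N <= M)%N ->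
  \sum_(j < M) cmod (coefsum c N (z * omega M ^+ j)) ^+ 2 =
  M%:R * \sum_(n < N) cmod (c n) ^+ 2 * cmod z ^+ (2 * n).
Proof.
move=> NM; apply: (@complexI R); rewrite rmorph_sum rmorphM rmorph_sum /= rmorph_nat.
pose A n := c n * z ^+ n; pose o := omega M.
have E j : (cmod (coefsum c N (z * o ^+ j)) ^+ 2)%:C%C =
   \sum_(n < N) \sum_(m < N) A n * conjc (A m) * (o ^+ n * conjc o ^+ m) ^+ j.
  rewrite cmod_sqrC /coefsum rmorph_sum /= mulr_suml; apply: eq_bigr => n _.
  rewrite mulr_sumr; apply: eq_bigr => m _.
  rewrite /A !rmorphM /= !rmorphXn /= !exprMn -!exprM [(n * j)%N]mulnC [(m * j)%N]mulnC.
  by rewrite rmorphM rmorphXn /= exprMn !exprM; ring.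
under eq_bigr do rewrite E.
rewrite exchange_big /= mulr_sumr; apply: eq_bigr => n _.
rewrite exchange_big /=.
under eq_bigr => m _ do rewrite -mulr_sumr sum_omega ?(leq_trans (ltn_ord _)) //.
rewrite (bigD1 n) //= eqxx big1 ?addr0 => [|m mn]; last first.
  by rewrite eq_sym (negbTE (_ : nat_of_ord m != n)) ?mulr0.
rewrite -cmod_sqrC /A cmodM exprMn cmodX -exprM [(n * 2)%N]mulnC.
by rewrite mulrC.
Qed.

End RootsOfUnity.

(** * Measurability and rotation averages on the plane *)

Section PlaneFunctions.
Variable R : realType.
Local Notation C := R[i].
Local Notation leb := (@lebesgue_measure R).
Local Notation area := (leb \x leb)%E.
Local Notation RR := (measurableTypeR R * measurableTypeR R)%type.

Definition wc (w : RR) : C := (w.1 +i* w.2)%C.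

Definition cmeasurable (g : RR -> C) := measurable_fun setT (fun w => complex.Re (g w)) /\
  measurable_fun setT (fun w => complex.Im (g w)).

Lemma cmeasurable_wc : cmeasurable wc.
Proof. by split; [exact: measurable_fst|exact: measurable_snd]. Qed.

Lemma cmeasurable_cst k : cmeasurable (fun=> k).
Proof. by split; exact: measurable_cst. Qed.

Lemma cmeasurableD g h : cmeasurable g -> cmeasurable h -> cmeasurable (fun w => g w + h w).
Proof.
move=> [g1 g2] [h1 h2]; split.
  by under eq_fun do rewrite ReD; exact: measurable_funD.
by under eq_fun do rewrite ImD; exact: measurable_funD.
Qed.

Lemma cmeasurableM g h : cmeasurable g -> cmeasurable h -> cmeasurable (fun w => g w * h w).
Proof.
move=> [g1 g2] [h1 h2]; split.
  by under eq_fun do rewrite Re_mul; apply: measurable_funB; exact: measurable_funM.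
by under eq_fun do rewrite Im_mul; apply: measurable_funD; exact: measurable_funM.
Qed.

Lemma cmeasurable_coefsum a n g : cmeasurable g -> cmeasurable (fun w => coefsum a n (g w)).
Proof.
move=> mg; have mX k : cmeasurable (fun w => g w ^+ k).
  elim: k => [|k IH]; first by under eq_fun do rewrite expr0; exact: cmeasurable_cst.
  by under eq_fun do rewrite exprS; exact: cmeasurableM.
elim: n => [|n IH].
  by rewrite /coefsum; under eq_fun do rewrite big_ord0; exact: cmeasurable_cst.
under eq_fun do rewrite coefsumS; apply: cmeasurableD => //.
by apply: cmeasurableM => //; exact: cmeasurable_cst.
Qed.

Lemma cvg_fseries (f : C -> C) a z : fseries f a ->
  (fun n => complex.Re (coefsum a n z)) @ \oo --> complex.Re (f z) /\
  (fun n => complex.Im (coefsum a n z)) @ \oo --> complex.Im (f z).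
Proof.
move=> fa; have [M M0 MP] := fseries_cvg z fa.
have H (k : nat -> R) l : (forall n, `|l - k n| <= cmod (f z - coefsum a n z)) -> k @ \oo --> l.
  move=> kl; apply/cvgrPdist_le => e e0; have [N NP] := eps_pow2 M e0.
  near=> n; rewrite (le_trans (kl n))// (le_trans (MP n))// (le_trans _ NP)//.
  rewrite ler_wpM2l // lef_pV2 ?posrE ?exprn_gt0 // ler_weXn2l ?ler1n //.
  by near: n; exact: nbhs_infty_ge.
by split; apply: H => n; rewrite -?ReB -?ImB; [exact: Re_le_cmod|exact: Im_le_cmod].
Unshelve. all: by end_near. Qed.

Lemma cmeasurable_fseries f a g : fseries f a -> cmeasurable g ->
  cmeasurable (fun w => f (g w)).
Proof.
move=> fa mg; split.
- apply: (@measurable_fun_cvg _ _ _ setT (fun n w => complex.Re (coefsum a n (g w)))).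
    by move=> n; have [] := cmeasurable_coefsum a n mg.
  by move=> w _; have [] := cvg_fseries (g w) fa.
- apply: (@measurable_fun_cvg _ _ _ setT (fun n w => complex.Im (coefsum a n (g w)))).
    by move=> n; have [] := cmeasurable_coefsum a n mg.
  by move=> w _; have [] := cvg_fseries (g w) fa.
Qed.

Lemma measurable_cmod g : cmeasurable g -> measurable_fun setT (fun w => cmod (g w)).
Proof.
move=> [g1 g2]; apply: (eq_measurable_fun (fun w => (complex.Re (g w) ^+ 2 + complex.Im (g w) ^+ 2) `^ 2^-1)).
  move=> w _; rewrite -cmod_sqr powR12_sqrt ?sqr_ge0 // sqrtr_sqr ger0_norm ?cmod_ge0 //.
by apply: (measurableT_comp (measurable_powR _)); apply: measurable_funD; exact: measurable_funX.
Qed.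

Lemma area_rot (F : C -> \bar R) (t : R) : measurable_fun setT (fun w => F (wc w)) ->
  (forall z, 0 <= F z)%E ->
  (\int[area]_w F (wc w * cis t)%R = \int[area]_w F (wc w))%E.
Proof.
move=> mF F0; rewrite -(@area_rotation _ (fun w => F (wc w)) (cos t) (sin t)) //; last first.
  exact: cos2Dsin2.
apply: eq_integral => w _; congr F; apply: eq_ReIm; rewrite ?Re_mul ?Im_mul /=; ring.
Qed.

Lemma sume_const (x : \bar R) n : (0 <= x)%E -> (\sum_(j < n) x = n%:R%:E * x)%E.
Proof.
move=> x0; elim: n => [|n IH]; first by rewrite big_ord0 mul0e.
by rewrite big_ord_recr /= IH -natr1 EFinD ge0_muleDl ?mul1e // lee_fin.
Qed.

(** All rotated copies of [F] have the same integral, so an integrand may be replaced by its mean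
    over rotations before it is estimated pointwise. *)
Lemma area_avg (F : C -> \bar R) (M : nat) : measurable_fun setT (fun w => F (wc w)) ->
  (forall j : nat, measurable_fun setT (fun w => F (wc w * omega R M ^+ j))) ->
  (forall z, 0 <= F z)%E ->
  (\int[area]_w (\sum_(j < M) F (wc w * omega R M ^+ j)%R) = M%:R%:E * \int[area]_w F (wc w))%E.
Proof.
move=> mF mFj F0; rewrite ge0_integral_sum //.
have E j : (\int[area]_w F (wc w * omega R M ^+ j)%R = \int[area]_w F (wc w))%E.
  by rewrite -cis_natM area_rot.
under eq_bigr do rewrite E; rewrite sume_const //.
by apply: integral_ge0 => w _; exact: F0.
Qed.

End PlaneFunctions.

(** * Inequalities for concave powers *)

Section PowerInequalities.
Variable R : realType.
Implicit Types (q : R) (y B V w : nat -> R).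

Lemma powR_splitM q a : 0 < a -> a `^ q * a `^ (1 - q) = a.
Proof.
move=> a0; rewrite -powRD; last by rewrite (gt_eqF a0) implybT.
by rewrite addrCA subrr addr0 powRr1 // ltW.
Qed.

Lemma young_powR q a b : 0 < q -> q <= 1 -> 0 <= a -> 0 <= b ->
  a `^ q * b `^ (1 - q) <= q * a + (1 - q) * b.
Proof.
move=> q0 q1 a0 b0; have [qE|qn] := eqVneq q 1.
  by rewrite qE subrr powRr0 powRr1 // mulr1 mul1r mul0r addr0.
have q' : 0 < 1 - q by rewrite subr_gt0 lt_neqAle qn.
have := @conjugate_powR R (a `^ q) (b `^ (1 - q)) q^-1 (1 - q)^-1.
rewrite !invr_gt0 !invrK q0 q' !powR_ge0 addrC subrK => /(_ isT isT isT isT erefl).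
by rewrite -!powRrM !mulfV ?gt_eqF // !powRr1 // [a * q]mulrC [b * _]mulrC.
Qed.

Lemma powRD_le q a b : 0 < q -> q <= 1 -> 0 <= a -> 0 <= b ->
  (a + b) `^ q <= a `^ q + b `^ q.
Proof.
move=> q0 q1 a0 b0; have [ab|ab] := eqVneq (a + b) 0.
  by rewrite ab powR0 ?gt_eqF // addr_ge0 ?powR_ge0.
have s0 : 0 < a + b by rewrite lt_neqAle eq_sym ab addr_ge0.
(* This is [x <= x^q] at [x = c / (a + b)], cleared of denominators; adding the cases [c = a] and
   [c = b] gives the claim. *)
have H c : 0 <= c -> c <= a + b -> c * (a + b) `^ q <= c `^ q * (a + b).
  move=> c0 cs; have [->|cn] := eqVneq c 0.
    by rewrite powR0 ?gt_eqF // !mul0r.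
  have cp : 0 < c by rewrite lt_neqAle eq_sym cn.
  have -> : c * (a + b) `^ q = c `^ q * (c `^ (1 - q) * (a + b) `^ q).
    by rewrite mulrA powR_splitM.
  rewrite ler_pM2l ?powR_gt0 //.
  rewrite -[leRHS](powR_splitM q s0) mulrC ler_pM2l ?powR_gt0 //.
  by apply: ge0_ler_powR; rewrite ?nnegrE ?subr_ge0 // ltW.
have := lerD (H a a0 (ler_wpDr b0 (lexx a))) (H b b0 (ler_wpDl a0 (lexx b))).
by rewrite -!mulrDl mulrC ler_pM2r.
Qed.

Lemma powR_dist_le q a b : 0 < q -> q <= 1 -> 0 <= a -> 0 <= b ->
  `|a `^ q - b `^ q| <= `|a - b| `^ q.
Proof.
move=> q0 q1; wlog ab : a b / b <= a.
  move=> H a0 b0; have [ba|/ltW ab] := leP b a; first exact: H.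
  by rewrite distrC [`|a - b|]distrC; exact: H.
move=> a0 b0; rewrite !ger0_norm ?subr_ge0 //; last first.
  by apply: ge0_ler_powR => //; exact: ltW.
rewrite lerBlDr; have := @powRD_le q (a - b) b q0 q1; rewrite subrK subr_ge0; exact.
Qed.

Lemma cvg_powR q (u : nat -> R) (l : R) : 0 < q -> q <= 1 -> (forall n, 0 <= u n) -> 0 <= l ->
  u @ \oo --> l -> (fun n => u n `^ q) @ \oo --> l `^ q.
Proof.
move=> q0 q1 u0 l0 ul; apply/cvgrPdist_le => e e0.
have d0 : 0 < e `^ q^-1 by exact: powR_gt0.
move/cvgrPdist_le : ul => /(_ _ d0) [N _ NP].
exists N => // n /NP /= H; rewrite (le_trans (powR_dist_le q0 q1 l0 (u0 n)))//.
have E : e = (e `^ q^-1) `^ q by rewrite -powRrM mulVf ?gt_eqF // powRr1 // ltW.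
by rewrite [leRHS]E; apply: ge0_ler_powR; rewrite ?nnegrE ?powR_ge0 ?(ltW q0).
Qed.

Lemma powR_sum_le q N y : 0 < q -> q <= 1 -> (forall n, 0 <= y n) ->
  (\sum_(n < N) y n) `^ q <= \sum_(n < N) y n `^ q.
Proof.
move=> q0 q1 y0; elim: N => [|N IH]; first by rewrite !big_ord0 powR0 ?gt_eqF.
rewrite !big_ord_recr /= (le_trans (powRD_le q0 q1 _ _))//; first exact: sumr_ge0.
by rewrite lerD2r.
Qed.

(** Young's inequality bounds [(y n)^q Y^(1 - q)] by [q y n + (1 - q) Y]; summed against weights of
    total at most 1 this is at most [Y]. *)
Lemma powR_jensen q N y w : 0 < q -> q <= 1 -> (forall n, 0 <= y n) -> (forall n, 0 <= w n) ->
  \sum_(n < N) w n <= 1 ->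
  \sum_(n < N) y n `^ q * w n <= (\sum_(n < N) y n * w n) `^ q.
Proof.
move=> q0 q1 y0 w0 w1; set Y := \sum_(n < N) y n * w n.
have yw n : 0 <= y n * w n by rewrite mulr_ge0.
have Y0 : 0 <= Y by exact: sumr_ge0.
have [YE|Yn] := eqVneq Y 0.
  rewrite big1 ?powR_ge0 // => n _.
  have /eqP : y n * w n = 0.
    by have /eqP := YE; rewrite psumr_eq0 // => /allP /(_ n); rewrite mem_index_enum => /(_ isT) /eqP.
  by rewrite mulf_eq0 => /orP[/eqP ->|/eqP ->]; rewrite ?mulr0 // powR0 ?mul0r // gt_eqF.
have Yp : 0 < Y by rewrite lt_neqAle eq_sym Yn.
rewrite -(ler_pM2r (powR_gt0 (1 - q) Yp)) powR_splitM //.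
rewrite mulr_suml (@le_trans _ _ (\sum_(n < N) (q * y n + (1 - q) * Y) * w n)) //.
  apply: ler_sum => n _; rewrite mulrAC ler_wpM2r //; exact: young_powR.
under eq_bigr do rewrite mulrDl -!mulrA; rewrite big_split /= -!mulr_sumr -/Y.
have : (1 - q) * (Y * \sum_(i < N) w i) <= (1 - q) * (Y * 1).
  by rewrite ler_wpM2l ?subr_ge0 // ler_wpM2l.
lra.
Qed.

Lemma powR_mean q N y : 0 < q -> q <= 1 -> (forall n, 0 <= y n) -> (0 < N)%N ->
  \sum_(n < N) y n `^ q <= N%:R * ((\sum_(n < N) y n) / N%:R) `^ q.
Proof.
move=> q0 q1 y0 N0; have NR : 0 < N%:R :> R by rewrite ltr0n.
have W : \sum_(n < N) N%:R^-1 = 1 :> R.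
  by rewrite sumr_const card_ord -[_ *+ N]mulr_natl divff ?gt_eqF.
have Ni : 0 <= N%:R^-1 :> R by rewrite invr_ge0 ltW.
have := @powR_jensen q N y (fun=> N%:R^-1) q0 q1 y0 (fun=> Ni).
rewrite W lexx => /(_ isT); rewrite -!mulr_suml mulrC ler_pdivrMl //.
Qed.

(** Young's inequality for [B n / X] and [V n]. The factor [1 + sum V] stands in for the sharp
    [(sum V)^(1 - q)], since only finiteness matters. *)
Lemma powR_hoelder q N B V X : 0 < q -> q < 1 -> (forall n, 0 <= B n) -> (forall n, 0 <= V n) ->
  \sum_(n < N) B n <= X ->
  \sum_(n < N) B n `^ q * V n `^ (1 - q) <= X `^ q * (1 + \sum_(n < N) V n).
Proof.
move=> q0 q1 B0 V0 BX; have SB : 0 <= \sum_(n < N) B n by exact: sumr_ge0.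
have SV : 0 <= \sum_(n < N) V n by exact: sumr_ge0.
have X0 : 0 <= X by exact: le_trans BX.
have [XE|Xn] := eqVneq X 0.
  rewrite big1 ?mulr_ge0 ?powR_ge0 ?addr_ge0 // => n _.
  have SE : \sum_(n < N) B n = 0 by apply: le_anti; rewrite SB -{2}XE BX.
  have -> : B n = 0.
    by have /eqP := SE; rewrite psumr_eq0 // => /allP /(_ n); rewrite mem_index_enum => /(_ isT) /eqP.
  by rewrite powR0 ?mul0r // gt_eqF.
have Xp : 0 < X by rewrite lt_neqAle eq_sym Xn.
have Xq : 0 < X `^ q by exact: powR_gt0.
rewrite (@le_trans _ _ (\sum_(n < N) X `^ q * (q * (B n / X) + (1 - q) * V n))) //.
  apply: ler_sum => n _.
  have -> : B n `^ q = X `^ q * (B n / X) `^ q.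
    by rewrite -powRM ?divr_ge0 // mulrC divfK.
  by rewrite -mulrA ler_pM2l //; apply: young_powR; rewrite ?divr_ge0 // ltW.
rewrite -mulr_sumr ler_pM2l // big_split /= -!mulr_sumr -mulr_suml lerD //.
  by rewrite -[1]mulr1 ler_pM // ?(ltW q0) ?(ltW q1) ?divr_ge0 // ler_pdivrMr // mul1r.
rewrite -[leRHS]mul1r ler_wpM2r //; lra.
Qed.

End PowerInequalities.

(** * Gaussian integrals and Bessel inequality *)

Lemma fatou_le (d : measure_display) (T : measurableType d) (R : realType)
    (mu : {measure set T -> \bar R}) (F : (T -> \bar R)^nat) (G : T -> \bar R) (B : \bar R) :
  (forall n, measurable_fun setT (F n)) -> (forall n x, (0 <= F n x)%E) ->
  (forall x, F ^~ x @ \oo --> G x) -> (forall n, (\int[mu]_x F n x <= B)%E) ->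
  (\int[mu]_x G x <= B)%E.
Proof.
move=> mF F0 FG FB; have := @fatou _ _ _ mu setT measurableT F mF (fun n x _ => F0 n x).
have -> : (\int[mu]_x limn_einf (F ^~ x) = \int[mu]_x G x)%E.
  by apply: eq_integral => x _; rewrite (cvg_limn_einf_sup (FG x)).
move=> /le_trans; apply; rewrite limn_einf_lim; apply: lime_le.
  exact: is_cvg_einfs.
by apply: nearW => n; rewrite /einfs (le_trans _ (FB n))//; apply: ereal_inf_lbound; exists n => /=.
Qed.

Section FockIntegrals.
Variables (R : realType) (al : R).
Hypothesis al0 : 0 < al.
Local Notation C := R[i].
Local Notation leb := (@lebesgue_measure R).
Local Notation area := (leb \x leb)%E.
Local Notation RR := (measurableTypeR R * measurableTypeR R)%type.
Implicit Types (f : C -> C) (a c : nat -> C) (q : R) (w : RR) (z : C).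

Definition gauss z : R := expR (- (al * cmod z ^+ 2)).
(* [dint al (p / 2) f] is the integral in [fock_norm al p f], and [bw al a n] is, up to the
   factor [discarea al], the squared norm of [a n * z ^ n] in F^2. *)
Definition dens f z : R := cmod (f z) ^+ 2 * gauss z.
Definition dint q f : \bar R := (\int[area]_w (dens f (wc w) `^ q)%:E)%E.
Definition bw c n : R := cmod (c n) ^+ 2 * n`!%:R / al ^+ n.

Lemma gauss_gt0 z : 0 < gauss z. Proof. exact: expR_gt0. Qed.

Lemma dens_ge0 f z : 0 <= dens f z.
Proof. by rewrite mulr_ge0 ?sqr_ge0 // ltW // gauss_gt0. Qed.

Lemma bw_ge0 c n : 0 <= bw c n.
Proof. rewrite /bw; apply: divr_ge0; first by apply: mulr_ge0; [exact: sqr_ge0|exact: ler0n].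
by apply: exprn_ge0; exact: ltW. Qed.

Lemma gauss_wc w : gauss (wc w) = expR (- sqnorm al w).
Proof. by rewrite /gauss cmod_sqr. Qed.

Lemma sqnorm_ge0 w : 0 <= sqnorm al w.
Proof. by rewrite mulr_ge0 ?addr_ge0 ?sqr_ge0 ?ltW. Qed.

Lemma pw_sqnorm n w :
  cmod (wc w) ^+ (2 * n) * gauss (wc w) = n`!%:R / al ^+ n * pw n (sqnorm al w).
Proof.
rewrite gauss_wc /pw exprM cmod_sqr /= -/(sqnorm al w) {2}/sqnorm exprMn; field.
by rewrite gt_eqF ?fact_gt0R // expf_neq0 // gt_eqF.
Qed.

Lemma measurable_gauss (g : RR -> C) : cmeasurable g -> measurable_fun setT (fun w => gauss (g w)).
Proof.
move=> mg; apply: measurableT_comp => //; apply: measurableT_comp => //.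
by apply: measurable_funM => //; apply: measurable_funX; exact: measurable_cmod.
Qed.

Lemma measurable_dens f (g : RR -> C) : cmeasurable g -> cmeasurable (fun w => f (g w)) ->
  measurable_fun setT (fun w => dens f (g w)).
Proof.
move=> mg mf; apply: measurable_funM; last exact: measurable_gauss.
by apply: measurable_funX; exact: measurable_cmod.
Qed.

Lemma measurable_powR_dens q f (g : RR -> C) : cmeasurable g -> cmeasurable (fun w => f (g w)) ->
  measurable_fun setT (fun w => (dens f (g w) `^ q)%:E).
Proof.
move=> mg mf; apply/measurable_EFinP; apply: (measurableT_comp (measurable_powR q)).
exact: measurable_dens.
Qed.

Lemma measurable_pw_sqnorm n : measurable_fun setT (fun w => pw n (sqnorm al w)).
Proof. by apply: (measurableT_comp (@measurable_pw R n)); exact: measurable_sqnorm. Qed.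

Lemma area_pw_powR q n : (\int[area]_w (pw n (sqnorm al w) `^ q)%:E =
  (discarea al)%:E * \int[leb]_(x in `]0%R, +oo[) (pw n x `^ q)%:E)%E.
Proof.
have mP : measurable_fun setT (fun x : R => (pw n x `^ q)%:E).
  by apply/measurable_EFinP; apply: (measurableT_comp (measurable_powR q)); exact: measurable_pw.
have := @radial_integral R al (fun x => (pw n x `^ q)%:E) al0 mP.
by apply=> x; rewrite lee_fin powR_ge0.
Qed.

Lemma area_pw n : (\int[area]_w (pw n (sqnorm al w))%:E = (discarea al)%:E)%E.
Proof.
have E : (\int[area]_w (pw n (sqnorm al w))%:E = \int[area]_w (pw n (sqnorm al w) `^ 1)%:E)%E.
  by apply: eq_integral => w _; rewrite powRr1 // pw_ge0 // sqnorm_ge0.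
rewrite E area_pw_powR.
have -> : (\int[leb]_(x in `]0%R, +oo[) (pw n x `^ 1)%:E = 1)%E.
  rewrite -(integral_pw R n); apply: eq_integral => x; rewrite inE /= in_itv /= andbT => x0.
  by rewrite powRr1 // pw_ge0 // ltW.
by rewrite mule1.
Qed.

Lemma cmod_omegaX M j z : cmod (z * omega R M ^+ j) = cmod z.
Proof. by rewrite cmodM cmodX cmod_omega expr1n mulr1. Qed.

Lemma cmeasurable_rot M j : cmeasurable (fun w : RR => wc w * omega R M ^+ j).
Proof. by apply: cmeasurableM; [exact: cmeasurable_wc|exact: cmeasurable_cst]. Qed.

Lemma sum_dens_rot c N M w : (N <= M)%N ->
  \sum_(j < M) dens (coefsum c N) (wc w * omega R M ^+ j) =
  M%:R * \sum_(n < N) bw c n * pw n (sqnorm al w).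
Proof.
move=> NM; rewrite /dens /gauss; under eq_bigr do rewrite cmod_omegaX.
rewrite -mulr_suml parseval // -mulrA mulr_suml; congr (_ * _); apply: eq_bigr => n _.
by rewrite -mulrA -/(gauss (wc w)) pw_sqnorm /bw !mulrA.
Qed.

(** Two properties of [t^q] are used in turn: concavity moves the mean over rotations inside the
    power, where Parseval applies, and subadditivity then separates the terms. *)
Lemma dint_coefsum q c N : 0 < q -> q <= 1 ->
  (dint q (coefsum c N) <= \sum_(n < N) ((bw c n `^ q)%:E *
     ((discarea al)%:E * \int[leb]_(x in `]0%R, +oo[) (pw n x `^ q)%:E)))%E.
Proof.
move=> q0 q1; pose M := N.+1; have M0 : 0 < M%:R :> R by rewrite ltr0n.
have mc (g : RR -> C) : cmeasurable g -> cmeasurable (fun w => coefsum c N (g w)).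
  exact: cmeasurable_coefsum.
have bp0 n w : 0 <= bw c n * pw n (sqnorm al w).
  by rewrite mulr_ge0 ?bw_ge0 ?pw_ge0 ?sqnorm_ge0.
have := @area_avg R (fun z => (dens (coefsum c N) z `^ q)%:E) M.
rewrite -/(dint q (coefsum c N)) => avg.
have {}avg : (M%:R%:E * dint q (coefsum c N) = \int[area]_w
   (\sum_(j < M) (dens (coefsum c N) (wc w * omega R M ^+ j)%R `^ q)%:E))%E.
  apply/esym/avg.
  - by apply: measurable_powR_dens; [exact: cmeasurable_wc|apply: mc; exact: cmeasurable_wc].
  - by move=> j; apply: measurable_powR_dens; [|apply: mc]; exact: cmeasurable_rot.
  - by move=> z; rewrite lee_fin powR_ge0.
have H : (M%:R%:E * dint q (coefsum c N) <= \int[area]_w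
    (M%:R%:E * \sum_(n < N) ((bw c n `^ q)%:E * (pw n (sqnorm al w) `^ q)%:E)))%E.
  rewrite avg; apply: ge0_le_integral => //.
  - by move=> w _; apply: sume_ge0 => j _; rewrite lee_fin powR_ge0.
  - apply: emeasurable_sum => j; apply: measurable_powR_dens; [|apply: mc]; exact: cmeasurable_rot.
  - apply: emeasurable_funM => //; apply: emeasurable_sum => n; apply: emeasurable_funM => //.
    apply/measurable_EFinP; apply: (measurableT_comp (measurable_powR q)).
    exact: measurable_pw_sqnorm.
  - move=> w _; rewrite sumEFin; under [X in (_ <= _ * X)%E]eq_bigr do rewrite -EFinM.
    rewrite sumEFin -EFinM lee_fin.
    have := powR_mean q0 q1 (fun j => dens_ge0 (coefsum c N) (wc w * omega R M ^+ j)) (ltn0Sn N).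
    rewrite -/M sum_dens_rot // [_ * _ / _]mulrAC divff ?gt_eqF // mul1r => /le_trans; apply.
    rewrite ler_pM2l // (le_trans (powR_sum_le N q0 q1 (fun n => bp0 n w)))//.
    by apply: ler_sum => n _; rewrite powRM ?bw_ge0 ?pw_ge0 ?sqnorm_ge0.
rewrite -(lee_pmul2l _ (_ : 0 < M%:R%:E)%E) // (le_trans H)//.
rewrite ge0_integralZl //; last 2 first.
- apply: emeasurable_sum => n; apply: emeasurable_funM => //.
  apply/measurable_EFinP; apply: (measurableT_comp (measurable_powR q)).
  exact: measurable_pw_sqnorm.
- by move=> w _; apply: sume_ge0 => n _; rewrite -EFinM lee_fin mulr_ge0 ?powR_ge0.
rewrite lee_pmul2l // ge0_integral_sum //; last 2 first.
- move=> n; apply: emeasurable_funM => //.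
  apply/measurable_EFinP; apply: (measurableT_comp (measurable_powR q)).
  exact: measurable_pw_sqnorm.
- by move=> n w _; rewrite -EFinM lee_fin mulr_ge0 ?powR_ge0.
apply: lee_sum => n _; rewrite ge0_integralZl //; last 3 first.
- apply/measurable_EFinP; apply: (measurableT_comp (measurable_powR q)).
  exact: measurable_pw_sqnorm.
- by move=> w _; rewrite lee_fin powR_ge0.
- by rewrite lee_fin powR_ge0.
by rewrite area_pw_powR.
Qed.

(* Averaging [dens f] over the rotations by [M]-th roots of unity dominates half of the
   partial Parseval sum [s] up to an error vanishing with [M]; capping the average by [s]
   makes it converge pointwise, so that Fatou applies. *)
Lemma bessel f a N : fseries f a ->
  ((\sum_(n < N) bw a n * discarea al)%:E <= 2%:E * dint 1 f)%E.
Proof.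
move=> fa.
pose s w : R := \sum_(n < N) bw a n * pw n (sqnorm al w).
have s0 w : 0 <= s w by apply: sumr_ge0 => n _; rewrite mulr_ge0 ?bw_ge0 ?pw_ge0 ?sqnorm_ge0.
have ms : measurable_fun setT s.
  by apply: measurable_sum => n; apply: measurable_funM => //; exact: measurable_pw_sqnorm.
pose h M w : R := (\sum_(j < M) dens f (wc w * omega R M ^+ j)) / M%:R.
have h0 M w : 0 <= h M w by rewrite divr_ge0 //; apply: sumr_ge0 => j _; exact: dens_ge0.
have mf (g : RR -> C) : cmeasurable g -> cmeasurable (fun w => f (g w)).
  by move=> mg; exact: (cmeasurable_fseries fa mg).
have mh M : measurable_fun setT (h M).
  apply: measurable_funM => //; apply: measurable_sum => j; apply: measurable_dens.
    exact: cmeasurable_rot.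
  by apply: mf; exact: cmeasurable_rot.
have ih M : (0 < M)%N -> (\int[area]_w (h M w)%:E = dint 1 f)%E.
  move=> M0; have MR : 0 < M%:R :> R by rewrite ltr0n.
  have := @area_avg R (fun z => (dens f z)%:E) M.
  have -> : (\int[area]_w (dens f (wc w))%:E = dint 1 f)%E.
    by apply: eq_integral => w _; rewrite powRr1 // dens_ge0.
  move=> avg; have {}avg : (\int[area]_w (\sum_(j < M) (dens f (wc w * omega R M ^+ j)%R)%:E) =
       M%:R%:E * dint 1 f)%E.
    apply: avg.
    - by apply/measurable_EFinP; apply: measurable_dens; [|apply: mf]; exact: cmeasurable_wc.
    - by move=> j; apply/measurable_EFinP; apply: measurable_dens; [|apply: mf]; exact: cmeasurable_rot.
    - by move=> z; rewrite lee_fin dens_ge0.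
  transitivity (M%:R^-1%:E * (M%:R%:E * dint 1 f))%E; last first.
    by rewrite muleA -EFinM mulVf ?mul1e // gt_eqF.
  rewrite -avg -ge0_integralZl //; last 2 first.
  - apply: emeasurable_sum => j; apply/measurable_EFinP; apply: measurable_dens; [|apply: mf]; exact: cmeasurable_rot.
  - by move=> w _; apply: sume_ge0 => j _; rewrite lee_fin dens_ge0.
  by apply: eq_integral => w _; rewrite sumEFin -EFinM mulrC.
(* Parseval is exact for the partial sum of order [M], whose distance to [f] on the circle through
   [w] decays like [2 ^- M]. *)
have sh w : exists2 K, 0 <= K & forall M, (N <= M)%N -> (0 < M)%N -> s w <= 2 * h M w + K / 2 ^+ M.
  have r0 : 0 < cmod (wc w) + 1 by rewrite ltr_wpDl // cmod_ge0.
  have [K K0 KP] := fa _ r0.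
  exists (2 * K ^+ 2) => [|M NM M0]; first by rewrite mulr_ge0 ?sqr_ge0.
  have MR : 0 < M%:R :> R by rewrite ltr0n.
  have sM : s w <= M%:R^-1 * \sum_(j < M) dens (coefsum a M) (wc w * omega R M ^+ j).
    rewrite sum_dens_rot // mulKf ?gt_eqF // /s.
    rewrite -(subnKC NM) big_split_ord /= lerDl.
    by apply: sumr_ge0 => n _; rewrite mulr_ge0 ?bw_ge0 ?pw_ge0 ?sqnorm_ge0.
  rewrite (le_trans sM)// ler_pdivrMl // mulrDr.
  have -> : M%:R * (2 * h M w) = \sum_(j < M) 2 * dens f (wc w * omega R M ^+ j).
    by rewrite /h mulrCA [M%:R * _]mulrC divfK ?gt_eqF // mulr_sumr.
  have -> : M%:R * (2 * K ^+ 2 / 2 ^+ M) = \sum_(j < M) 2 * K ^+ 2 / 2 ^+ M.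
    by rewrite sumr_const card_ord -[RHS]mulr_natl.
  rewrite -big_split /=; apply: ler_sum => j _.
  set z := wc w * _; have zw : cmod z = cmod (wc w) by exact: cmod_omegaX.
  have /(KP M) Hz : cmod z <= cmod (wc w) + 1 by rewrite zw lerDl.
  have e1 : cmod (f z - coefsum a M z) ^+ 2 <= K ^+ 2 / 2 ^+ M.
    have x1 : cmod z / (2 * (cmod (wc w) + 1)) <= 2^-1.
      by rewrite ler_pdivrMr ?mulr_gt0 // mulrA mulVf // mul1r zw lerDl.
    have x0 : 0 <= cmod z / (2 * (cmod (wc w) + 1)) by rewrite divr_ge0 ?cmod_ge0 // mulr_ge0 // ltW.
    have H : cmod (f z - coefsum a M z) <= K * (2^-1) ^+ M.
      by rewrite (le_trans Hz)// ler_wpM2l // lerXn2r ?nnegrE ?invr_ge0.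
    rewrite (@le_trans _ _ ((K * (2^-1) ^+ M) ^+ 2)) //.
      by rewrite lerXn2r ?nnegrE ?cmod_ge0 ?mulr_ge0 ?exprn_ge0 ?invr_ge0.
    rewrite exprMn -exprVn ler_wpM2l ?sqr_ge0 // -exprM.
    by rewrite ler_wiXn2l ?invr_ge0 ?invf_le1 ?ler1n // leq_pmulr.
  have e2 : cmod (coefsum a M z) <= cmod (f z) + cmod (f z - coefsum a M z).
    by rewrite -{1}[coefsum a M z](subKr (f z)); exact: cmodB.
  have g1 : gauss z <= 1 by rewrite expR_le1 oppr_le0 mulr_ge0 ?sqr_ge0 ?ltW.
  have g0 := gauss_gt0 z.
  (* The factor 2 of the statement comes from [(x + y)^2 <= 2 x^2 + 2 y^2]. *)
  have e3 : cmod (coefsum a M z) ^+ 2 <= 2 * cmod (f z) ^+ 2 + 2 * (K ^+ 2 / 2 ^+ M).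
    move: e1 e2 (cmod_ge0 (coefsum a M z)) (sqr_ge0 (cmod (f z) - cmod (f z - coefsum a M z))).
    move: (cmod _) (cmod _) (cmod _) (K ^+ 2 / _) => x y u v; clear; nra.
  rewrite /dens (le_trans (ler_wpM2r (ltW g0) e3))// mulrDl lerD //.
    by rewrite mulrA.
  rewrite -[2 * K ^+ 2 / _]mulrA.
  by rewrite ler_piMr // mulr_ge0 // divr_ge0 ?sqr_ge0 // exprn_ge0.
have -> : ((\sum_(n < N) bw a n * discarea al)%:E = \int[area]_w (s w)%:E)%E.
  under [RHS]eq_integral do rewrite -sumEFin.
  rewrite ge0_integral_sum //; last 2 first.
  - by move=> n; apply/measurable_EFinP; apply: measurable_funM => //; exact: measurable_pw_sqnorm.
  - by move=> n w _; rewrite lee_fin mulr_ge0 ?bw_ge0 ?pw_ge0 ?sqnorm_ge0.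
  rewrite -sumEFin; apply: eq_bigr => n _; under eq_integral do rewrite EFinM.
  rewrite ge0_integralZl ?area_pw //.
  - by apply/measurable_EFinP; exact: measurable_pw_sqnorm.
  - by move=> w _; rewrite lee_fin pw_ge0 // sqnorm_ge0.
  - by rewrite lee_fin bw_ge0.
pose M k := (N + k).+1.
apply: (@fatou_le _ _ R _ (fun k w => (Num.min (s w) (2 * h (M k) w))%:E)).
- move=> k; apply/measurable_EFinP; apply: measurable_minr => //; exact: measurable_funM.
- by move=> k w; rewrite lee_fin le_min s0 mulr_ge0.
- move=> w; have [K K0 KP] := sh w.
  apply: cvg_EFin; first exact: nearW.
  apply/cvgrPdist_le => e e0; have [k0 k0P] := eps_pow2 K e0.
  near=> k; have kk : (k0 <= k)%N by near: k; exact: nbhs_infty_ge.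
  have H : s w - e <= 2 * h (M k) w.
    have NMk : (N <= M k)%N by rewrite /M leqW // leq_addr.
    rewrite lerBlDr (le_trans (KP (M k) NMk (ltn0Sn _)))// lerD2l.
    rewrite (le_trans _ k0P)// ler_wpM2l // lef_pV2 ?posrE ?exprn_gt0 // ler_weXn2l ?ler1n //.
    by rewrite /M leqW // (leq_trans kk) // leq_addl.
  rewrite ler_distlC; apply/andP; split; last by rewrite ge_min lerDl ltW.
  by rewrite le_min H andbT gerBl ltW.
- move=> k; rewrite -(ih (M k)) // -ge0_integralZl //; last 2 first.
  - by apply/measurable_EFinP; exact: mh.
  - by move=> w _; rewrite lee_fin.
  apply: ge0_le_integral => //.
  - by move=> w _; rewrite lee_fin le_min s0 mulr_ge0.
  - apply/measurable_EFinP; apply: measurable_minr => //; exact: measurable_funM.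
  - apply: emeasurable_funM => //; by apply/measurable_EFinP; exact: mh.
  - by move=> w _; rewrite -EFinM lee_fin ge_min lexx orbT.
Unshelve. all: by end_near. Qed.

End FockIntegrals.

(** * The Hausdorff operator on power series *)

Lemma Rintegral_dct (d : measure_display) (T : measurableType d) (R : realType)
    (mu : {measure set T -> \bar R}) (D : set T) (u : nat -> T -> R) (v : T -> R) (G : T -> \bar R) :
  measurable D -> (forall n, mu.-integrable D (fun t => (u n t)%:E)) -> mu.-integrable D G ->
  (forall t, D t -> u ^~ t @ \oo --> v t) -> (forall n t, D t -> (`|u n t|%:E <= G t)%E) ->
  mu.-integrable D (fun t => (v t)%:E) /\
  (fun n => Rintegral mu D (u n)) @ \oo --> Rintegral mu D v.
Proof.
move=> mD iu iG uv uG.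
have mv : measurable_fun D (fun t => (v t)%:E).
  apply/measurable_EFinP; apply: (@measurable_fun_cvg _ _ _ D u v) => // n.
  by apply/measurable_EFinP; exact: (measurable_int mu (iu n)).
have mu_ n : measurable_fun D (fun t => (u n t)%:E) by exact: (measurable_int mu (iu n)).
have [] := @dominated_convergence _ _ _ mu D mD (fun n t => (u n t)%:E) (fun t => (v t)%:E) G mu_ mv _ iG _.
- by apply: aeW => t Dt; apply: cvg_EFin; [exact: nearW|exact: uv].
- by apply: aeW => t n Dt; exact: uG.
move=> iv _ H; split=> //; rewrite /Rintegral; apply: fine_cvg.
by rewrite fineK //; exact: integrable_fin_num.
Qed.

Section HausdorffSeries.
Variables (R : realType) (mu : {measure set (measurableTypeR R) -> \bar R}).
Local Notation C := R[i].
Local Notation D := (`]0%R, +oo[%classic : set (measurableTypeR R)).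
Variable m : nat -> R.
Hypothesis mE : forall n, hausdorff_moment mu n = (m n)%:E.

Lemma moment_ge0 n : 0 <= m n.
Proof.
rewrite -lee_fin -mE; apply: integral_ge0 => t; rewrite /= in_itv /= andbT => t0.
by rewrite lee_fin invr_ge0 exprn_ge0 // ltW.
Qed.

Lemma measurable_moment n : measurable_fun D (fun t : measurableTypeR R => (t ^+ n.+1)^-1 : R).
Proof.
apply: open_continuous_measurable_fun; first exact: interval_open.
move=> t; rewrite inE /= in_itv /= andbT => t0.
apply: (@cvgV _ _ _ _ (fun t : R => t ^+ n.+1)); first by rewrite expf_neq0 // gt_eqF.
exact: exprn_continuous.
Qed.

Lemma moment_integrable n : mu.-integrable D (fun t => ((t ^+ n.+1)^-1)%:E).
Proof.
apply/integrableP; split; first by apply/measurable_EFinP; exact: measurable_moment.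
have -> : (\int[mu]_(t in D) `|((t ^+ n.+1)^-1)%:E| = (m n)%:E)%E.
  rewrite -mE; apply: eq_integral => t; rewrite inE /= in_itv /= andbT => t0.
  by rewrite ger0_norm // invr_ge0 exprn_ge0 // ltW.
exact: ltry.
Qed.

Lemma Rintegral_moment n : Rintegral mu D (fun t => (t ^+ n.+1)^-1) = m n.
Proof. by rewrite /Rintegral -/(hausdorff_moment mu n) mE. Qed.

Definition hterm (c : nat -> C) z n (t : R) : C := c n * z ^+ n * ((t ^+ n.+1)^-1)%:C%C.

Lemma Re_mulr_real (u : C) (r : R) : complex.Re (u * r%:C%C) = complex.Re u * r.
Proof. by rewrite Re_mul /= mulr0 subr0. Qed.

Lemma Im_mulr_real (u : C) (r : R) : complex.Im (u * r%:C%C) = complex.Im u * r.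
Proof. by rewrite Im_mul /= mulr0 add0r. Qed.

Lemma hausdorff_integrand_coefsum c N z (t : R) : t != 0 ->
  hausdorff_integrand (coefsum c N) z t = \sum_(n < N) hterm c z n t.
Proof.
move=> t0; rewrite /hausdorff_integrand /coefsum mulr_suml; apply: eq_bigr => n _.
have tC : t%:C%C != 0 :> C by rewrite fmorph_eq0.
by rewrite /hterm fmorphV rmorphXn /= exprMn exprVn exprS invfM; ring.
Qed.

(* Dominated convergence, with [sum |a n| |z|^n / t^(n+1)] as dominating function. *)
Lemma hausdorff_fseries f a : fseries f a ->
  (forall r : R, 0 < r -> exists M, forall n, cmod (a n * (m n)%:C%C) * r ^+ n <= M) ->
  (forall z, cintegrable mu D (hausdorff_integrand f z)) /\
  fseries (hausdorff mu f) (fun n => a n * (m n)%:C%C).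
Proof.
move=> fa eb; pose b n := a n * (m n)%:C%C; rewrite -/b.
(* [h] is known beforehand to have an expansion, and [key] identifies it with the operator
   pointwise, so the integral need not be differentiated in [z]. *)
have [h hb] : exists h, fseries h b by exact: ecoef_fseries.
have key z : cintegrable mu D (hausdorff_integrand f z) /\ hausdorff mu f z = h z.
  pose x := cmod z.
  pose G t := (\sum_(0 <= n <oo) (cmod (a n) * x ^+ n * (t ^+ n.+1)^-1)%:E)%E.
  have T0 n t : 0 < t -> (0 <= (cmod (a n) * x ^+ n * (t ^+ n.+1)^-1)%:E)%E.
    by move=> t0; rewrite lee_fin !mulr_ge0 ?invr_ge0 ?exprn_ge0 ?cmod_ge0 // ltW.
  have mT n : measurable_fun D (fun t => (cmod (a n) * x ^+ n * (t ^+ n.+1)^-1)%:E).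
    by apply/measurable_EFinP; apply: measurable_funM => //; exact: measurable_moment.
  have D0 t : D t -> 0 < t by rewrite /= in_itv /= andbT.
  have mD : measurable D by [].
  have iG : (\int[mu]_(t in D) G t < +oo)%E.
    rewrite integral_nneseries //; last by move=> n t /D0; exact: T0.
    have E n : (\int[mu]_(t in D) (cmod (a n) * x ^+ n * (t ^+ n.+1)^-1)%:E =
       (cmod (b n) * x ^+ n)%:E)%E.
      under eq_integral do rewrite EFinM.
      rewrite ge0_integralZl //; last 3 first.
      - by apply/measurable_EFinP; exact: measurable_moment.
      - by move=> t /D0 t0; rewrite lee_fin invr_ge0 exprn_ge0 // ltW.
      - by rewrite lee_fin mulr_ge0 ?exprn_ge0 ?cmod_ge0.
      rewrite -/(hausdorff_moment mu n) mE -EFinM /b cmodM cmod_real ger0_norm ?moment_ge0 //.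
      by rewrite mulrAC.
    (* A radius of at least [2 * x] makes the terms at most [M / 2 ^+ n]. *)
    have r0 : 0 < 2 * x + 1 by rewrite ltr_wpDl // mulr_ge0 // cmod_ge0.
    have [M MP] := eb _ r0.
    apply: (@le_lt_trans _ _ (2 * M)%:E); last exact: ltry.
    apply: lime_le.
      by apply: is_cvg_nneseries => n _ _; apply: integral_ge0 => t /D0; exact: T0.
    apply: nearW => N; under eq_bigr do rewrite E; rewrite sumEFin lee_fin big_mkord.
    have M0 : 0 <= M by have := MP 0%N; rewrite expr0 mulr1; apply: le_trans; exact: cmod_ge0.
    apply: (@le_trans _ _ (\sum_(n < N) M * (2^-1) ^+ n)).
      apply: ler_sum => n _; rewrite exprVn ler_pdivlMr ?exprn_gt0 // -mulrA -exprMn.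
      rewrite (le_trans _ (MP n))// ler_wpM2l ?cmod_ge0 // lerXn2r ?nnegrE ?mulr_ge0 ?cmod_ge0 //.
        exact: ltW.
      by rewrite mulrC lerDl.
    rewrite -mulr_sumr mulrC ler_wpM2r //.
    have := subrX1 (2^-1 : R) N.
    have : 0 <= (2^-1 : R) ^+ N by rewrite exprn_ge0 // invr_ge0.
    lra.
  have G0 t : D t -> (0 <= G t)%E.
    by move=> /D0 t0; apply: nneseries_ge0 => n _ _; exact: T0.
  have integG : mu.-integrable D G.
    apply/integrableP; split.
      by apply: ge0_emeasurable_sum => // n t /D0 t0 _; exact: T0.
    rewrite (_ : (\int[mu]_(t in D) `|G t| = \int[mu]_(t in D) G t)%E) //.
    by apply: eq_integral => t; rewrite inE => Dt; rewrite gee0_abs // G0.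
  pose part N t := hausdorff_integrand (coefsum a N) z t.
  have partE N t : D t -> part N t = \sum_(n < N) hterm a z n t.
    by move=> /D0 t0; rewrite /part hausdorff_integrand_coefsum // gt_eqF.
  have hI n : cintegrable mu D (hterm a z n) /\ cintegral mu D (hterm a z n) = b n * z ^+ n.
    have [I1 I2] : mu.-integrable D (fun t => (complex.Re (hterm a z n t))%:E) /\
        mu.-integrable D (fun t => (complex.Im (hterm a z n t))%:E).
      split.
        rewrite (_ : (fun t => _) = (fun t => (complex.Re (a n * z ^+ n))%:E * ((t ^+ n.+1)^-1)%:E)%E).
          by apply: integrableZl => //; exact: moment_integrable.
        by apply/funext => t; rewrite /hterm Re_mulr_real EFinM.
      rewrite (_ : (fun t => _) = (fun t => (complex.Im (a n * z ^+ n))%:E * ((t ^+ n.+1)^-1)%:E)%E).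
        by apply: integrableZl => //; exact: moment_integrable.
      by apply/funext => t; rewrite /hterm Im_mulr_real EFinM.
    split; first by split.
    rewrite /cintegral; under eq_Rintegral do rewrite /hterm Re_mulr_real.
    under [X in (_ +i* X)%C]eq_Rintegral do rewrite /hterm Im_mulr_real.
    rewrite !RintegralZl ?Rintegral_moment //; try exact: moment_integrable.
    by rewrite /b mulrAC; apply: eq_ReIm; rewrite ?Re_mulr_real ?Im_mulr_real.
  have pI N : cintegrable mu D (part N) /\ cintegral mu D (part N) = coefsum b N z.
    have [J1 J2] : cintegrable mu D (fun t => \sum_(n < N) hterm a z n t) /\
       cintegral mu D (fun t => \sum_(n < N) hterm a z n t) = coefsum b N z.
      elim: N => [|N [IH1 IH2]].
        rewrite (_ : (fun t => _) = (fun=> 0)); last by apply/funext => t; rewrite big_ord0.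
        split; first by split; exact: integrable0.
        by rewrite /coefsum big_ord0 /cintegral /Rintegral /= integral0.
      have [h1 h2] := hI N.
      have E : (fun t => \sum_(n < N.+1) hterm a z n t) =
        (fun t => \sum_(n < N) hterm a z n t + hterm a z N t).
        by apply/funext => t; rewrite big_ord_recr.
      rewrite E; split; first exact: cintegrableD.
      by rewrite cintegralD // IH2 h2 coefsumS.
    split.
      by apply: eq_cintegrable J1 => // t Dt; rewrite partE.
    by rewrite -J2; apply: eq_cintegral => // t Dt; rewrite partE.
  have bnd N t : D t -> ((cmod (part N t))%:E <= G t)%E.
    move=> Dt; have t0 := D0 _ Dt; rewrite partE //.
    apply: (@le_trans _ _ (\sum_(0 <= n < N) (cmod (a n) * x ^+ n * (t ^+ n.+1)^-1)%:E)%E).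
      rewrite big_mkord sumEFin lee_fin (le_trans (cmod_sum _ _ _))//.
      apply: ler_sum => n _; rewrite /hterm !cmodM cmodX cmod_real ger0_norm //.
      by rewrite invr_ge0 exprn_ge0 // ltW.
    by apply: nneseries_lim_ge => n _ _; exact: T0.
  have Cr t : D t -> (fun N => complex.Re (part N t)) @ \oo --> complex.Re (hausdorff_integrand f z t) /\
      (fun N => complex.Im (part N t)) @ \oo --> complex.Im (hausdorff_integrand f z t).
    move=> /D0 t0; have [C1 C2] := cvg_fseries (z / t%:C%C) fa.
    rewrite /part /hausdorff_integrand; move: (z / t%:C%C) C1 C2 => u C1 C2.
    rewrite -(fmorphV (real_complex R)) /= Re_mulr_real Im_mulr_real.
    split; [under eq_fun do rewrite Re_mulr_real|under eq_fun do rewrite Im_mulr_real].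
      exact: cvgMl.
    exact: cvgMl.
  have Cr1 t (Dt : D t) := (Cr t Dt).1.
  have Cr2 t (Dt : D t) := (Cr t Dt).2.
  have Re_le_cmodE (u : C) : (`|complex.Re u|%:E <= (cmod u)%:E)%E by rewrite lee_fin Re_le_cmod.
  have Im_le_cmodE (u : C) : (`|complex.Im u|%:E <= (cmod u)%:E)%E by rewrite lee_fin Im_le_cmod.
  have [DR1 DR2] := @Rintegral_dct _ _ _ mu D (fun N t => complex.Re (part N t))
    (fun t => complex.Re (hausdorff_integrand f z t)) G mD (fun N => (pI N).1.1) integG
    (fun t Dt => Cr1 t Dt) (fun N t Dt => le_trans (Re_le_cmodE _) (bnd N t Dt)).
  have [DI1 DI2] := @Rintegral_dct _ _ _ mu D (fun N t => complex.Im (part N t))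
    (fun t => complex.Im (hausdorff_integrand f z t)) G mD (fun N => (pI N).1.2) integG
    (fun t Dt => Cr2 t Dt) (fun N t Dt => le_trans (Im_le_cmodE _) (bnd N t Dt)).
  split; first by split.
  have [H1 H2] := cvg_fseries z hb.
  have E N := (pI N).2.
  apply: eq_ReIm.
    apply/esym; apply: (cvg_unique _ H1) => //.
    rewrite (_ : (fun n => _) = (fun N => Rintegral mu D (fun t => complex.Re (part N t)))) //.
    by apply/funext => N; rewrite -E.
  apply/esym; apply: (cvg_unique _ H2) => //.
  rewrite (_ : (fun n => _) = (fun N => Rintegral mu D (fun t => complex.Im (part N t)))) //.
  by apply/funext => N; rewrite -E.
split; first by move=> z; have [] := key z.
suff -> : hausdorff mu f = h by [].
by apply/funext => z; have [] := key z.
Qed.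

End HausdorffSeries.

(** * Boundedness from summability of the moments *)

Section FockNorm.
Variables (R : realType) (al : R).
Hypothesis al0 : 0 < al.
Local Notation C := R[i].
Local Notation leb := (@lebesgue_measure R).
Local Notation area := (leb \x leb)%E.
Implicit Types (f g : C -> C) (p J : R).

Lemma dint_ge0 q f : (0 <= dint al q f)%E.
Proof. by apply: integral_ge0 => w _; rewrite lee_fin powR_ge0. Qed.

Definition fockc p : R := al * p / (2 * pi).

Lemma fockc_gt0 p : 0 < p -> 0 < fockc p.
Proof. by move=> p0; rewrite divr_gt0 ?mulr_gt0 ?pi_gt0. Qed.

Lemma fock_norm_dint p f : fock_norm al p f = (((fockc p)%:E * dint al (p / 2) f) `^ p^-1)%E.
Proof.
have E : (\int[area]_w ((cmod (f (w.1 +i* w.2)%C) *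
       expR (- (al / 2) * cmod (w.1 +i* w.2)%C ^+ 2)) `^ p)%:E = dint al (p / 2) f)%E.
  apply: eq_integral => w _.
  rewrite /dens -/(wc w); set x := cmod (f _); set y := cmod _.
  have -> : x ^+ 2 * gauss al (wc w) = (x * expR (- (al / 2) * y ^+ 2)) `^ 2%:R.
    rewrite powR_mulrn ?mulr_ge0 ?expR_ge0 ?cmod_ge0 // exprMn; congr (_ * _).
    by rewrite [RHS]expr2 -expRD /gauss -/y; congr expR; field.
  by rewrite -powRrM; congr (_ `^ _)%:E; field.
by rewrite /fock_norm E.
Qed.

Lemma fock_norm_le p f J : 0 < p -> (dint al (p / 2) f <= J%:E)%E ->
  (fock_norm al p f <= ((fockc p * J) `^ p^-1)%:E)%E.
Proof.
move=> p0 fJ; rewrite fock_norm_dint -poweR_EFin (EFinM (fockc p) J).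
have J0 : (0 <= J%:E)%E by exact: le_trans (dint_ge0 _ _) fJ.
have c0 : (0 <= (fockc p)%:E)%E by rewrite lee_fin ltW ?fockc_gt0.
apply: gt0_ler_poweR; rewrite ?invr_ge0 ?(ltW p0) ?in_itv /= ?leey ?andbT //.
- by rewrite mule_ge0 ?dint_ge0.
- by rewrite mule_ge0.
- exact: lee_wpmul2l.
Qed.

Lemma dint_fock_norm p f y : 0 < p -> 0 <= y -> (fock_norm al p f <= y%:E)%E ->
  (dint al (p / 2) f <= ((fockc p)^-1 * y `^ p)%:E)%E.
Proof.
move=> p0 y0; rewrite fock_norm_dint => H.
have c0 := fockc_gt0 p0; have c1 : (0 <= (fockc p)%:E)%E by rewrite lee_fin ltW.
have := @gt0_ler_poweR R p (ltW p0) _ _ _ _ H; rewrite -poweRrM mulVf ?gt_eqF //.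
rewrite !in_itv /= ?leey ?andbT poweR_ge0 lee_fin y0 => /(_ isT isT).
rewrite poweRe1 ?mule_ge0 ?dint_ge0 // => H2.
rewrite -(lee_pmul2l (_ : (fockc p)%:E \is a fin_num) (_ : 0 < (fockc p)%:E)%E) //.
by rewrite -EFinM mulVKf ?gt_eqF.
Qed.

Lemma fock_norm_fin p f : 0 < p -> (fock_norm al p f < +oo)%E ->
  exists2 J, 0 <= J & dint al (p / 2) f = J%:E.
Proof.
move=> p0; have pn : p^-1 != 0 by rewrite invr_eq0 gt_eqF.
rewrite fock_norm_dint => /(lty_poweRy pn) H.
have {}H : (dint al (p / 2) f < +oo)%E.
  rewrite ltNge leye_eq; apply/negP => /eqP E; move: H; rewrite E gt0_muley ?ltxx // lte_fin.
  exact: fockc_gt0.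
have fn : dint al (p / 2) f \is a fin_num by rewrite ge0_fin_numE ?dint_ge0.
exists (fine (dint al (p / 2) f)); last by rewrite fineK.
by rewrite fine_ge0 ?dint_ge0.
Qed.

Lemma fock_norm2 f J : 0 <= J -> dint al 1 f = J%:E ->
  fock_norm al 2 f = ((fockc 2) `^ 2^-1 * J `^ 2^-1)%:E.
Proof.
move=> J0 fJ; rewrite fock_norm_dint divff // fJ -EFinM poweR_EFin powRM //.
exact/ltW/fockc_gt0.
Qed.

(** The [p]-th root turns [J^(p / 2)] into [J^(1 / 2)], a multiple of the norm of [f]; [dint_bound]
    is the passage in the other direction. *)
Lemma fock_norm_bound p f g K J : 0 < p -> 0 <= K -> 0 <= J -> dint al 1 f = J%:E ->
  (dint al (p / 2) g <= (K * J `^ (p / 2))%:E)%E ->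
  (fock_norm al p g <= ((fockc p * K) `^ p^-1 / (fockc 2) `^ 2^-1)%:E * fock_norm al 2 f)%E.
Proof.
move=> p0 K0 J0 fJ gK; rewrite (fock_norm2 J0 fJ) -EFinM.
have c0 : 0 <= fockc p by exact/ltW/fockc_gt0.
apply: le_trans (fock_norm_le p0 gK) _; rewrite lee_fin.
have c2 : fockc 2 `^ 2^-1 != 0 by rewrite gt_eqF // powR_gt0 // fockc_gt0.
rewrite [leRHS](_ : _ = (fockc p * K) `^ p^-1 * J `^ 2^-1); last by field.
have E : (fockc p * K * J `^ (p / 2)) `^ p^-1 = (fockc p * K) `^ p^-1 * J `^ 2^-1.
  rewrite (powRM _ (mulr_ge0 c0 K0) (powR_ge0 _ _)) -[(J `^ _) `^ _]powRrM.
  by congr (_ * _ `^ _); field; rewrite gt_eqF.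
by rewrite mulrA E.
Qed.

Lemma dint_bound p f g K J : 0 < p -> 0 <= K -> 0 <= J -> (dint al 1 f <= J%:E)%E ->
  (fock_norm al p g <= K%:E * fock_norm al 2 f)%E ->
  (dint al (p / 2) g <= ((fockc p)^-1 * (K * (fockc 2) `^ 2^-1) `^ p * J `^ (p / 2))%:E)%E.
Proof.
move=> p0 K0 J0 fJ H; have c2 : 0 <= fockc 2 by exact/ltW/fockc_gt0.
have H2 : (fock_norm al p g <= (K * ((fockc 2) `^ 2^-1) * J `^ 2^-1)%:E)%E.
  apply: (le_trans H); rewrite -mulrA EFinM lee_wpmul2l ?lee_fin //.
  by rewrite -powRM //; apply: fock_norm_le; rewrite ?divff.
apply: le_trans (dint_fock_norm p0 _ H2) _; first by rewrite !mulr_ge0 ?powR_ge0.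
have E : (K * fockc 2 `^ 2^-1 * J `^ 2^-1) `^ p = (K * fockc 2 `^ 2^-1) `^ p * J `^ (p / 2).
  by rewrite powRM ?mulr_ge0 ?powR_ge0 // -[(J `^ _) `^ _]powRrM [2^-1 * p]mulrC.
by rewrite E mulrA.
Qed.

End FockNorm.

Section Sufficiency.
Variables (R : realType) (al p : R) (mu : {measure set (measurableTypeR R) -> \bar R}).
Hypotheses (al0 : 0 < al) (p0 : 0 < p) (p2 : p < 2).
Local Notation C := R[i].
Local Notation s := (2 * p / (2 - p)).
Local Notation leb := (@lebesgue_measure R).

Lemma expo_gt0 : 0 < s.
Proof. by rewrite divr_gt0 ?mulr_gt0 ?subr_gt0. Qed.

(** This is what singles out [s]: with [q = p / 2] it reads [m^(2 q) = (m^s)^(1 - q)] for Hoelder's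
    inequality, and [s = (s + 2) q] for the test functions. *)
Lemma expo_eq : s * (1 - p / 2) = p.
Proof. by field; rewrite subr_eq0 gt_eqF. Qed.

Lemma hausdorff_moment_ge0 n : (0 <= hausdorff_moment mu n)%E.
Proof.
apply: integral_ge0 => t; rewrite /= in_itv /= andbT => t0.
by rewrite lee_fin invr_ge0 exprn_ge0 // ltW.
Qed.

Lemma fin_moment : (forall n, (hausdorff_moment mu n < +oo)%E) ->
  forall n, hausdorff_moment mu n = (fine (hausdorff_moment mu n))%:E.
Proof. by move=> H n; rewrite fineK // ge0_fin_numE ?hausdorff_moment_ge0. Qed.

Lemma hausdorff_sufficient :
  (\sum_(0 <= n <oo) (hausdorff_moment mu n `^ s * (Num.sqrt (n.+1%:R : R))%:E) < +oo)%E ->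
  hausdorff_bounded mu al 2 p.
Proof.
move=> sumV; have s0 := expo_gt0; have se := expo_eq.
pose q := p / 2; have q0 : 0 < q by rewrite divr_gt0.
have q1 : q < 1 by rewrite ltr_pdivrMr // mul1r.
have r0 n : 0 < Num.sqrt n.+1%:R :> R by rewrite sqrtr_gt0 ltr0n.
have r1 n : 1 <= Num.sqrt n.+1%:R :> R.
  have := @ler_wsqrtr R 1 n.+1%:R; rewrite sqrtr1; apply; exact: ler1n.
have T0 n : (0 <= hausdorff_moment mu n `^ s * (Num.sqrt (n.+1%:R : R))%:E)%E.
  by rewrite mule_ge0 ?poweR_ge0 ?lee_fin ?sqrtr_ge0.
(* An infinite moment would make its own term, hence the whole series, infinite. *)
have mfin n : (hausdorff_moment mu n < +oo)%E.
  rewrite ltNge leye_eq; apply/negP => /eqP E; move: sumV.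
  rewrite (@nneseries_pinfty _ _ _ n) ?ltxx // E poweRyr ?gt_eqF // gt0_mulye // lte_fin.
pose m n := fine (hausdorff_moment mu n).
have mE n : hausdorff_moment mu n = (m n)%:E by exact: fin_moment.
have m0 n : 0 <= m n by rewrite -lee_fin -mE hausdorff_moment_ge0.
pose V n := m n `^ s * Num.sqrt n.+1%:R.
have V0 n : 0 <= V n by rewrite mulr_ge0 ?powR_ge0 ?sqrtr_ge0.
have [S SV] : exists S, forall N, \sum_(n < N) V n <= S.
  pose T := (\sum_(0 <= n <oo) (hausdorff_moment mu n `^ s * (Num.sqrt (n.+1%:R : R))%:E))%E.
  have TT : T \is a fin_num by rewrite ge0_fin_numE //; exact: nneseries_ge0.
  exists (fine T) => N; rewrite -lee_fin fineK // -sumEFin.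
  apply: le_trans (@nneseries_lim_ge _ _ xpredT 0%N N (fun n _ _ => T0 n)).
  rewrite big_mkord; apply: lee_sum => n _; by rewrite mE.
have S0 : 0 <= S by rewrite (le_trans _ (SV 0%N)) // big_ord0.
(* Bounded moments keep the multiplied coefficients those of an entire function, as
   [hausdorff_fseries] requires. *)
have mb n : m n <= S `^ s^-1.
  have mS : m n `^ s <= S.
    apply: le_trans (SV n.+1); rewrite big_ord_recr /= (@le_trans _ _ (V n)) //.
      by rewrite /V ler_peMr ?powR_ge0.
    by rewrite lerDr; exact: sumr_ge0.
  have E : m n = (m n `^ s) `^ s^-1 by rewrite -powRrM mulfV ?gt_eqF // powRr1.
  rewrite E.
  by apply: ge0_ler_powR; rewrite ?nnegrE ?powR_ge0 ?invr_ge0 ?(ltW s0).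
have [K K0 KP] := integral_pw_powR q0 q1.
have c0 := discarea_gt0 al0.
(* [discarea al * K] comes from the integrals of the weights, [1 + S] from [powR_hoelder], and the
   last factor from [bessel], which bounds the sum of [bw al a n] by [2 * J / discarea al]. *)
pose Kc := discarea al * K * (1 + S) * (2 / discarea al) `^ q.
have Kc0 : 0 < Kc.
  by rewrite !mulr_gt0 ?ltr_wpDr ?powR_gt0 ?divr_gt0.
have main f : fock al 2 f -> exists J, [/\ 0 <= J, dint al 1 f = J%:E,
    (forall z, cintegrable mu `]0%R, +oo[ (hausdorff_integrand f z)),
    entire (hausdorff mu f) & (dint al q (hausdorff mu f) <= (Kc * J `^ q)%:E)%E].
  move=> [ef nf]; have [J J0] := fock_norm_fin al0 (ltr0n R 2) nf.
  rewrite divff // => fJ; exists J.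
  have [a fa] := entire_fseries ef.
  have [HI HF] : (forall z, cintegrable mu `]0%R, +oo[ (hausdorff_integrand f z)) /\
      fseries (hausdorff mu f) (fun n => a n * (m n)%:C%C).
    apply: hausdorff_fseries => // r rp; have [M MP] := fseries_ecoef fa rp.
    exists (M * S `^ s^-1) => n.
    rewrite cmodM cmod_real ger0_norm // mulrAC ler_pM ?mulr_ge0 ?cmod_ge0 ?exprn_ge0 //.
    exact: ltW.
  split; [exact: J0|exact: fJ|exact: HI|exact: (fseries_entire HF)|].
  set b := fun n => a n * (m n)%:C%C in HF.
  pose X := 2 * J / discarea al.
  have X0 : 0 <= X by rewrite divr_ge0 ?mulr_ge0 // ltW.
  have SX N : \sum_(n < N) bw al a n <= X.
    rewrite ler_pdivlMr // mulr_suml -lee_fin EFinM -fJ; exact: bessel.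
  (* Fatou's lemma reduces the estimate to the partial sums of the image, with a bound independent
     of [N]. *)
  apply: (@fatou_le _ _ R _ (fun N w => (dens al (coefsum b N) (wc w) `^ q)%:E)).
  - move=> N; apply: measurable_powR_dens; first exact: cmeasurable_wc.
    by apply: cmeasurable_coefsum; exact: cmeasurable_wc.
  - by move=> N w; rewrite lee_fin powR_ge0.
  - move=> w; apply: cvg_EFin; first exact: nearW.
    apply: (cvg_powR q0 (ltW q1)) => [N||]; [exact: dens_ge0|exact: dens_ge0|].
    have [H1 H2] := cvg_fseries (wc w) HF.
    apply: cvgMl; rewrite cmod_sqr (_ : (fun N => _) =
      (fun N => complex.Re (coefsum b N (wc w)) ^+ 2 + complex.Im (coefsum b N (wc w)) ^+ 2)).
      by apply: cvgD; rewrite !expr2; [exact: (cvgM H1 H1)|exact: (cvgM H2 H2)].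
    by apply/funext => N; rewrite cmod_sqr.
  - move=> N; rewrite -/(dint al q (coefsum b N)).
    apply: le_trans (dint_coefsum al0 b N q0 (ltW q1)) _.
    apply: (@le_trans _ _ (\sum_(n < N) (discarea al * K * (bw al a n `^ q * V n `^ (1 - q)))%:E)%E).
      apply: lee_sum => n _.
      apply: (@le_trans _ _ ((bw al b n `^ q)%:E * ((discarea al)%:E *
         (K * (Num.sqrt n.+1%:R) `^ (1 - q))%:E))%E).
        rewrite lee_wpmul2l ?lee_fin ?powR_ge0 // lee_wpmul2l ?lee_fin ?(ltW c0) //.
      rewrite -!EFinM lee_fin.
      have -> : bw al b n = bw al a n * m n ^+ 2.
        by rewrite /bw /b cmodM cmod_real exprMn ger0_norm //; ring.
      have -> : V n `^ (1 - q) = (m n ^+ 2) `^ q * Num.sqrt n.+1%:R `^ (1 - q).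
        rewrite /V powRM ?powR_ge0 ?sqrtr_ge0 //; congr (_ * _).
        by rewrite -powRrM se -powR_mulrn // -powRrM /q mulrCA mulfV ?mulr1.
      rewrite powRM ?bw_ge0 ?sqr_ge0 // le_eqVlt; apply/orP; left; apply/eqP; ring.
    rewrite sumEFin lee_fin -mulr_sumr.
    have E : Kc * J `^ q = discarea al * K * (X `^ q * (1 + S)).
      rewrite /Kc /X (_ : 2 * J / discarea al = 2 / discarea al * J); last by rewrite mulrAC.
      have d2 : 0 <= 2 / discarea al by rewrite divr_ge0 // ltW.
      by rewrite (powRM q d2 J0); ring.
    rewrite E ler_wpM2l ?mulr_ge0 ?(ltW c0) ?(ltW K0) //.
    apply: le_trans (powR_hoelder q0 q1 (bw_ge0 al0 a) V0 (SX N)) _.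
    by rewrite ler_wpM2l ?powR_ge0 // lerD2l.
split.
- by move=> f /main [J []].
- move=> f /main [J [J0 _ _ eH dH]]; split=> //.
  by apply: le_lt_trans (fock_norm_le al0 p0 dH) _; exact: ltry.
- exists ((fockc al p * Kc) `^ p^-1 / (fockc al 2) `^ 2^-1).
    by apply: divr_gt0; apply: powR_gt0; [apply: mulr_gt0 => //|]; exact: fockc_gt0.
  move=> f /main [J [J0 fJ _ _ dH]].
  exact: fock_norm_bound (ltW Kc0) J0 fJ dH.
Qed.

End Sufficiency.

(** * Random signs *)

Section Khintchine.
Variable R : realType.
Local Notation C := R[i].
Implicit Types (e : nat -> R) (x : nat -> C) (q : R).

Definition upd e N s : nat -> R := fun n => if n == N then s else e n.

(** All [2 ^ N] patterns of signs in the first [N] places. The later entries stay 1, so that a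
    pattern is a full sequence whatever [N]. *)
Fixpoint signs N : seq (nat -> R) :=
  if N is N'.+1 then [seq upd e N' 1 | e <- signs N'] ++ [seq upd e N' (-1) | e <- signs N']
  else [:: fun=> 1].

Lemma size_signs N : size (signs N) = (2 ^ N)%N.
Proof. by elim: N => // N IH; rewrite /= size_cat !size_map IH expnS mul2n addnn. Qed.

Lemma sum_signs_const N (k : R) : \sum_(e <- signs N) k = 2 ^+ N * k.
Proof.
by rewrite big_const_seq count_predT size_signs iter_addr_0 -natrX mulr_natl.
Qed.

(** Assuming the bound for all sequences of modulus 1, and not just for the members of [signs N],
    lets the induction apply to [F (upd e N s)]. *)
Lemma sum_signs_le N (F : (nat -> R) -> \bar R) (B : R) :
  (forall e, (forall n, `|e n| = 1) -> (F e <= B%:E)%E) ->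
  (\sum_(e <- signs N) F e <= (2 ^+ N * B)%:E)%E.
Proof.
elim: N F => [|N IH] F FB.
  by rewrite big_seq1 expr0 mul1r; apply: FB => n; rewrite normr1.
have U s : `|s| = 1 -> (\sum_(e <- signs N) F (upd e N s) <= (2 ^+ N * B)%:E)%E.
  by move=> s1; apply: IH => e e1; apply: FB => n; rewrite /upd; case: eqP.
rewrite big_cat !big_map /= exprS -mulrA mulr_natl mulr2n EFinD leeD //; apply: U.
  by rewrite normr1.
by rewrite normrN1.
Qed.

Definition rsum e x N : C := \sum_(n < N) (e n)%:C%C * x n.

Lemma rsum_upd e x N s : rsum (upd e N s) x N.+1 = rsum e x N + s%:C%C * x N.
Proof.
rewrite /rsum big_ord_recr /= /upd eqxx; congr (_ + _); apply: eq_bigr => i _.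
by rewrite ltn_eqF.
Qed.

Lemma big_signs (G : C -> R) x N : \sum_(e <- signs N.+1) G (rsum e x N.+1) =
  \sum_(e <- signs N) (G (rsum e x N + x N) + G (rsum e x N - x N)).
Proof.
rewrite big_cat !big_map big_split /=; congr (_ + _); apply: eq_bigr => e _; rewrite rsum_upd.
  by rewrite mul1r.
by rewrite rmorphN mulN1r.
Qed.

Lemma parallelogram (u v : C) :
  cmod (u + v) ^+ 2 + cmod (u - v) ^+ 2 = 2 * cmod u ^+ 2 + 2 * cmod v ^+ 2.
Proof. by case: u v => [a b] [c d]; rewrite !cmod_sqr /=; ring. Qed.

(** With [S = |u|^2 + |v|^2] and [t = 2 (a c + b d)] the left side is [2 S^2 + 2 t^2]. Lagrange's
    identity, with remainder [(a d - b c)^2], gives [t^2 <= 4 |u|^2 |v|^2]. *)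
Lemma parallelogram4 (u v : C) : cmod (u + v) ^+ 4 + cmod (u - v) ^+ 4 <=
  2 * cmod u ^+ 4 + 12 * (cmod u ^+ 2 * cmod v ^+ 2) + 2 * cmod v ^+ 4.
Proof.
rewrite !(exprM _ 2 2); case: u v => [a b] [c d]; rewrite !cmod_sqr /=.
have := sqr_ge0 (a * d - b * c); nra.
Qed.

Lemma signs_moment2 x N : \sum_(e <- signs N) cmod (rsum e x N) ^+ 2 =
  2 ^+ N * \sum_(n < N) cmod (x n) ^+ 2.
Proof.
elim: N => [|N IH].
  by rewrite big_seq1 /rsum !big_ord0 cmod0 expr0n mulr0.
rewrite (big_signs (fun z => cmod z ^+ 2)); under eq_bigr do rewrite parallelogram.
rewrite big_split /= -mulr_sumr IH sum_signs_const.
by rewrite big_ord_recr /= (exprS 2 N); ring.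
Qed.

(** The induction dictates the constant 3: the cross term 12 of [parallelogram4] has to be matched
    by [2 * 3 * 2]. *)
Lemma signs_moment4 x N : \sum_(e <- signs N) cmod (rsum e x N) ^+ 4 <=
  2 ^+ N * (3 * (\sum_(n < N) cmod (x n) ^+ 2) ^+ 2).
Proof.
elim: N => [|N IH].
  by rewrite big_seq1 /rsum !big_ord0 cmod0 expr0n /= expr0n /= !mulr0.
rewrite (big_signs (fun z => cmod z ^+ 4)).
apply: le_trans (ler_sum _ (fun e _ => parallelogram4 _ _)) _.
rewrite !big_split /= sum_signs_const -!mulr_sumr -mulr_suml signs_moment2.
rewrite big_ord_recr /= (exprS 2 N); set S := \sum_(i < N) _; set y := cmod (x N).
have y4 : y ^+ 4 = (y ^+ 2) ^+ 2 by rewrite -exprM.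
have P : 0 <= 2 ^+ N :> R by rewrite exprn_ge0.
have Y : 0 <= 2 ^+ N * (y ^+ 2) ^+ 2 by rewrite mulr_ge0 ?sqr_ge0.
rewrite y4; move: IH; rewrite -/S; move: (\sum_(e <- _) _) => T IH.
have -> : 2 * 2 ^+ N * (3 * (S + y ^+ 2) ^+ 2) = 2 * (2 ^+ N * (3 * S ^+ 2)) +
  12 * (2 ^+ N * S * y ^+ 2) + 6 * (2 ^+ N * (y ^+ 2) ^+ 2) by ring.
have -> : 2 ^+ N * (2 * (y ^+ 2) ^+ 2) = 2 * (2 ^+ N * (y ^+ 2) ^+ 2) by ring.
lra.
Qed.

Lemma powR_ge_quadratic q y : 0 < q -> q <= 1 -> 0 <= y -> y - y ^+ 2 <= y `^ q.
Proof.
move=> q0 q1 y0; have [y1|y1] := leP y 1; last first.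
  by rewrite (le_trans _ (powR_ge0 _ _))// subr_le0 expr2 ler_peMr // ltW.
rewrite (@le_trans _ _ y) //; first by rewrite gerBl sqr_ge0.
have [->|yn] := eqVneq y 0; first by rewrite powR_ge0.
have yp : 0 < y by rewrite lt_neqAle eq_sym yn.
rewrite -{1}(powR_splitM q yp) ler_piMr ?powR_ge0 //.
have := @ge0_ler_powR R (1 - q); rewrite subr_ge0 => /(_ q1 y 1).
by rewrite !nnegrE powR1; apply.
Qed.

(* [y^q >= y - y^2] at [y = |sum|^2 / (6 S)], with the second and fourth moments; the
   scale 6 makes the mean of the right-hand side positive. *)
Lemma khintchine q x N : 0 < q -> q <= 1 ->
  2 ^+ N / 12 * (\sum_(n < N) cmod (x n) ^+ 2) `^ q <=
  \sum_(e <- signs N) (cmod (rsum e x N) ^+ 2) `^ q.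
Proof.
move=> q0 q1; set S := \sum_(n < N) _.
have S0 : 0 <= S by apply: sumr_ge0 => n _; exact: sqr_ge0.
have [SE|Sn] := eqVneq S 0.
  by rewrite SE powR0 ?gt_eqF // mulr0 sumr_ge0 // => e _; exact: powR_ge0.
have Sp : 0 < S by rewrite lt_neqAle eq_sym Sn.
have H e : S `^ q * (cmod (rsum e x N) ^+ 2 / (6 * S) - cmod (rsum e x N) ^+ 4 / (36 * S ^+ 2)) <=
    (cmod (rsum e x N) ^+ 2) `^ q.
  set y := cmod _; have y0 : 0 <= y ^+ 2 / (6 * S) by rewrite divr_ge0 ?sqr_ge0 ?mulr_ge0.
  have -> : y ^+ 4 / (36 * S ^+ 2) = (y ^+ 2 / (6 * S)) ^+ 2 by field.
  apply: le_trans (ler_wpM2l (powR_ge0 _ _) (powR_ge_quadratic q0 q1 y0)) _.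
  rewrite -powRM //; apply: ge0_ler_powR; rewrite ?nnegrE ?(ltW q0) ?(mulr_ge0 S0 y0) ?sqr_ge0 //.
  have -> : S * (y ^+ 2 / (6 * S)) = y ^+ 2 / 6 by field.
  by rewrite ler_pdivrMr // ler_peMr ?sqr_ge0 // ler1n.
apply: le_trans (ler_sum _ (fun e _ => H e)).
rewrite -mulr_sumr sumrB -!mulr_suml signs_moment2 -/S.
have M4 := signs_moment4 x N; rewrite -/S in M4.
rewrite mulrC ler_wpM2l ?powR_ge0 //.
(* In the mean the quadratic term contributes [1/6] and the quartic one at most [3/36 = 1/12]; their
   difference is the constant of the statement. *)
have H4 : (\sum_(e <- signs N) cmod (rsum e x N) ^+ 4) / (36 * S ^+ 2) <= 2 ^+ N / 12.
  rewrite ler_pdivrMr ?mulr_gt0 ?exprn_gt0 // (le_trans M4)//.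
  by rewrite le_eqVlt; apply/orP; left; apply/eqP; field.
have -> : 2 ^+ N * S / (6 * S) = 2 * (2 ^+ N / 12) by field.
lra.
Qed.

End Khintchine.

(** * Summability of the moments from boundedness *)

Section Polynomials.
Variable R : realType.
Local Notation C := R[i].
Implicit Types (c : nat -> C).

Definition trunc c N : nat -> C := fun n => if (n < N)%N then c n else 0.

Lemma coefsum_trunc c N n z : (N <= n)%N -> coefsum (trunc c N) n z = coefsum c N z.
Proof.
move=> Nn; rewrite /coefsum -(subnKC Nn) big_split_ord /= [X in _ + X]big1 ?addr0.
  by apply: eq_bigr => i _; rewrite /trunc ltn_ord.
by move=> i _; rewrite /trunc ltnNge leq_addr mul0r.
Qed.

Lemma ecoef_trunc c N : ecoef (trunc c N).
Proof.
move=> r r0; exists (\sum_(k < N) cmod (c k) * r ^+ k) => n.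
have P k : 0 <= cmod (c k) * r ^+ k by rewrite mulr_ge0 ?cmod_ge0 // exprn_ge0 // ltW.
rewrite /trunc; case: ifP => nN; last by rewrite cmod0 mul0r sumr_ge0.
by rewrite (bigD1 (Ordinal nN)) //= lerDl sumr_ge0.
Qed.

Lemma fseries_coefsum c N : fseries (coefsum c N) (trunc c N).
Proof.
have [g gc] := ecoef_fseries (ecoef_trunc c N).
suff -> : coefsum c N = g by [].
apply/funext => z; have [M M0 MP] := fseries_cvg z gc.
apply/esym/eqP; rewrite -subr_eq0 -cmod_eq0 eq_le cmod_ge0 andbT.
apply/ler_addgt0Pr => e e0; rewrite add0r; have [n nP] := eps_pow2 M e0.
have := MP (N + n)%N; rewrite coefsum_trunc ?leq_addr // => H.
rewrite (le_trans H)// (le_trans _ nP)// ler_wpM2l // lef_pV2 ?posrE ?exprn_gt0 //.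
by rewrite ler_weXn2l ?ler1n // leq_addl.
Qed.

Lemma entire_coefsum c N : entire (coefsum c N).
Proof. exact: fseries_entire (@fseries_coefsum c N). Qed.

End Polynomials.

Section PolynomialNorms.
Variables (R : realType) (al : R).
Hypothesis al0 : 0 < al.
Local Notation C := R[i].
Local Notation leb := (@lebesgue_measure R).
Local Notation area := (leb \x leb)%E.
Local Notation RR := (measurableTypeR R * measurableTypeR R)%type.
Implicit Types (b c : nat -> C) (q : R).

Lemma dint1_coefsum c N :
  (dint al 1 (coefsum c N) <= (discarea al * \sum_(n < N) bw al c n)%:E)%E.
Proof.
apply: le_trans (dint_coefsum al0 c N ltr01 (lexx _)) _.
rewrite mulr_sumr -sumEFin; apply: lee_sum => n _.
rewrite -(area_pw_powR al0).
have -> : (\int[area]_w (pw n (sqnorm al w) `^ 1)%:E = (discarea al)%:E)%E.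
  rewrite -(area_pw al0 n); apply: eq_integral => w _; rewrite powRr1 //.
  by apply: pw_ge0; exact: sqnorm_ge0.
by rewrite -EFinM powRr1 ?bw_ge0 // mulrC.
Qed.

Lemma fock_coefsum c N : fock al 2 (coefsum c N).
Proof.
split; first exact: entire_coefsum.
apply: le_lt_trans (fock_norm_le al0 _ (_ : (_ <= (discarea al * \sum_(n < N) bw al c n)%:E)%E)) _ => //.
  by rewrite divff //; exact: dint1_coefsum.
exact: ltry.
Qed.

Lemma signs_lower_bound q b N B : 0 < q -> q <= 1 ->
  (forall e : nat -> R, (forall n, `|e n| = 1) ->
    (dint al q (coefsum (fun n => (e n)%:C%C * b n)%R N) <= B%:E)%E) ->
  discarea al / 12 * \sum_(n < N) bw al b n `^ q <= B.
Proof.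
move=> q0 q1 HB.
pose f (e : nat -> R) := coefsum (fun n => (e n)%:C%C * b n) N.
have mf e : measurable_fun setT (fun w : RR => (dens al (f e) (wc w) `^ q)%:E).
  apply: measurable_powR_dens; first exact: cmeasurable_wc.
  by apply: cmeasurable_coefsum; exact: cmeasurable_wc.
have P0 : 0 < 2 ^+ N :> R by rewrite exprn_gt0.
have c0 := discarea_gt0 al0.
have pt (w : RR) : 2 ^+ N / 12 * \sum_(n < N) bw al b n `^ q * pw n (sqnorm al w) <=
    \sum_(e <- signs R N) dens al (f e) (wc w) `^ q.
  pose x n := b n * wc w ^+ n.
  (* The Gaussian factor does not depend on the signs; put back inside the power after Khintchine's
     inequality, it turns [cmod (x n) ^+ 2] into [bw al b n] times a Poisson weight. *)
  have E e : dens al (f e) (wc w) `^ q = (cmod (rsum e x N) ^+ 2) `^ q * gauss al (wc w) `^ q.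
    rewrite /dens powRM ?sqr_ge0 //; last by exact/ltW/gauss_gt0.
    congr ((cmod _ ^+ 2) `^ _ * _); rewrite /f /coefsum /rsum; apply: eq_bigr => n _.
    by rewrite /x mulrA.
  under [X in _ <= X]eq_bigr do rewrite E; rewrite -mulr_suml.
  have g0 := ltW (gauss_gt0 al (wc w)).
  apply: le_trans (ler_wpM2r (powR_ge0 _ _) (khintchine x N q0 q1)).
  have S0 : 0 <= \sum_(n < N) cmod (x n) ^+ 2 by apply: sumr_ge0 => n _; exact: sqr_ge0.
  rewrite -[leRHS]mulrA -(powRM q S0 g0) ler_wpM2l ?divr_ge0 ?(ltW P0) //.
  have -> : (\sum_(n < N) cmod (x n) ^+ 2) * gauss al (wc w) =
      \sum_(n < N) bw al b n * pw n (sqnorm al w).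
    rewrite mulr_suml; apply: eq_bigr => n _.
    rewrite /x cmodM cmodX exprMn -exprM [(n * 2)%N]mulnC -mulrA pw_sqnorm // /bw.
    by rewrite !mulrA.
  apply: (@powR_jensen R q N (bw al b) (fun n => pw n (sqnorm al w))) => //.
  - by move=> n; exact: bw_ge0.
  - by move=> n; apply: pw_ge0; exact: sqnorm_ge0.
  - by apply: sum_pw_le1; exact: sqnorm_ge0.
have I1 : (\int[area]_w (\sum_(e <- signs R N) (dens al (f e) (wc w) `^ q)%:E) <= (2 ^+ N * B)%:E)%E.
  rewrite ge0_integral_sum //; first exact: sum_signs_le.
  by move=> e w _; rewrite lee_fin powR_ge0.
have I2 : (\int[area]_w (2 ^+ N / 12 * \sum_(n < N) bw al b n `^ q * pw n (sqnorm al w))%:E <=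
    \int[area]_w (\sum_(e <- signs R N) (dens al (f e) (wc w) `^ q)%:E))%E.
  apply: ge0_le_integral => //.
  - move=> w _; rewrite lee_fin mulr_ge0 ?divr_ge0 ?(ltW P0) //; apply: sumr_ge0 => n _.
    by rewrite mulr_ge0 ?powR_ge0 // pw_ge0 // sqnorm_ge0.
  - apply/measurable_EFinP; apply: measurable_funM => //; apply: measurable_sum => n.
    by apply: measurable_funM => //; exact: measurable_pw_sqnorm.
  - by apply: emeasurable_sum => e; exact: mf.
  - by move=> w _; rewrite sumEFin lee_fin.
have I3 : (\int[area]_w (2 ^+ N / 12 * \sum_(n < N) bw al b n `^ q * pw n (sqnorm al w))%:E =
    (2 ^+ N / 12 * \sum_(n < N) bw al b n `^ q * discarea al)%:E)%E.
  under eq_integral do rewrite EFinM -sumEFin.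
  rewrite ge0_integralZl //; last 2 first.
  - apply: emeasurable_sum => n; apply/measurable_EFinP.
    by apply: measurable_funM => //; exact: measurable_pw_sqnorm.
  - move=> w _; apply: sume_ge0 => n _; rewrite lee_fin.
    by rewrite mulr_ge0 ?powR_ge0 // pw_ge0 // sqnorm_ge0.
  rewrite [RHS]EFinM -sumEFin; congr (_ * _)%E.
  rewrite ge0_integral_sum //; last 2 first.
  - move=> n; apply/measurable_EFinP.
    by apply: measurable_funM => //; exact: measurable_pw_sqnorm.
  - by move=> n w _; rewrite lee_fin mulr_ge0 ?powR_ge0 // pw_ge0 // sqnorm_ge0.
  apply: eq_bigr => n _; under eq_integral do rewrite EFinM.
  rewrite ge0_integralZl ?area_pw // ?lee_fin ?powR_ge0 //.
  - by apply/measurable_EFinP; exact: measurable_pw_sqnorm.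
  - by move=> w _; rewrite lee_fin pw_ge0 // sqnorm_ge0.
have := le_trans I2 I1; rewrite I3 lee_fin -mulr_suml -mulrA ler_pM2l //.
by rewrite [_ * discarea al]mulrC mulrA [_ * discarea al]mulrC.
Qed.

End PolynomialNorms.

Section Necessity.
Variables (R : realType) (al p : R) (mu : {measure set (measurableTypeR R) -> \bar R}).
Hypotheses (al0 : 0 < al) (p0 : 0 < p) (p2 : p < 2).
Local Notation C := R[i].
Local Notation s := (2 * p / (2 - p)).

(** At [z = 1] the integrand of the monomial is [t^-(n+1)], so its integrability is finiteness of
    the moment. *)
Lemma moment_finite n :
  cintegrable mu `]0%R, +oo[ (hausdorff_integrand (fun z : C => z ^+ n) 1) ->
  (hausdorff_moment mu n < +oo)%E.
Proof.
move=> [/integrableP[_ H] _]; apply: le_lt_trans H; rewrite le_eqVlt; apply/orP; left; apply/eqP.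
apply: eq_integral => t; rewrite inE /= in_itv /= andbT => t0.
have -> : hausdorff_integrand (fun z : C => z ^+ n) 1 t = ((t ^+ n.+1)^-1)%:C%C.
  by rewrite /hausdorff_integrand mul1r fmorphV rmorphXn /= exprS exprVn invfM mulrC.
by rewrite /= ger0_norm // invr_ge0 exprn_ge0 // ltW.
Qed.

Lemma hausdorff_necessary : hausdorff_bounded mu al 2 p ->
  (\sum_(0 <= n <oo) hausdorff_moment mu n `^ s < +oo)%E.
Proof.
move=> [HI HF [K K0 HK]]; have s0 := expo_gt0 p0 p2; have se := @expo_eq R p p2.
pose q := p / 2; have q0 : 0 < q by rewrite divr_gt0.
have q1 : q < 1 by rewrite ltr_pdivrMr // mul1r.
have mfin n : (hausdorff_moment mu n < +oo)%E.
  apply: moment_finite; apply: HI.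
  have -> : (fun z : C => z ^+ n) = coefsum (fun k => (k == n)%:R) n.+1.
    apply/funext => z; rewrite coefsumS eqxx mul1r /coefsum big1 ?add0r // => i _.
    by rewrite ltn_eqF // mul0r.
  exact: fock_coefsum.
pose m n := fine (hausdorff_moment mu n).
have mE n : hausdorff_moment mu n = (m n)%:E by exact: fin_moment.
have m0 n : 0 <= m n by rewrite -lee_fin -mE hausdorff_moment_ge0.
pose V n := m n `^ s.
have V0 n : 0 <= V n by exact: powR_ge0.
have an0 n : al ^+ n != 0 by rewrite expf_neq0 // gt_eqF.
have fn0 n : n`!%:R != 0 :> R by rewrite gt_eqF // fact_gt0R.
have c0 := discarea_gt0 al0.
(* Chosen so that [bw] takes the value [V n] at every choice of signs. *)
pose c n : C := (Num.sqrt (V n * al ^+ n / n`!%:R))%:C%C.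
pose b n : C := c n * (m n)%:C%C.
have cb e n : `|e n| = 1 -> bw al (fun n => (e n)%:C%C * c n) n = V n.
  move=> e1; rewrite /bw cmodM !cmod_real e1 mul1r real_normK ?num_real // sqr_sqrtr; last first.
    by rewrite !mulr_ge0 ?exprn_ge0 ?invr_ge0 ?(ltW al0).
  by field; rewrite an0 fn0.
(* The image has [V n * m n ^+ 2 = m^(s + 2)], and [(s + 2) q = s]: both sides of the boundedness
   estimate involve the same sum. *)
have bb n : bw al b n `^ q = V n.
  have -> : bw al b n = V n * m n ^+ 2.
    rewrite /bw /b cmodM !cmod_real exprMn !real_normK ?num_real // sqr_sqrtr; last first.
      by rewrite !mulr_ge0 ?exprn_ge0 ?invr_ge0 ?(ltW al0).
    by field; rewrite an0 fn0.
  rewrite powRM ?sqr_ge0 // /V -[m n ^+ 2]powR_mulrn // -!powRrM -powRD.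
    congr (_ `^ _); have e2 : 2 * q = p by rewrite /q; field.
    by rewrite e2; move: se; rewrite -/q; move: (s) => x; lra.
  by rewrite gt_eqF // (addr_gt0 (mulr_gt0 s0 q0) (mulr_gt0 (ltr0Sn R 1) q0)).
(* The first factor inverts the constant of [signs_lower_bound], the middle ones come from
   [dint_bound], and the last from the bound [discarea al * S] on the integral of the test
   function. *)
pose A := 12 / discarea al * ((fockc al p)^-1 * (K * (fockc al 2) `^ 2^-1) `^ p * (discarea al) `^ q).
have key N : \sum_(n < N) V n <= A * (\sum_(n < N) V n) `^ q.
  set S := \sum_(n < N) V n; have S0 : 0 <= S by exact: sumr_ge0.
  have : discarea al / 12 * \sum_(n < N) bw al b n `^ q <=
     (fockc al p)^-1 * (K * (fockc al 2) `^ 2^-1) `^ p * (discarea al * S) `^ q.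
    apply: (signs_lower_bound al0 q0 (ltW q1)) => e e1.
    pose f := coefsum (fun n => (e n)%:C%C * c n) N.
    have ff : fock al 2 f by exact: fock_coefsum.
    have Hf : hausdorff mu f = coefsum (fun n => (e n)%:C%C * b n) N.
      have E : (fun n => trunc (fun n => (e n)%:C%C * c n) N n * (m n)%:C%C) =
          trunc (fun n => (e n)%:C%C * b n) N.
        by apply/funext => n; rewrite /trunc; case: ifP; rewrite ?mul0r // mulrA.
      have ec := ecoef_trunc (fun n => (e n)%:C%C * b n) N; rewrite -E in ec.
      have [_ H] := hausdorff_fseries mE (fseries_coefsum (fun n => (e n)%:C%C * c n) N) ec.
      rewrite E in H; apply/funext.
      exact: fseries_ext H (fseries_coefsum _ N).
    rewrite -Hf; apply: (@dint_bound R al al0 p f _ K _ p0 (ltW K0)).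
    - by rewrite mulr_ge0 // ltW.
    - apply: le_trans (dint1_coefsum al0 _ N) _; rewrite -/S.
      by rewrite lee_fin ler_wpM2l ?(ltW c0) //; apply: ler_sum => n _; rewrite cb.
    - exact: HK.
  under eq_bigr do rewrite bb; rewrite -/S (powRM _ (ltW c0) S0) => H.
  rewrite -[leLHS](_ : 12 / discarea al * (discarea al / 12 * S) = S); last by field; rewrite gt_eqF.
  rewrite [leRHS](_ : _ = 12 / discarea al * ((fockc al p)^-1 *
    (K * fockc al 2 `^ 2^-1) `^ p * (discarea al `^ q * S `^ q))); last by rewrite /A; ring.
  by rewrite ler_wpM2l // divr_ge0 // ltW.
(* Dividing [S <= A * S^q] by [S^q] is legitimate because the partial sum [S] is finite; the
   resulting bound is independent of [N]. *)
have bnd N : \sum_(n < N) V n <= A `^ (1 - q)^-1.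
  have := key N; set S := \sum_(n < N) V n => SA; have S0 : 0 <= S by exact: sumr_ge0.
  have [->|Sn] := eqVneq S 0; first exact: powR_ge0.
  have Sp : 0 < S by rewrite lt_neqAle eq_sym Sn.
  have q' : 0 < 1 - q by rewrite subr_gt0.
  have E : S = (S `^ (1 - q)) `^ (1 - q)^-1 by rewrite -powRrM mulfV ?gt_eqF // powRr1.
  have A0 : 0 <= A by rewrite -(ler_pM2r (powR_gt0 q Sp)) mul0r (le_trans S0).
  rewrite E; apply: ge0_ler_powR; rewrite ?nnegrE ?powR_ge0 ?invr_ge0 ?(ltW q') //.
  by rewrite -(ler_pM2l (powR_gt0 q Sp)) powR_splitM // mulrC.
apply: (@le_lt_trans _ _ (A `^ (1 - q)^-1)%:E); last exact: ltry.
apply: lime_le; first by apply: is_cvg_nneseries => n _ _; exact: poweR_ge0.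
apply: nearW => N; rewrite big_mkord.
by under eq_bigr do rewrite mE poweR_EFin; rewrite sumEFin lee_fin.
Qed.

End Necessity.

Local Open Scope ereal_scope.

Theorem theorem5p4 (R : realType) (alpha p : R)
    (mu : {measure set (measurableTypeR R) -> \bar R})
    (halpha : (0 < alpha)%R) (hp0 : (0 < p)%R) (hp2 : (p < 2)%R) :
  (\sum_(0 <= n <oo) (hausdorff_moment mu n `^ (2 * p / (2 - p)) *
       (Num.sqrt (n.+1%:R : R))%:E) < +oo ->
     hausdorff_bounded mu alpha 2 p) /\
  (hausdorff_bounded mu alpha 2 p ->
     \sum_(0 <= n <oo) hausdorff_moment mu n `^ (2 * p / (2 - p)) < +oo).
Proof.
split; first exact: hausdorff_sufficient.
exact: hausdorff_necessary.
Qed.
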